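(* Let $F_T:\widehat T\to T\subset\mathbb R^3$ be the regular element maps of a conforming curved triangulation of an oriented surface, and set $J=DF_T$, $G=J^TJ$, $J_\Gamma=\sqrt{\det G}$. Let $\hat u$ (scalar), $\hat v$ and $\hat w$ (vector fields) be smooth reference fields on $\widehat T$, mapped by $u\circ F_T=\hat u$, $v\circ F_T=JG^{-1}\hat v$ and $w\circ F_T=J_\Gamma^{-1}J\hat w$. Then $$\nabla_\Gamma u\circ F_T=JG^{-1}\widehat\nabla\hat u,\qquad \mathrm{curl}_\Gamma v\circ F_T=J_\Gamma^{-1}\,\widehat{\mathrm{curl}}\,\hat v,\qquad \mathrm{div}_\Gamma w\circ F_T=J_\Gamma^{-1}\,\widehat{\mathrm{div}}\,\hat w,$$ and the mapped constraint spaces form a de Rham subcomplex on the conforming curved triangulation.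
   Context: $\widehat T\subset\mathbb R^2$ is the reference triangle, and $J=[J_1\ J_2]\in\mathbb R^{3\times2}$ has full rank. The surface is oriented by the unit normal $N=(J_1\times J_2)/J_\Gamma$. $\nabla_\Gamma$ and $\mathrm{div}_\Gamma$ are the surface gradient and divergence, and $\mathrm{curl}_\Gamma$ is the scalar surface curl of a tangent field, so that $\int_\omega\mathrm{curl}_\Gamma v=\oint_{\partial\omega}v\cdot\mathrm dx$ with the induced orientation. Hats denote the planar operators on $\widehat T$, with $\widehat{\mathrm{curl}}\,\hat v=\partial_1\hat v_2-\partial_2\hat v_1$. Conforming curved triangulation: the maps $F_T$ are uniformly regular and compatible on shared edges, so that the curved triangles $T=F_T(\widehat T)$ form a conforming triangulation of the surface; for two triangles sharing an edge there are affine parameterizations $\hat\gamma_\pm:[0,1]\to\hat e_\pm$ of the corresponding reference edges with $F_+\circ\hat\gamma_+=F_-\circ\hat\gamma_-$. Mapped constraint spaces, for a degree $d\ge1$ (in each case the polynomials are chosen independently on each triangle and only the stated edge conditions are imposed): - $V_\Gamma^0$: scalars $u\circ F_T=\hat u_T$ with $\hat u_T\in\mathcal P_{d+1}(\widehat T)$, such that the univariate Bernstein coefficients of $\hat u_\pm\circ\hat\gamma_\pm$ agree on every shared edge. - $V^1_{\Gamma,\mathrm{curl}}$: tangent fields $v\circ F_T=JG^{-1}\hat v_T$ with $\hat v_T\in[\mathcal P_d(\widehat T)]^2$, such that the Bernstein coefficients of $(\hat v_\pm\circ\hat\gamma_\pm)\cdot\hat\gamma_\pm'$ agree on every shared edge.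 - $V^1_{\Gamma,\mathrm{div}}$: flux fields $w\circ F_T=J_\Gamma^{-1}J\hat w_T$ with $\hat w_T\in[\mathcal P_d(\widehat T)]^2$, such that the Bernstein coefficients of $(\hat w_\pm\circ\hat\gamma_\pm)\cdot R\hat\gamma_\pm'$ agree on every shared edge, where $R(a,b)=(-b,a)$. - $V_\Gamma^2$: densities $q\circ F_T=J_\Gamma^{-1}\hat q_T$ with $\hat q_T\in\mathcal P_{d-1}(\widehat T)$ and no edge condition. De Rham subcomplex: the mapped spaces lie in $H^1$, $H(\mathrm{curl}_\Gamma)$, $H(\mathrm{div}_\Gamma)$ and $L^2$ of the surface respectively, and the operators in the three identities map between them, namely $\nabla_\Gamma V_\Gamma^0\subset V^1_{\Gamma,\mathrm{curl}}$, $\mathrm{curl}_\Gamma V^1_{\Gamma,\mathrm{curl}}\subset V_\Gamma^2$ and $\mathrm{div}_\Gamma V^1_{\Gamma,\mathrm{div}}\subset V_\Gamma^2$, with $\mathrm{curl}_\Gamma\nabla_\Gamma=0$. *)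

(* Defs.v *)
From HB Require Import structures.
From mathcomp Require Import all_boot all_order all_algebra.
From mathcomp Require Import all_classical all_reals all_analysis.

Set Implicit Arguments.
Unset Strict Implicit.
Unset Printing Implicit Defensive.

Import Order.TTheory GRing.Theory Num.Theory.
Import numFieldNormedType.Exports.

Local Open Scope classical_set_scope.
Local Open Scope ring_scope.

Section vectors.
Context {R : realType}.

Definition dot n (a b : 'cV[R]_n) : R := \sum_k a k 0 * b k 0.

(* Indices are taken modulo 3. *)
Definition cross (a b : 'cV[R]_3) : 'cV[R]_3 :=
  \col_k (a (k + 1) 0 * b (k - 1) 0 - a (k - 1) 0 * b (k + 1) 0).

Definition quarter_turn (a : 'cV[R]_2) : 'cV[R]_2 :=
  \col_k (if k == 0 then - a 1 0 else a 0 0).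

Definition basis (k : 'I_2) : 'cV[R]_2 := delta_mx k 0.

(* Integration over the plane is with respect to the product Lebesgue measure
   on pairs; [pt] reads a pair as a column vector. *)
Definition pt (z : measurableTypeR R * measurableTypeR R) : 'cV[R]_2 :=
  \col_k (if k == 0 then z.1 else z.2).

Definition lebesgue2 :
    {measure set (measurableTypeR R * measurableTypeR R) -> \bar R} :=
  (@lebesgue_measure R \x @lebesgue_measure R)%E.

End vectors.

Section reference_triangle.
Context {R : realType}.

Definition That : set 'cV[R]_2 :=
  [set x | [/\ 0 <= x 0 0, 0 <= x 1 0 & x 0 0 + x 1 0 <= 1]].

Definition vertex (a : 'I_3) : 'cV[R]_2 :=
  \col_k (a == k.+1 :> nat)%:R.

Definition edge_param (a b : 'I_3) (t : R) : 'cV[R]_2 :=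
  (1 - t) *: vertex a + t *: vertex b.

(* The derivative of [edge_param a b]. *)
Definition edge_dir (a b : 'I_3) : 'cV[R]_2 := vertex b - vertex a.

Definition counterclockwise (a b : 'I_3) : bool := b == a + 1.

Definition integral_That (f : 'cV[R]_2 -> R) : R :=
  \int[lebesgue2]_(z in pt @^-1` That) f (pt z).

End reference_triangle.

Section regularity.
Context {R : realType} {W : normedModType R}.

Fixpoint Cn_on (n : nat) (U : set 'cV[R]_2) (f : 'cV[R]_2 -> W) : Prop :=
  if n is m.+1 then
    (forall x, U x -> differentiable f x) /\
    (forall k, Cn_on m U (fun x => 'D_(basis k) f x))
  else forall x, U x -> {for x, continuous f}.

(* Regularity up to the boundary: f is C^n on an open neighbourhood of That. *)
Definition Cn_That (n : nat) (f : 'cV[R]_2 -> W) : Prop :=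
  exists U, [/\ open U, That `<=` U & Cn_on n U f].

Definition smooth_That (f : 'cV[R]_2 -> W) : Prop :=
  exists U, [/\ open U, That `<=` U & forall n, Cn_on n U f].

End regularity.

Section planar_operators.
Context {R : realType}.

Definition grad_hat (f : 'cV[R]_2 -> R) (x : 'cV[R]_2) : 'cV[R]_2 :=
  \col_k 'D_(basis k) f x.

Definition curl_hat (f : 'cV[R]_2 -> 'cV[R]_2) (x : 'cV[R]_2) : R :=
  'D_(basis 0) (fun y => f y 1 0) x - 'D_(basis 1) (fun y => f y 0 0) x.

Definition div_hat (f : 'cV[R]_2 -> 'cV[R]_2) (x : 'cV[R]_2) : R :=
  \sum_k 'D_(basis k) (fun y => f y k 0) x.

End planar_operators.

Section element_map.
Context {R : realType}.
Implicit Types (X F : 'cV[R]_2 -> 'cV[R]_3).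

Definition jac X (x : 'cV[R]_2) : 'M[R]_(3, 2) :=
  \matrix_(i, k) ('D_(basis k) X x) i 0.

Definition gram X x : 'M[R]_2 := (jac X x)^T *m jac X x.

Definition area_density X x : R := Num.sqrt (\det (gram X x)).

Definition unit_normal X x : 'cV[R]_3 :=
  (area_density X x)^-1 *: cross (col 0 (jac X x)) (col 1 (jac X x)).

Definition covariant X x (a : 'cV[R]_2) : 'cV[R]_3 :=
  jac X x *m invmx (gram X x) *m a.

Definition contravariant X x (a : 'cV[R]_2) : 'cV[R]_3 :=
  (area_density X x)^-1 *: (jac X x *m a).

Definition curved_triangle X : set 'cV[R]_3 := X @` That.

Definition regular_map X : Prop :=
  [/\ Cn_That 2 X, {in That &, injective X} &
      forall x, That x -> \rank (jac X x) = 2].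

Definition tangent_at X (p t : 'cV[R]_3) : Prop :=
  exists x a, [/\ That x, X x = p & t = jac X x *m a].

(* Area-formula surface integral over [curved_triangle X] of a density given
   as a function of the parameter. *)
Definition surface_integral X (f : 'cV[R]_2 -> R) : R :=
  integral_That (fun x => f x * area_density X x).

(* Line integral of v . dx along the boundary of [curved_triangle X], in the
   orientation induced by [unit_normal X]. *)
Definition circulation X (v : 'cV[R]_3 -> 'cV[R]_3) : R :=
  \sum_(a < 3) \int[@lebesgue_measure R]_(t in `[0%R, 1%R])
    dot (v (X (edge_param a (a + 1) t)))
        ((fun s => X (edge_param a (a + 1) s))^`()%classic t).

End element_map.

Section surface_operators.
Context {R : realType}.
Variable F : 'cV[R]_2 -> 'cV[R]_3.
Let T := curved_triangle F.

(* The tangent vector g representing the differential at p of the restriction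
   of u to T; at boundary points of T the increments are one-sided. *)
Definition is_surface_grad (u : 'cV[R]_3 -> R) (p g : 'cV[R]_3) : Prop :=
  [/\ T p, tangent_at F p g &
    forall e, 0 < e -> \forall q \near within T (nbhs p),
      `|u q - u p - dot g (q - p)| <= e * `|q - p|].

Definition surface_differentiable u p : Prop :=
  exists g, is_surface_grad u p g.

Definition surface_grad u p : 'cV[R]_3 := get (is_surface_grad u p).

Definition surface_vdifferentiable (w : 'cV[R]_3 -> 'cV[R]_3) p : Prop :=
  forall k, surface_differentiable (fun q => w q k 0) p.

Definition surface_div (w : 'cV[R]_3 -> 'cV[R]_3) p : R :=
  \sum_k surface_grad (fun q => w q k 0) p k 0.

(* [F \o psi] parameterizes, compatibly with the unit normal of F, a curved
   triangular region contained in T. *)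
Definition oriented_subregion (psi : 'cV[R]_2 -> 'cV[R]_2) : Prop :=
  [/\ Cn_That 2 psi, {in That &, injective psi},
      forall x, That x -> That (psi x) &
      forall x, That x ->
        0 < \det (\matrix_(i, k) ('D_(basis k) psi x) i 0)].

(* The continuous density whose integral over every oriented region is the
   circulation along its boundary. *)
Definition is_surface_curl (v : 'cV[R]_3 -> 'cV[R]_3) (c : 'cV[R]_3 -> R) :
    Prop :=
  {within T, continuous c} /\
  forall psi, oriented_subregion psi ->
    surface_integral (F \o psi) (fun x => c (F (psi x))) =
    circulation (F \o psi) v.

Definition has_surface_curl v : Prop := exists c, is_surface_curl v c.

Definition surface_curl v : 'cV[R]_3 -> R := get (is_surface_curl v).

End surface_operators.

Section triangulation.
Context {R : realType} {I : finType}.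
Variable F : I -> 'cV[R]_2 -> 'cV[R]_3.
Let T i := curved_triangle (F i).

Definition surface : set 'cV[R]_3 := \bigcup_i T i.

Definition shared_edge (i : I) (a b : 'I_3) (j : I) (c d : 'I_3) : Prop :=
  [/\ i != j, a != b, c != d &
    forall t, 0 <= t <= 1 -> F i (edge_param a b t) = F j (edge_param c d t)].

Definition boundary_edge (i : I) (a b : 'I_3) : Prop :=
  a != b /\ ~ exists j c d, shared_edge i a b j c d.

Definition meet_conformingly (i j : I) : Prop :=
  [\/ T i `&` T j = set0,
      exists a b, F i (vertex a) = F j (vertex b) /\
                  T i `&` T j = [set F i (vertex a)] |
      exists a b c d, shared_edge i a b j c d /\
        T i `&` T j = (F i \o edge_param a b) @` `[0, 1]].

(* Adjacency of two triangles through an edge having the endpoint p. *)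
Definition star_adjacent (p : 'cV[R]_3) : rel I := fun i j =>
  `[< exists a b c d, shared_edge i a b j c d /\ F i (vertex a) = p >].

Record oriented_triangulation : Prop := OrientedTriangulation {
  triangulation_regular : forall i, regular_map (F i);
  triangulation_uniform : exists m M : R, 0 < m /\
    forall i x a, That x ->
      m * dot a a <= dot (jac (F i) x *m a) (jac (F i) x *m a) <= M * dot a a;
  triangulation_conforming : forall i j, i != j -> meet_conformingly i j;
  (* The union is a topological surface, possibly with boundary. *)
  triangulation_edge : forall i a b j c d k e f,
    shared_edge i a b j c d -> shared_edge i a b k e f -> j = k;
  triangulation_vertex : forall i j a b, F i (vertex a) = F j (vertex b) ->
    connect (star_adjacent (F i (vertex a))) i j;
  (* The unit normals orient the surface: neighbours induce opposite
     orientations on their common edge. *)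
  triangulation_oriented : forall i a b j c d,
    shared_edge i a b j c d -> counterclockwise a b != counterclockwise c d
}.

End triangulation.

(* A field on the surface is a family f, where [f i] gives the field on the
   closed triangle i; fields that jump across an edge are two-valued there. *)
Section function_spaces.
Context {R : realType} {I : finType}.
Variable F : I -> 'cV[R]_2 -> 'cV[R]_3.
Implicit Types (f u q : I -> 'cV[R]_3 -> R)
  (v w g : I -> 'cV[R]_3 -> 'cV[R]_3).

Definition L2 f : Prop := forall i,
  measurable_fun (pt @^-1` That)
    (fun z => f i (F i (pt z)) : measurableTypeR R) /\
  lebesgue2.-integrable (pt @^-1` That)
    (fun z => (f i (F i (pt z)) ^+ 2 * area_density (F i) (pt z))%:E).

Definition tangential v : Prop := forall i x, That x ->
  tangent_at (F i) (F i x) (v i (F i x)).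

Definition L2_tangential v : Prop :=
  tangential v /\ forall k, L2 (fun i p => v i p k 0).

Definition total_integral (f : I -> 'cV[R]_2 -> R) : R :=
  \sum_i surface_integral (F i) (f i).

(* Continuous, piecewise C^1, vanishing on the boundary of the surface. *)
Definition test_function (phi : 'cV[R]_3 -> R) : Prop :=
  [/\ {within surface F, continuous phi},
      forall i, exists2 h, Cn_That 1 h & forall x, That x -> phi (F i x) = h x &
      forall i a b t, boundary_edge F i a b -> 0 <= t <= 1 ->
        phi (F i (edge_param a b t)) = 0].

(* Flux of w across the edge (a, b) of triangle i, against the (unnormalized)
   conormal t x N, where t is the tangent of the parameterized edge. *)
Definition edge_flux w i a b (t : R) : R :=
  dot (w i (F i (edge_param a b t)))
      (cross (jac (F i) (edge_param a b t) *m edge_dir a b)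
             (unit_normal (F i) (edge_param a b t))).

(* Tangential, piecewise C^1, with continuous flux across shared edges and no
   flux through the boundary of the surface. *)
Definition test_field w : Prop :=
  [/\ tangential w,
      forall i, exists2 h : 'cV[R]_2 -> 'cV[R]_3,
        Cn_That 1 h & forall x, That x -> w i (F i x) = h x,
      forall i a b j c d t, shared_edge F i a b j c d -> 0 <= t <= 1 ->
        edge_flux w i a b t = edge_flux w j c d t &
      forall i a b t, boundary_edge F i a b -> 0 <= t <= 1 ->
        edge_flux w i a b t = 0].

Definition weak_grad u g : Prop := forall w, test_field w ->
  total_integral (fun i x => u i (F i x) * surface_div (F i) (w i) (F i x)) =
  - total_integral (fun i x => dot (g i (F i x)) (w i (F i x))).

Definition weak_div w f : Prop := forall phi, test_function phi ->
  total_integral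
    (fun i x => dot (w i (F i x)) (surface_grad (F i) phi (F i x))) =
  - total_integral (fun i x => f i (F i x) * phi (F i x)).

(* grad phi x N is the vector surface curl of phi. *)
Definition weak_curl v f : Prop := forall phi, test_function phi ->
  total_integral
    (fun i x => dot (v i (F i x))
       (cross (surface_grad (F i) phi (F i x)) (unit_normal (F i) x))) =
  total_integral (fun i x => f i (F i x) * phi (F i x)).

Definition H1 u : Prop :=
  L2 u /\ exists2 g, L2_tangential g & weak_grad u g.

Definition Hcurl v : Prop :=
  L2_tangential v /\ exists2 f, L2 f & weak_curl v f.

Definition Hdiv w : Prop :=
  L2_tangential w /\ exists2 f, L2 f & weak_div w f.

End function_spaces.

Section constraint_spaces.
Context {R : realType}.

Definition is_poly (n : nat) (f : 'cV[R]_2 -> R) : Prop :=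
  exists c : nat -> nat -> R, forall x,
    f x = \sum_(i < n.+1) \sum_(j < n.+1 | (i + j <= n)%N)
            c i j * x 0 0 ^+ i * x 1 0 ^+ j.

Definition is_vpoly (n : nat) (f : 'cV[R]_2 -> 'cV[R]_2) : Prop :=
  forall k, is_poly n (fun x => f x k 0).

Definition bernstein_coefs (n : nat) (f : R -> R) (c : 'I_n.+1 -> R) : Prop :=
  forall t, 0 <= t <= 1 ->
    f t = \sum_(k < n.+1) c k * ('C(n, k)%:R * t ^+ k * (1 - t) ^+ (n - k)).

Definition same_bernstein_coefs (n : nat) (f g : R -> R) : Prop :=
  exists2 c : 'I_n.+1 -> R, bernstein_coefs f c & bernstein_coefs g c.

Context {I : finType}.
Variables (F : I -> 'cV[R]_2 -> 'cV[R]_3) (d : nat).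

Definition V0 (u : I -> 'cV[R]_3 -> R) : Prop :=
  exists uh : I -> 'cV[R]_2 -> R,
  [/\ forall i, is_poly d.+1 (uh i),
      forall i x, That x -> u i (F i x) = uh i x &
      forall i a b j a' b', shared_edge F i a b j a' b' ->
        same_bernstein_coefs d.+1 (uh i \o edge_param a b)
                                  (uh j \o edge_param a' b')].

Definition V1curl (v : I -> 'cV[R]_3 -> 'cV[R]_3) : Prop :=
  exists vh : I -> 'cV[R]_2 -> 'cV[R]_2,
  [/\ forall i, is_vpoly d (vh i),
      forall i x, That x -> v i (F i x) = covariant (F i) x (vh i x) &
      forall i a b j a' b', shared_edge F i a b j a' b' ->
        same_bernstein_coefs d
          (fun t => dot (vh i (edge_param a b t)) (edge_dir a b))
          (fun t => dot (vh j (edge_param a' b' t)) (edge_dir a' b'))].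

Definition V1div (w : I -> 'cV[R]_3 -> 'cV[R]_3) : Prop :=
  exists wh : I -> 'cV[R]_2 -> 'cV[R]_2,
  [/\ forall i, is_vpoly d (wh i),
      forall i x, That x -> w i (F i x) = contravariant (F i) x (wh i x) &
      forall i a b j a' b', shared_edge F i a b j a' b' ->
        same_bernstein_coefs d
          (fun t => dot (wh i (edge_param a b t))
                        (quarter_turn (edge_dir a b)))
          (fun t => dot (wh j (edge_param a' b' t))
                        (quarter_turn (edge_dir a' b')))].

Definition V2 (q : I -> 'cV[R]_3 -> R) : Prop :=
  exists qh : I -> 'cV[R]_2 -> R,
    (forall i, is_poly d.-1 (qh i)) /\
    (forall i x, That x -> q i (F i x) = (area_density (F i) x)^-1 * qh i x).

Record de_rham_subcomplex : Prop := DeRhamSubcomplex {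
  V0_H1 : forall u, V0 u -> H1 F u;
  V1curl_Hcurl : forall v, V1curl v -> Hcurl F v;
  V1div_Hdiv : forall w, V1div w -> Hdiv F w;
  V2_L2 : forall q, V2 q -> L2 F q;
  grad_V0 : forall u, V0 u -> V1curl (fun i => surface_grad (F i) (u i));
  curl_V1curl : forall v, V1curl v -> V2 (fun i => surface_curl (F i) (v i));
  div_V1div : forall w, V1div w -> V2 (fun i => surface_div (F i) (w i));
  curl_grad0 : forall u, V0 u -> forall i p, curved_triangle (F i) p ->
    surface_curl (F i) (surface_grad (F i) (u i)) p = 0
}.

End constraint_spaces.

(* Main.v *)
(* Everything is pulled back to the reference triangle. Regularity and
   compactness make each element map bi-Lipschitz from every point, so that a
   reference field differentiable at x yields a surface gradient at F(x), unique
   because the directions into the triangle span the plane. The surface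
   divergence of the contravariant field J_Gamma^-1 J w is the trace of such
   gradients; its metric terms cancel by Jacobi's formula for the derivative of
   J_Gamma and the symmetry of second derivatives. The circulation of the
   covariant field J G^-1 v around a subregion is that of the pulled back 1-form,
   and Green's theorem on the reference triangle (Fubini and the fundamental
   theorem of calculus) identifies its density. Integrating by parts on every
   element, the weak derivatives of the mapped fields exist and are the
   elementwise ones: boundary terms vanish on the boundary of the surface, and on
   a shared edge they cancel in pairs, since equal Bernstein coefficients match
   the traces and the two triangles traverse the edge in opposite directions. *)

Require Import Defs.
From HB Require Import structures.
From mathcomp Require Import all_boot all_order all_algebra.
From mathcomp Require Import all_classical all_reals all_analysis.
From mathcomp Require Import ring lra.

Set Implicit Arguments.
Unset Strict Implicit.
Unset Printing Implicit Defensive.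

Import Order.TTheory GRing.Theory Num.Theory.
Import numFieldNormedType.Exports.
Import Defs.

Local Open Scope classical_set_scope.
Local Open Scope ring_scope.

(** * Calculus in the plane *)

(** The surface gradient and the surface curl are [get] of a characterizing property, so every
    pull-back formula needs uniqueness as well as existence. That property sees a field only on the
    closed triangle, hence one-sidedly on its boundary and only within a cone at a corner. The
    element maps are of class C^2, so the Jacobian, the Gram matrix and [J_Gamma] are C^1, just
    enough for one integration by parts. After the pull-back no metric survives: the pairing of a
    flux field with a gradient and the rotated pairing of the weak curl, integrated against the area
    density, and the flux across an edge all become bilinear expressions in reference fields. The
    weak identities thus need only the planar divergence and Green theorems, and edge conditions
    stated for reference polynomials suffice on curved edges. The test fields of the weak gradient
    are not given as mapped fields; being tangential, they are contravariant images of C^1 reference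
    fields. *)

Section coordinates.
Context {R : realType} {V : normedModType R} {m : nat}.
Implicit Types (f : V -> 'cV[R]_m) (x v : V).

Lemma differentiable_col f x :
  differentiable f x <-> forall i, differentiable (fun y => f y i 0 : R) x.
Proof.
split=> [df i|df].
  exact: (@differentiable_comp _ _ _ _ f (fun N : 'cV[R]_m => N i 0) x df
    (differentiable_coord _ i 0)).
have -> : f = \sum_(i < m) (fun y => f y i 0 *: (delta_mx i 0 : 'cV[R]_m)).
  apply/funext => y; apply/matrixP => k j; rewrite (ord1 j) fct_sumE summxE.
  rewrite (bigD1 k)//= !mxE !eqxx mulr1 big1 ?addr0// => i ik.
  by rewrite !mxE eq_sym (negbTE ik) mulr0.
apply: (@differentiable_sum _ _ _ m
  (fun i y => f y i 0 *: (delta_mx i 0 : 'cV[R]_m))) => i.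
exact: differentiableZl.
Qed.

Lemma derive_col f x v i : differentiable f x ->
  'D_v (fun y => f y i 0) x = ('D_v f x) i 0.
Proof.
move=> df; rewrite derive_mx ?mxE//.
exact: diff_derivable.
Qed.

Lemma continuous_col f x :
  {for x, continuous f} <-> forall i, {for x, continuous (fun y => f y i 0 : R)}.
Proof.
split=> [cf i|cf].
  apply: (@continuous_comp _ _ _ f (fun M : 'cV[R]_m => M i 0)) => //.
  exact: coord_continuous.
apply/cvgrPdist_le => /= e e0; near=> y.
rewrite /Num.Def.normr/= mx_normrE (bigmax_le _ (ltW e0))//= => -[i j] _.
rewrite !mxE/= (ord1 j); move: i; near: y; apply: filter_forall => i.
exact: (cvgrPdist_le _ _).1 (cf i) _ e0.
Unshelve. all: by end_near. Qed.

End coordinates.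

Section plane_derivatives.
Context {R : realType} {W : normedModType R}.
Local Notation E := 'cV[R]_2.
Implicit Types (f : E -> W) (x v : E) (U : set E).

Lemma vec2E v : v = v 0 0 *: basis 0 + v 1 0 *: basis 1.
Proof.
apply/matrixP => i j; rewrite (ord1 j) !mxE !eqxx andbT /=.
by case: i => -[|[|]]//= p; rewrite (mulr0, mulr1) (mulr0, mulr1) (addr0, add0r);
  congr (v _ _); apply/val_inj.
Qed.

Lemma derive_dirE f x v : differentiable f x ->
  'D_v f x = v 0 0 *: 'D_(basis 0) f x + v 1 0 *: 'D_(basis 1) f x.
Proof.
by move=> df; rewrite !deriveE// [in LHS](vec2E v) linearD !linearZ.
Qed.

Lemma derive_comp {V V' : normedModType R} (g : V -> V') (f : V' -> W)
    (x v : V) :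
  differentiable g x -> differentiable f (g x) ->
  'D_v (f \o g) x = 'D_('D_v g x) f (g x).
Proof.
move=> dg df; rewrite (@deriveE _ _ _ g)// (@deriveE _ _ _ f)//.
rewrite (@deriveE _ _ _ (f \o g)); last exact: differentiable_comp.
by rewrite (@diff_comp _ _ _ _ g f).
Qed.

Lemma derive_compE {V : normedModType R} (g : V -> E) f (x v : V) :
  differentiable g x -> differentiable f (g x) ->
  'D_v (f \o g) x = ('D_v g x) 0 0 *: 'D_(basis 0) f (g x) +
                    ('D_v g x) 1 0 *: 'D_(basis 1) f (g x).
Proof. by move=> dg df; rewrite derive_comp// derive_dirE. Qed.

Lemma Cn_on_sub n U U' f : U' `<=` U -> Cn_on n U f -> Cn_on n U' f.
Proof.
move=> UU'; elim: n f => [f /= + x /UU'|n IH f [df Df]]; first exact.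
by split=> [x /UU'|k]; [exact: df|exact/IH/Df].
Qed.

Lemma near_eq_continuous {T T' : topologicalType} (f g : T -> T') (x : T) :
  (\near x, f x = g x) -> {for x, continuous f} -> {for x, continuous g}.
Proof.
move=> fg cf; rewrite /prop_for /continuous_at -(nbhs_singleton fg).
apply: cvg_trans cf; apply: near_eq_cvg.
by apply: filterS fg => y ->.
Qed.

(** Reduces every closure property of C^1 to a formula for the partial derivatives. The formula is
    known on [U] only, and openness lets its continuity pass to the derivative itself. *)
Lemma C1_intro U f (df : 'I_2 -> E -> W) : open U ->
  (forall x, U x -> differentiable f x) ->
  (forall k x, U x -> 'D_(basis k) f x = df k x) ->
  (forall k x, U x -> {for x, continuous (df k)}) -> Cn_on 1 U f.
Proof.
move=> oU dif fE cdf; split=> // k x Ux.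
apply: near_eq_continuous (cdf k x Ux).
by near do (apply/esym/fE); exact: open_nbhs_nbhs.
Unshelve. all: by end_near. Qed.

Lemma C1_cst U (w : W) : open U -> Cn_on 1 U (fun=> w).
Proof.
move=> oU; apply: (@C1_intro _ _ (fun _ _ => 0)) => //.
- by move=> k x _; exact: derive_cst.
- by move=> k x _; exact: cst_continuous.
Qed.

Lemma C1D U f g : open U -> Cn_on 1 U f -> Cn_on 1 U g ->
  Cn_on 1 U (fun x => f x + g x).
Proof.
move=> oU [df cf] [dg cg].
apply: (@C1_intro _ _ (fun k x => 'D_(basis k) f x + 'D_(basis k) g x)) => //.
- by move=> x Ux; apply: differentiableD; [exact: df|exact: dg].
- by move=> k x Ux; apply: deriveD; apply: diff_derivable; [exact: df|exact: dg].
- by move=> k x Ux; apply: continuousD; [exact: cf|exact: cg].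
Qed.

Lemma Cn_on_continuous n U f x : Cn_on n U f -> U x -> {for x, continuous f}.
Proof.
case: n => [|n] + Ux; first exact.
by case=> df _; exact/differentiable_continuous/df.
Qed.

Lemma Cn_onS n U f : Cn_on n.+1 U f -> Cn_on n U f.
Proof.
elim: n f => [f h x|n IH f [df Df]]; first exact: (Cn_on_continuous h).
by split; [exact: df|move=> k; apply: IH; exact: Df].
Qed.

End plane_derivatives.

Section C1_closure.
Context {R : realType}.
Local Notation E := 'cV[R]_2.
Implicit Types (f g : E -> R) (U : set E).

Lemma C1M U f g : open U -> Cn_on 1 U f -> Cn_on 1 U g ->
  Cn_on 1 U (fun x => f x * g x).
Proof.
move=> oU [df cf] [dg cg].
apply: (@C1_intro _ _ _ _
  (fun k x => f x * 'D_(basis k) g x + g x * 'D_(basis k) f x)) => //.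
- by move=> x Ux; apply: differentiableM; [exact: df|exact: dg].
- by move=> k x Ux; apply: deriveM; apply: diff_derivable; [exact: df|exact: dg].
- move=> k x Ux.
  have cfx := differentiable_continuous (df _ Ux).
  have cgx := differentiable_continuous (dg _ Ux).
  apply: continuousD.
    by apply: (@continuousM _ _ f ('D_(basis k) g) x cfx); exact: cg.
  by apply: (@continuousM _ _ g ('D_(basis k) f) x cgx); exact: cf.
Qed.

Lemma C1V U f : open U -> (forall x, U x -> f x != 0) ->
  Cn_on 1 U f -> Cn_on 1 U (fun x => (f x)^-1).
Proof.
move=> oU f0 [df cf].
apply: (@C1_intro _ _ _ _ (fun k x => - f x ^- 2 *: 'D_(basis k) f x)) => //.
- by move=> x Ux; apply: differentiableV; [exact: df|exact: f0].
- by move=> k x Ux; apply: deriveV; [exact: f0|exact/diff_derivable/df].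
- move=> k x Ux; apply: continuousM; last exact: cf.
  apply: continuousN; apply: continuousV; first by rewrite expf_neq0// f0.
  apply: (@continuous_comp _ _ _ f (fun y : R => y ^+ 2)).
    exact/differentiable_continuous/df.
  exact: exprn_continuous.
Qed.

Lemma differentiable_sqrt (a : R) : 0 < a -> differentiable (@Num.sqrt R) a.
Proof. by move=> a0; apply/derivable1_diffP; apply: ex_derive; exact: is_derive1_sqrt. Qed.

Lemma derive_sqrt_comp f x v : differentiable f x -> 0 < f x ->
  'D_v (fun y => Num.sqrt (f y)) x = (2 * Num.sqrt (f x))^-1 * 'D_v f x.
Proof.
move=> df f0; have ds := differentiable_sqrt f0.
rewrite deriveE; last exact: (@differentiable_comp _ _ _ _ f (@Num.sqrt R)).
rewrite (@diff_comp _ _ _ _ f (@Num.sqrt R))// [LHS]/=.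
rewrite (@deriveE _ _ _ f)//; set a := 'd f x v.
have -> : 'd (@Num.sqrt R) (f x) a = a *: 'd (@Num.sqrt R) (f x) (1 : R).
  by rewrite -linearZ; congr ('d _ _ _); rewrite /GRing.scale/= mulr1.
rewrite -(@deriveE _ _ _ (@Num.sqrt R))// [LHS]mulrC; congr (_ * _).
by apply: derive_val; exact: is_derive1_sqrt.
Qed.

Lemma C1_sqrt U f : open U -> (forall x, U x -> 0 < f x) ->
  Cn_on 1 U f -> Cn_on 1 U (fun x => Num.sqrt (f x)).
Proof.
move=> oU f0 [df cf].
apply: (@C1_intro _ _ _ _
  (fun k x => (2 * Num.sqrt (f x))^-1 * 'D_(basis k) f x)) => //.
- move=> x Ux; apply: (@differentiable_comp _ _ _ _ f (@Num.sqrt R));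
    [exact: df|exact/differentiable_sqrt/f0].
- by move=> k x Ux; apply: derive_sqrt_comp; [exact: df|exact: f0].
- move=> k x Ux; apply: continuousM; last exact: cf.
  apply: continuousV; first by rewrite mulf_neq0// gt_eqF// sqrtr_gt0 f0.
  apply: continuousM; first exact: cst_continuous.
  apply: (@continuous_comp _ _ _ f (@Num.sqrt R)); last exact: sqrt_continuous.
  exact/differentiable_continuous/df.
Qed.

Lemma C1N U f : open U -> Cn_on 1 U f -> Cn_on 1 U (fun x => - f x).
Proof.
move=> oU cf.
have -> : (fun x => - f x) = (fun x => -1 * f x).
  by apply/funext => x; rewrite mulN1r.
exact: (C1M oU (C1_cst _ oU) cf).
Qed.

Lemma C1B U f g : open U -> Cn_on 1 U f -> Cn_on 1 U g ->
  Cn_on 1 U (fun x => f x - g x).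
Proof. by move=> oU cf cg; exact: (C1D oU cf (C1N oU cg)). Qed.

Lemma C1_col m U (f : E -> 'cV[R]_m) : open U ->
  Cn_on 1 U f <-> forall i, Cn_on 1 U (fun x => f x i 0).
Proof.
move=> oU; split=> [[df cf] i|cf].
  apply: (@C1_intro _ _ _ _ (fun k x => ('D_(basis k) f x) i 0)) => //.
  - by move=> x /df/differentiable_col.
  - by move=> k x /df dfx; exact: derive_col.
  - by move=> k x /(cf k)/continuous_col.
have df x : U x -> differentiable f x.
  by move=> Ux; apply/differentiable_col => i; exact: (cf i).1.
apply: (@C1_intro _ _ _ _
  (fun k x => \col_i 'D_(basis k) (fun y => f y i 0) x)) => //.
- move=> k x Ux; apply/matrixP => i j; rewrite (ord1 j) !mxE.
  by rewrite derive_col//; exact: df.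
- move=> k x Ux; apply/continuous_col => i.
  have -> : (fun y => (\col_i0 'D_(basis k) (fun y0 => f y0 i0 0) y) i 0) =
      'D_(basis k) (fun y => f y i 0).
    by apply/funext => y; rewrite !mxE.
  exact: (cf i).2.
Qed.

Lemma C1_comp (W : normedModType R) U U' (psi : E -> E) (f : E -> W) : open U ->
  Cn_on 1 U psi -> Cn_on 1 U' f -> (forall x, U x -> U' (psi x)) ->
  Cn_on 1 U (fun x => f (psi x)).
Proof.
move=> oU [dp cp] [df cf] sU.
apply: (@C1_intro _ _ _ _ (fun k x =>
    ('D_(basis k) psi x) 0 0 *: 'D_(basis 0) f (psi x) +
    ('D_(basis k) psi x) 1 0 *: 'D_(basis 1) f (psi x))) => //.
- by move=> x Ux; apply: differentiable_comp; [exact: dp|exact/df/sU].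
- by move=> k x Ux; apply: derive_compE; [exact: dp|exact/df/sU].
- move=> k x Ux; have cpx := differentiable_continuous (dp x Ux).
  apply: continuousD; apply: continuousZ;
    do ?[by have /continuous_col := cp k x Ux; exact];
    by apply: (@continuous_comp _ _ _ psi ('D_(basis _) f)) => //;
      exact/cf/sU.
Qed.

(** Serves to shrink the domain of an element map to points with positive Gram determinant. *)
Lemma open_gt0 U f : open U -> (forall x, U x -> {for x, continuous f}) ->
  open (U `&` [set x | 0 < f x]).
Proof.
move=> oU cf; rewrite openE => x [Ux fx]; apply: filterI.
  exact: open_nbhs_nbhs.
exact: (cvgr_gt (f x) (cf x Ux)).
Qed.

Lemma open_setI_preimage (V : topologicalType) U (g : E -> V) (O : set V) :
  open U -> (forall x, U x -> {for x, continuous g}) -> open O ->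
  open (U `&` g @^-1` O).
Proof.
move=> oU cg oO; rewrite openE => x [Ux gx]; apply: filterI.
  exact: open_nbhs_nbhs.
by apply: cg => //; exact: open_nbhs_nbhs.
Qed.

End C1_closure.

Section frechet.
Context {R : realType} {V W : normedModType R}.
Implicit Types (f : V -> W) (x a : V).

Lemma differentiable_approx f x (e : R) : differentiable f x -> 0 < e ->
  \forall y \near x, `|f y - f x - 'd f x (y - x)| <= e * `|y - x|.
Proof.
move=> df e0; have /eqaddoP/(_ e e0) := diff_locally df.
rewrite (near_shift 0 x); near_simpl; apply: filterS => y /=.
by rewrite subr0 addrK opprD addrA.
Qed.

Lemma differentiable_line x a (t : R) : differentiable (fun s : R => x + s *: a) t.
Proof.
apply: (@differentiableD _ _ _ (fun=> x) (fun s : R => s *: a)).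
  exact: differentiable_cst.
exact: (@differentiableZl _ _ _ id).
Qed.

Lemma derive_line x a (t : R) : 'D_1 (fun s : R => x + s *: a) t = a.
Proof.
rewrite (@deriveD _ _ _ (fun=> x) (fun s : R => s *: a)) ?derive_cst ?add0r.
- rewrite deriveE; last exact: (@differentiableZl _ _ _ id).
  by rewrite (@diffZl _ _ _ id)// -(@deriveE _ _ _ id)// derive_id scale1r.
- exact: derivable_cst.
- apply: diff_derivable; exact: (@differentiableZl _ _ _ id).
Qed.

(** Brings directional derivatives within reach of the one-variable mean value and fundamental
    theorems. *)
Lemma is_derive_line f x a (t : R) : differentiable f (x + t *: a) ->
  is_derive t 1 (fun s : R => f (x + s *: a)) ('D_a f (x + t *: a)).
Proof.
move=> df; have dl := differentiable_line x a t.
have dfl : differentiable (f \o (fun s : R => x + s *: a)) t.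
  exact: differentiable_comp.
apply: DeriveDef; first exact: diff_derivable.
by have := derive_comp (1 : R) dl df; rewrite derive_line.
Qed.

End frechet.

Section symmetry_of_second_derivatives.
Context {R : realType} {V : normedModType R}.
Implicit Types (f : V -> R) (x a b : V).

(** Symmetric in [a] and [b], while its quotient by h^2 approximates the iterated derivative in
    either order. *)
Let second_difference f x a b (h : R) : R :=
  f (x + h *: a + h *: b) - f (x + h *: a) - (f (x + h *: b) - f x).

(* Mean value theorem in the direction [a], then first-order expansion of
   the derivative in that direction. *)
Lemma second_difference_approx f x a b (e : R) :
  (\forall y \near x, differentiable f y) ->
  differentiable ('D_a f) x -> 0 < e ->
  \forall h \near 0^'+,
    `|h ^- 2 * second_difference f x a b h - 'D_b ('D_a f) x| <= e.
Proof.
(* The two remainders below are at most e/c times h(|a| + |b|) and h|a|; the summand 1 keeps [c]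
   positive. *)
move=> df dg e0; pose c : R := 1 + (`|a| + `|b|) + `|a|.
have c0 : 0 < c by rewrite /c -addrA ltr_pwDl// !addr_ge0.
have ec0 : 0 < e / c by rewrite divr_gt0.
have /(_ _ ec0)/nbhs_ballP[r1 /= r10 r1P] := differentiable_approx dg.
have /nbhs_ballP[r2 /= r20 r2P] := df.
pose M := 1 + `|a| + `|b|.
have M0 : 0 < M by rewrite /M -addrA ltr_pwDl// addr_ge0.
near=> h.
have h0 : 0 < h by near: h; exact: nbhs_right_gt.
have small (r t s : R) : h * M < r -> 0 <= t <= h -> 0 <= s <= h ->
    `|t *: a + s *: b| < r.
  move=> hr /andP[t0 th] /andP[s0 sh]; apply: le_lt_trans hr.
  rewrite (le_trans (ler_normD _ _))// !normrZ !ger0_norm// /M !mulrDr mulr1.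
  by rewrite -addrA; apply: ler_wpDl; [exact: ltW|apply: lerD; exact: ler_wpM2r].
have hr1 : h * M < r1.
  by rewrite -ltr_pdivlMr//; near: h; apply: nbhs_right_lt; rewrite divr_gt0.
have hr2 : h * M < r2.
  by rewrite -ltr_pdivlMr//; near: h; apply: nbhs_right_lt; rewrite divr_gt0.
(* The second difference is [phi h - phi 0], to which the mean value theorem applies. *)
pose phi (t : R) := f (x + h *: b + t *: a) - f (x + t *: a).
pose dphi (t : R) := 'D_a f (x + h *: b + t *: a) - 'D_a f (x + t *: a).
have near_x (r t s : R) : h * M < r -> 0 <= t <= h -> 0 <= s <= h ->
    ball x r (x + s *: b + t *: a).
  move=> hr th sh; rewrite -ball_normE /= -addrA opprD addrA subrr sub0r normrN.
  by rewrite addrC small.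
have hh : 0 <= h <= h by rewrite ltW /=.
have h00 : 0 <= (0 : R) <= h by rewrite lexx ltW.
have dphiP (t : R) : 0 <= t <= h -> is_derive t 1 phi (dphi t).
  move=> th; apply: is_deriveB; apply: is_derive_line; apply: r2P.
    exact: near_x.
  by have := near_x r2 t 0 hr2 th h00; rewrite scale0r addr0.
have [||xi xih phiE] := @MVT _ phi dphi 0 h h0.
- by move=> t /[!in_itv]/= /andP[t0 th]; apply: dphiP; rewrite !ltW.
- apply: derivable_within_continuous => t /[!in_itv]/= th.
  by have [] := dphiP t th.
have {}xih : 0 <= xi <= h by move: xih; rewrite in_itv/= => /andP[? ?]; rewrite !ltW.
have -> : second_difference f x a b h = dphi xi * h.
  rewrite -[X in _ * X]subr0 -phiE /phi /second_difference scale0r !addr0.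
  rewrite addrAC -[x + h *: a + h *: b]addrAC; ring.
have -> : h ^- 2 * (dphi xi * h) = h^-1 * dphi xi.
  by rewrite mulrC -mulrA expr2 invfM mulVKf ?gt_eqF// mulrC.
set g := 'D_a f in dg r1P *.
have E1 := r1P _ (near_x r1 xi h hr1 xih hh).
have := r1P _ (near_x r1 xi 0 hr1 xih h00); rewrite scale0r addr0 => E2.
(* Both derivative values are compared with their linearizations at [x], which differ by h times the
   derivative along [b]. *)
have key (A1 A2 G D B : R) :
    h^-1 * (A1 - A2) - B = h^-1 * ((A1 - G - (h * B + D)) - (A2 - G - D)).
  by field; rewrite gt_eqF.
have dgE : 'd g x (x + h *: b + xi *: a - x) =
    h * 'd g x b + 'd g x (x + xi *: a - x).
  rewrite -[h * _]linearZ -linearD; congr ('d g x _).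
  by rewrite -!addrA addrCA.
rewrite dgE in E1.
rewrite /dphi -/g [X in _ - X]deriveE// (key _ _ (g x) ('d g x (x + xi *: a - x))).
rewrite normrM gtr0_norm ?invr_gt0// -ler_pdivlMl ?invr_gt0// invrK.
apply: (le_trans (ler_normB _ _)); apply: (le_trans (lerD E1 E2)).
have /andP[xi0 xile] := xih.
have n2 : `|x + xi *: a - x| <= h * `|a|.
  by rewrite addrC addKr normrZ ger0_norm// ler_wpM2r.
have n1 : `|x + h *: b + xi *: a - x| <= h * (`|a| + `|b|).
  have -> : x + h *: b + xi *: a - x = xi *: a + h *: b.
    by rewrite addrC -!addrA addKr addrC.
  apply: (le_trans (ler_normD _ _)); rewrite !normrZ !ger0_norm// ?(ltW h0)//.
  by rewrite mulrDr lerD2r ler_wpM2r.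
rewrite -mulrDr; apply: (le_trans (ler_wpM2l (ltW ec0) (lerD n1 n2))).
rewrite mulrAC ler_pdivrMr// -subr_ge0.
have -> : h * e * c - e * (h * (`|a| + `|b|) + h * `|a|) = h * e.
  by rewrite /c; ring.
by rewrite ltW// mulr_gt0.
Unshelve. all: by end_near. Qed.

Lemma derive_symmetric f x a b : (\forall y \near x, differentiable f y) ->
  differentiable ('D_a f) x -> differentiable ('D_b f) x ->
  'D_b ('D_a f) x = 'D_a ('D_b f) x.
Proof.
move=> df da db; apply/eqP; rewrite -subr_eq0 -normr_le0.
apply/ler_addgt0Pl => e e0; rewrite addr0.
have e20 : 0 < e / 2 by rewrite divr_gt0.
have Pab := second_difference_approx b df da e20.
have Pba := second_difference_approx a df db e20.
have [h [/= za zb]] := filter_ex (filterI Pab Pba).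
have E : second_difference f x b a h = second_difference f x a b h.
  by rewrite /second_difference (addrAC x); ring.
rewrite E in zb; move: za zb; set z := h ^- 2 * _ => za zb.
rewrite distrC in za; apply: le_trans (ler_distD z _ _) _.
by rewrite (splitr e) lerD.
Qed.

End symmetry_of_second_derivatives.

(** * Integration over the reference triangle *)

Lemma within_continuous_comp {T U V : topologicalType} (A : set T) (B : set U)
    (g : T -> U) (f : U -> V) :
  {within A, continuous g} -> (forall x, A x -> B (g x)) ->
  {within B, continuous f} -> {within A, continuous (f \o g)}.
Proof.
move=> /subspace_continuousP cg AB /subspace_continuousP cf.
apply/subspace_continuousP => x Ax P /(cf _ (AB _ Ax)) /=.
rewrite /nbhs/= /within/= => /(cg _ Ax).
rewrite /nbhs/= /within/=; apply: filterS => y BP Ay.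
by apply: BP => //; exact: AB.
Qed.

Section plane_measurability.
Context {R : realType}.
Local Notation mR := (measurableTypeR R).

Let box (a b c d : rat) : set (R * R) :=
  `](ratr a : R), ratr b[ `*` `](ratr c : R), ratr d[.

(** The product sigma-algebra contains open sets because each is the countable union of the rational
    boxes inside it; the other boxes contribute the empty set. *)
Lemma open_measurable2 (A : set (R * R)) : open A -> measurable (A : set (mR * mR)).
Proof.
move=> oA.
have -> : A = \bigcup_a \bigcup_b \bigcup_c \bigcup_d
    (if `[< box a b c d `<=` A >] then box a b c d else set0).
  apply/seteqP; split=> [[x y] Axy|z [a _ [b _ [c _ [d _]]]]]; last first.
    by case: ifPn => // /asboolP; exact.
  have /nbhs_ballP[e /= e0 eA] : nbhs (x, y) A by exact: open_nbhs_nbhs.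
  have ltl (t : R) : t - e < t by rewrite ltrBlDr ltrDl.
  have ltr (t : R) : t < t + e by rewrite ltrDl.
  have [a /[!in_itv]/= /andP[xa ax]] := rat_in_itvoo (ltl x).
  have [b /[!in_itv]/= /andP[xb bx]] := rat_in_itvoo (ltr x).
  have [c /[!in_itv]/= /andP[yc cy]] := rat_in_itvoo (ltl y).
  have [d /[!in_itv]/= /andP[yd dy]] := rat_in_itvoo (ltr y).
  exists a => //; exists b => //; exists c => //; exists d => //.
  case: ifPn => [_|/asboolP[]]; first by split; rewrite /= in_itv/= ?ax ?cy.
  move=> [u v] [/=]; rewrite !in_itv/= => /andP[au ub] /andP[cv vd].
  apply: eA; split; rewrite /ball/= ltr_distlC.
    by rewrite (lt_trans xa au) (lt_trans ub bx).
  by rewrite (lt_trans yc cv) (lt_trans vd dy).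
do 4 (apply: bigcupT_measurable_rat => ?).
case: ifPn => // _; apply: measurableX; exact: measurable_itv.
Qed.

Lemma open_measurable_subspace2 (D : set (R * R)) (U : set (subspace D)) :
  measurable (D : set (mR * mR)) -> open U -> measurable (D `&` U : set (mR * mR)).
Proof.
move=> mD oU; have [V oV VD] := (@open_subspaceP _ D U).1 oU; rewrite setIC -VD.
by apply: measurableI => //; exact: open_measurable2.
Qed.

Lemma within_continuous_measurable2 (D : set (R * R)) (f : R * R -> R) :
  measurable (D : set (mR * mR)) -> {within D, continuous f} ->
  measurable_fun (D : set (mR * mR)) (f : mR * mR -> mR).
Proof.
move=> mD /continuousP cf; apply: (measurability _ (measurable_realfun.RGenOpens.measurableE R)).
move=> _ [_ [a [b ->] <-]].
have oab : open (`]a, b[%classic : set R) by exact: interval_open.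
exact: (open_measurable_subspace2 mD (cf _ oab)).
Qed.

End plane_measurability.

Section integration_on_That.
Context {R : realType}.
Local Notation mR := (measurableTypeR R).
Local Notation E := 'cV[R]_2.
Local Notation D := (pt @^-1` (@That R)).

Lemma pt0 (z : R * R) : pt z 0 0 = z.1. Proof. by rewrite mxE. Qed.
Lemma pt1 (z : R * R) : pt z 1 0 = z.2. Proof. by rewrite mxE. Qed.

Lemma ptK (x : E) : pt (x 0 0, x 1 0) = x.
Proof. by apply/matrixP => i j; rewrite (ord1 j) mxE; case: i => -[|[|]]//= p;
  congr (x _ _); apply/val_inj. Qed.

Lemma pt_continuous : continuous (pt : R * R -> E).
Proof.
move=> z; apply/continuous_col => -[[|[|]]//= p].
  have -> : (fun y : R * R => pt y (Ordinal p) 0) = fst by apply/funext => y; rewrite mxE.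
  exact: cvg_fst.
have -> : (fun y : R * R => pt y (Ordinal p) 0) = snd by apply/funext => y; rewrite mxE.
exact: cvg_snd.
Qed.

Lemma closed_That : closed (@That R).
Proof.
have -> : @That R = [set x | 0 <= x 0 0] `&` ([set x | 0 <= x 1 0] `&`
    [set x | x 0 0 + x 1 0 <= 1]).
  by apply/seteqP; split => x /=; [case|case=> ? []].
have cc i := @coord_continuous R 2 1 i 0.
apply: closedI; [|apply: closedI].
- exact: (closed_comp (fun x _ => cc 0 x) (@closed_ge _ 0)).
- exact: (closed_comp (fun x _ => cc 1 x) (@closed_ge _ 0)).
- apply: (@closed_comp _ _ (fun x : E => x 0 0 + x 1 0) [set y : R | y <= 1]).
    by move=> x _; apply: (@continuousD _ _ _ (fun x : E => x 0 0)); exact: cc.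
  exact: closed_le.
Qed.

Lemma That_preimage_sub : D `<=` `[0, 1] `*` `[0, 1].
Proof.
by move=> [x y]; rewrite /= /That/= pt0 pt1/= => -[x0 y0 xy]; split => /=;
  rewrite in_itv/=; apply/andP; split=> //; lra.
Qed.

Lemma in_That (x y : R) :
  ((x, y) \in D) = [&& 0 <= x, 0 <= y & x + y <= 1].
Proof.
by apply/idP/and3P => [/[!inE]|[x0 y0 xy]]; rewrite ?inE /= /That/= pt0 pt1.
Qed.

Lemma compact_That_preimage : compact (D : set (R * R)).
Proof.
apply: (@subclosed_compact _ _ (`[0 : R, 1] `*` `[0 : R, 1])).
- exact: (closed_comp (fun x _ => @pt_continuous x) closed_That).
- by apply: compact_setX; exact: segment_compact.
- exact: That_preimage_sub.
Qed.

Lemma compact_That : compact (@That R).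
Proof.
have -> : @That R = pt @` D.
  apply/seteqP; split=> [x Tx|_ [z Tz <-]//].
  by exists (x 0 0, x 1 0); rewrite /= ptK.
apply: continuous_compact; last exact: compact_That_preimage.
by apply: continuous_subspaceT; exact: pt_continuous.
Qed.

Lemma measurable_That : measurable (D : set (mR * mR)).
Proof.
rewrite -[X in measurable X]setCK; apply: measurableC; apply: open_measurable2.
apply: closed_openC.
exact: (closed_comp (fun x _ => @pt_continuous x) closed_That).
Qed.

Lemma lebesgue2_rect (A B : set mR) : measurable A -> measurable B ->
  lebesgue2 (A `*` B) = (lebesgue_measure A * lebesgue_measure B)%E.
Proof. by move=> mA mB; exact: product_measure1E. Qed.

Lemma That_finite : (lebesgue2 (D : set (mR * mR)) < +oo)%E.
Proof.
apply: (@le_lt_trans _ _ (lebesgue2 ((`[0, 1] : set mR) `*` (`[0, 1] : set mR)))).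
  apply: le_measure; rewrite ?inE; [exact: measurable_That| |exact: That_preimage_sub].
  by apply: measurableX; exact: measurable_itv.
rewrite lebesgue2_rect ?lebesgue_measure_itv/=; try exact: measurable_itv.
by rewrite lte_fin ltr01 -EFinB -EFinM ltry.
Qed.

Lemma That_integrable (f : E -> R) : {within That, continuous f} ->
  lebesgue2.-integrable D (EFin \o (f \o pt)).
Proof.
move=> cf.
have cfp : {within D, continuous (f \o pt : R * R -> R)}.
  apply: within_continuous_comp cf => //.
  by apply: continuous_subspaceT; exact: pt_continuous.
apply: measurable_bounded_integrable.
- exact: measurable_That.
- exact: That_finite.
- apply: within_continuous_measurable2 => //; exact: measurable_That.
- have /compact_bounded[M [_ mrt]] := continuous_compact cfp compact_That_preimage.
  by exists M; split; rewrite ?num_real // => ? ? ? ?; exact: mrt.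
Qed.

Lemma That_pos : (0 < lebesgue2 (D : set (mR * mR)))%E.
Proof.
(* The square of side 1/2 at the origin lies in the triangle. *)
apply: (@lt_le_trans _ _ (lebesgue2 ((`[0, 2^-1] : set mR) `*` (`[0, 2^-1] : set mR)))).
  rewrite lebesgue2_rect ?lebesgue_measure_itv/=; try exact: measurable_itv.
  by rewrite lte_fin invr_gt0 ltr0n -EFinB -EFinM lte_fin subr0 mulr_gt0// invr_gt0.
apply: le_measure; rewrite ?inE; [|exact: measurable_That|].
  by apply: measurableX; exact: measurable_itv.
move=> [x y]/= []; rewrite !in_itv/= /That /= pt0 pt1/= => /andP[? ?] /andP[? ?].
by split=> //; lra.
Qed.

Lemma eq_integral_That (f g : E -> R) : (forall x, That x -> f x = g x) ->
  integral_That f = integral_That g.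
Proof. by move=> fg; apply: eq_Rintegral => z /[!inE]/= Dz; exact: fg. Qed.

Lemma integral_ThatD (f g : E -> R) :
  {within That, continuous f} -> {within That, continuous g} ->
  integral_That (fun x => f x + g x) = integral_That f + integral_That g.
Proof.
move=> cf cg.
apply: (@RintegralD _ _ _ lebesgue2 D (f \o pt) (g \o pt) measurable_That);
  exact: That_integrable.
Qed.

Lemma integral_ThatB (f g : E -> R) :
  {within That, continuous f} -> {within That, continuous g} ->
  integral_That (fun x => f x - g x) = integral_That f - integral_That g.
Proof.
move=> cf cg.
apply: (@RintegralB _ _ _ lebesgue2 D (f \o pt) (g \o pt) measurable_That);
  exact: That_integrable.
Qed.

(** A uniform lower bound reduces positivity of the integral to that of the area of the triangle. *)
Lemma integral_That_gt0 (f : E -> R) (e : R) :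
  0 < e -> {within That, continuous f} -> (forall x, That x -> e <= f x) ->
  0 < integral_That f.
Proof.
move=> e0 cf ef.
have ce : {within That, continuous (fun _ : E => e)}.
  by apply/subspace_continuousP => x _; exact: cvg_cst.
apply: (@lt_le_trans _ _ (integral_That (fun=> e))).
  rewrite /integral_That Rintegral_cst; last exact: measurable_That.
  rewrite mulr_gt0// fine_gt0// That_finite andbT; exact: That_pos.
apply: (@le_Rintegral _ _ _ lebesgue2 D (fun=> e) (f \o pt) measurable_That).
- exact: (That_integrable ce).
- exact: That_integrable.
- by move=> z; exact: ef.
Qed.

Let mu : {measure set mR -> \bar R} := @lebesgue_measure R.

(** Fubini with the slice integrals supplied in closed form by [h]: measurability of [h] is then no
    separate obligation, and the slices outside [0,1] are empty. *)
Lemma integral_That_iterated1 (f : E -> R) (h : R -> R) :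
  {within That, continuous f} ->
  (forall x, 0 <= x <= 1 ->
    (\int[mu]_(y in `[0%R, (1 - x)%R]) (f (pt (x, y)))%:E = (h x)%:E)%E) ->
  integral_That f = \int[mu]_(x in `[0, 1]) h x.
Proof.
move=> cf fh; rewrite /integral_That /Rintegral; congr fine.
have := That_integrable cf; rewrite integrable_mkcond; last exact: measurable_That.
move=> intf; rewrite integral_mkcond -(integral12_prod_meas1 intf) [RHS]integral_mkcond.
apply: eq_integral => x _; rewrite /fubini_F !patchE mem_setE in_itv/=.
have DE y : ((x, y) \in D) = [&& 0 <= x, 0 <= y & x + y <= 1] by exact: in_That.
case: ifPn => [x01|x01].
  rewrite -fh// [RHS]integral_mkcond; apply: eq_integral => y _.
  rewrite !patchE mem_setE DE in_itv/=; have /andP[-> _] := x01.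
  by rewrite lerBrDl.
rewrite integral0_eq// => y _; rewrite patchE DE; case: ifPn => // /and3P[x0 y0 xy].
by move: x01; rewrite x0 (le_trans _ xy)// lerDl.
Qed.

Lemma integral_That_iterated2 (f : E -> R) (h : R -> R) :
  {within That, continuous f} ->
  (forall y, 0 <= y <= 1 ->
    (\int[mu]_(x in `[0%R, (1 - y)%R]) (f (pt (x, y)))%:E = (h y)%:E)%E) ->
  integral_That f = \int[mu]_(y in `[0, 1]) h y.
Proof.
move=> cf fh; rewrite /integral_That /Rintegral; congr fine.
have := That_integrable cf; rewrite integrable_mkcond; last exact: measurable_That.
move=> intf; rewrite integral_mkcond -(integral21_prod_meas1 intf) [RHS]integral_mkcond.
apply: eq_integral => y _; rewrite /fubini_G !patchE mem_setE in_itv/=.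
have DE x : ((x, y) \in D) = [&& 0 <= x, 0 <= y & x + y <= 1] by exact: in_That.
case: ifPn => [y01|y01].
  rewrite -fh// [RHS]integral_mkcond; apply: eq_integral => x _.
  rewrite !patchE mem_setE DE in_itv/=; have /andP[-> _] := y01.
  by rewrite lerBrDr.
rewrite integral0_eq// => x _; rewrite patchE DE; case: ifPn => // /and3P[x0 y0 xy].
by move: y01; rewrite y0 (le_trans _ xy)// lerDr.
Qed.

(** The fundamental theorem of calculus on one slice of the triangle. *)
Lemma integral_segment_derive (g : E -> R) (x a : E) (l : R) : 0 <= l ->
  (forall t, 0 <= t <= l -> differentiable g (x + t *: a)) ->
  (forall t, 0 <= t <= l -> {for x + t *: a, continuous ('D_a g)}) ->
  (\int[mu]_(t in `[0%R, l]) ('D_a g (x + t *: a))%:E =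
    (g (x + l *: a) - g x)%:E)%E.
Proof.
(* The slice through the opposite vertex has length zero and is treated apart. *)
rewrite le_eqVlt => /predU1P[<- _ _|l0 dg cg].
  by rewrite set_itv1 integral_set1 scale0r addr0 subrr.
have dgl (t : R) : 0 <= t <= l ->
    is_derive t 1 (fun s : R => g (x + s *: a)) ('D_a g (x + t *: a)).
  by move=> tl; apply: is_derive_line; exact: dg.
have cgl (t : R) : 0 <= t <= l -> {for t, continuous (fun s : R => g (x + s *: a))}.
  by move=> /dgl dt; apply/differentiable_continuous/derivable1_diffP; exact: ex_derive.
rewrite (@continuous_FTC2 _ _ (fun s : R => g (x + s *: a)))// ?scale0r ?addr0//.
- apply/subspace_continuousP => t; rewrite /= in_itv/= => tl.
  apply: cvg_within_filter.
  apply: (@continuous_comp _ _ _ (fun s : R => x + s *: a) ('D_a g)); last exact: cg.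
  exact/differentiable_continuous/differentiable_line.
- split.
  + by move=> t /[!in_itv]/= /andP[t0 tl]; apply: ex_derive; apply: dgl; rewrite !ltW.
  + by apply: cvg_at_right_filter; apply: cgl; rewrite lexx ltW.
  + by apply: cvg_at_left_filter; apply: cgl; rewrite lexx ltW.
- move=> t /[!in_itv]/= /andP[t0 tl]; rewrite derive1E; apply: derive_val.
  by apply: dgl; rewrite !ltW.
Qed.

End integration_on_That.

(** * Edges of the reference triangle *)

Section edges.
Context {R : realType}.
Local Notation E := 'cV[R]_2.
Local Notation mu := (@lebesgue_measure R).

Lemma col2P (x y : E) : x 0 0 = y 0 0 -> x 1 0 = y 1 0 -> x = y.
Proof. by move=> xy0 xy1; rewrite (vec2E x) (vec2E y) xy0 xy1. Qed.

Lemma sum_I3 (V : nmodType) (f : 'I_3 -> V) : \sum_a f a = f 0 + f 1 + f (1 + 1).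
Proof.
rewrite !big_ord_recl big_ord0 addr0 addrA.
by congr (f _ + f _ + f _); exact/val_inj.
Qed.

Lemma sum_I2 (V : nmodType) (f : 'I_2 -> V) : \sum_a f a = f 0 + f 1.
Proof.
by rewrite !big_ord_recl big_ord0 addr0; congr (f _ + f _); exact/val_inj.
Qed.

Lemma That_convex (x y : E) (t : R) : That x -> That y -> 0 <= t <= 1 ->
  That ((1 - t) *: x + t *: y).
Proof.
move=> [x0 x1 xx] [y0 y1 yy] /andP[t0 t1]; rewrite /That/= !mxE.
by split; nra.
Qed.

Lemma vertex_That a : That (vertex a : E).
Proof.
by rewrite /That/= !mxE; case: a => -[|[|[|]]]//= p; split;
  rewrite ?ler01 ?addr0 ?add0r ?lexx.
Qed.

Lemma edge_param_That a b (t : R) : 0 <= t <= 1 -> That (edge_param a b t).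
Proof. by move=> t01; apply: That_convex => //; exact: vertex_That. Qed.

Lemma edge_param_line a b (t : R) :
  edge_param a b t = vertex a + t *: edge_dir a b.
Proof.
by rewrite /edge_param /edge_dir scalerBl scale1r scalerBr addrA addrAC.
Qed.

Lemma edge_param_rev a b (t : R) : edge_param a b (1 - t) = edge_param b a t.
Proof. by rewrite /edge_param opprB addrCA subrr addr0 addrC. Qed.

Lemma edge_dirN a b : edge_dir b a = - edge_dir a b :> E.
Proof. by rewrite /edge_dir opprB. Qed.

(** The indices stay unreduced, in the form that [a + 1] takes in the three terms produced by
    [sum_I3]. *)
Lemma edge_paramE (t : R) : [/\ edge_param 0 (0 + 1) t = pt (t, 0),
  edge_param 1 (1 + 1) t = pt (1 - t, t) &
  edge_param (1 + 1) (1 + 1 + 1) t = pt (0, 1 - t)].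
Proof.
by split; apply: col2P; rewrite !mxE/=; ring.
Qed.

Lemma edge_dirE (k : 'I_2) : [/\ edge_dir 0 (0 + 1) k 0 = (k == 0)%:R :> R,
  edge_dir 1 (1 + 1) k 0 = (k == 1)%:R - (k == 0)%:R :> R &
  edge_dir (1 + 1) (1 + 1 + 1) k 0 = - (k == 1)%:R :> R].
Proof. by case: k => [[|[|]]//= i]; rewrite !mxE/=; split; ring. Qed.

Lemma edge_param_continuous a b : continuous (edge_param a b : R -> E).
Proof.
rewrite (_ : edge_param a b = fun t => vertex a + t *: edge_dir a b); last first.
  by apply/funext => t; exact: edge_param_line.
by move=> t; exact/differentiable_continuous/differentiable_line.
Qed.

Lemma continuous_on_edge (W : topologicalType) a b (f : E -> W) :
  {within That, continuous f} ->
  {within `[(0 : R), 1], continuous (fun t => f (edge_param a b t))}.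
Proof.
move=> cf; apply: (@within_continuous_comp _ _ _ _ That (edge_param a b)) => //.
  by apply: continuous_subspaceT; exact: edge_param_continuous.
by move=> t; rewrite /= in_itv/=; exact: edge_param_That.
Qed.

Lemma continuous_on_edge_rev (W : topologicalType) a b (f : E -> W) :
  {within That, continuous f} ->
  {within `[(0 : R), 1], continuous (fun t => f (edge_param a b (1 - t)))}.
Proof.
move=> cf; rewrite (_ : (fun t : R => _) = (fun t => f (edge_param b a t))).
  exact: continuous_on_edge.
by apply/funext => t; rewrite edge_param_rev.
Qed.

Lemma within_That_continuous (W : topologicalType) U (f : E -> W) :
  That `<=` U -> (forall x, U x -> {for x, continuous f}) ->
  {within That, continuous f}.
Proof.
move=> TU cf; apply/subspace_continuousP => x Tx; apply: cvg_within_filter.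
exact/cf/TU.
Qed.

Lemma integrable01 (f : R -> R) : {within `[0, 1], continuous f} ->
  mu.-integrable `[0, 1] (EFin \o f).
Proof.
by move=> cf; apply: continuous_compact_integrable => //; exact: segment_compact.
Qed.

Lemma Rintegral01_onem (f : R -> R) : {within `[0, 1], continuous f} ->
  \int[mu]_(t in `[0, 1]) f (1 - t) = \int[mu]_(t in `[0, 1]) f t.
Proof.
move=> cf; rewrite [RHS]Rintegration_by_substitution_onem ?ler01 ?lexx//.
by rewrite /unstable.onem subrr.
Qed.

Lemma Rintegral01B (f g : R -> R) : {within `[0, 1], continuous f} ->
  {within `[0, 1], continuous g} ->
  \int[mu]_(t in `[0, 1]) (f t - g t) =
  \int[mu]_(t in `[0, 1]) f t - \int[mu]_(t in `[0, 1]) g t.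
Proof. by move=> cf cg; rewrite RintegralB//; exact: integrable01. Qed.

Lemma Rintegral01N (f : R -> R) : {within `[0, 1], continuous f} ->
  \int[mu]_(t in `[0, 1]) (- f t) = - \int[mu]_(t in `[0, 1]) f t.
Proof.
move=> cf; under eq_Rintegral do rewrite -mulN1r.
by rewrite RintegralZl ?mulN1r//; exact: integrable01.
Qed.

End edges.

(** The planar determinant. For a counterclockwise edge direction [b] it is the outward flux density
    of [a], weighted by the length of [b]. *)
Definition cross2 {R : realType} (a b : 'cV[R]_2) : R := a 0 0 * b 1 0 - a 1 0 * b 0 0.

(** * Green's theorem and the divergence theorem on the reference triangle *)

Section green.
Context {R : realType}.
Local Notation E := 'cV[R]_2.
Local Notation mu := (@lebesgue_measure R).
Variables (U : set E) (TU : That `<=` U).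

Lemma integral_partial0 (f : E -> R) : Cn_on 1 U f ->
  integral_That ('D_(basis 0) f) =
  \int[mu]_(t in `[0, 1]) f (edge_param 1 (1 + 1) t) -
  \int[mu]_(t in `[0, 1]) f (edge_param (1 + 1) (1 + 1 + 1) t).
Proof.
move=> [df cf].
have wf : {within That, continuous f}.
  by apply: within_That_continuous TU _ => x Ux; exact/differentiable_continuous/df.
(* Reversing the edge on the vertical axis makes [y] the parameter of both endpoints of the slice at
   height [y]. *)
rewrite -[X in _ - X]Rintegral01_onem; last exact: continuous_on_edge.
rewrite -Rintegral01B; [|exact: continuous_on_edge|]; last first.
  exact: continuous_on_edge_rev.
apply: integral_That_iterated2.
  by apply: within_That_continuous TU _ => x Ux; exact: cf.
move=> y /andP[y0 y1].
have [_ -> _] := edge_paramE y; have [_ _ ->] := edge_paramE (1 - y).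
rewrite subKr.
have ptE t : pt (t, y) = pt (0, y) + t *: basis 0 :> E.
  by apply: col2P; rewrite !mxE/=; ring.
have Tl t : 0 <= t <= 1 - y -> U (pt (0, y) + t *: basis 0).
  move=> /andP[t0 ty]; apply: TU; rewrite -ptE /That/= pt0 pt1/=; split=> //; lra.
have l0 : 0 <= 1 - y by rewrite subr_ge0.
rewrite (ptE (1 - y)) -(@integral_segment_derive R f (pt (0, y)) (basis 0) (1 - y) l0
  (fun t tl => df _ (Tl t tl)) (fun t tl => cf 0 _ (Tl t tl))).
by apply: eq_integral => t _; rewrite ptE.
Qed.

Lemma integral_partial1 (f : E -> R) : Cn_on 1 U f ->
  integral_That ('D_(basis 1) f) =
  \int[mu]_(t in `[0, 1]) f (edge_param 1 (1 + 1) t) -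
  \int[mu]_(t in `[0, 1]) f (edge_param 0 (0 + 1) t).
Proof.
move=> [df cf].
have wf : {within That, continuous f}.
  by apply: within_That_continuous TU _ => x Ux; exact/differentiable_continuous/df.
(* Here the hypotenuse is reversed, so that the abscissa parameterizes both endpoints. *)
rewrite -[X in X - _]Rintegral01_onem; last exact: continuous_on_edge.
rewrite -Rintegral01B; [| |exact: continuous_on_edge]; last first.
  exact: continuous_on_edge_rev.
apply: integral_That_iterated1.
  by apply: within_That_continuous TU _ => x Ux; exact: cf.
move=> x /andP[x0 x1].
have [-> _ _] := edge_paramE x; have [_ -> _] := edge_paramE (1 - x).
rewrite subKr.
have ptE t : pt (x, t) = pt (x, 0) + t *: basis 1 :> E.
  by apply: col2P; rewrite !mxE/=; ring.
have Tl t : 0 <= t <= 1 - x -> U (pt (x, 0) + t *: basis 1).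
  move=> /andP[t0 ty]; apply: TU; rewrite -ptE /That/= pt0 pt1/=; split=> //; lra.
have l0 : 0 <= 1 - x by rewrite subr_ge0.
rewrite (ptE (1 - x)) -(@integral_segment_derive R f (pt (x, 0)) (basis 1) (1 - x) l0
  (fun t tl => df _ (Tl t tl)) (fun t tl => cf 1 _ (Tl t tl))).
by apply: eq_integral => t _; rewrite ptE.
Qed.

Lemma green_That (z : E -> E) : open U -> Cn_on 1 U z ->
  integral_That (curl_hat z) = \sum_(a < 3) \int[mu]_(t in `[0, 1])
    dot (z (edge_param a (a + 1) t)) (edge_dir a (a + 1)).
Proof.
move=> oU /(C1_col _ oU) cz.
have wz k : {within That, continuous (fun x => z x k 0)}.
  by apply: within_That_continuous TU _ => x Ux; exact/differentiable_continuous/(cz k).1.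
rewrite /curl_hat integral_ThatB; last 2 first.
- by apply: within_That_continuous TU _ => x Ux; exact: (cz 1).2.
- by apply: within_That_continuous TU _ => x Ux; exact: (cz 0).2.
rewrite integral_partial0// integral_partial1// sum_I3.
have [d00 d10 d20] := @edge_dirE R 0; have [d01 d11 d21] := @edge_dirE R 1.
under [X in _ = X + _ + _]eq_Rintegral do rewrite /dot sum_I2 d00 d01/= mulr1 mulr0 addr0.
under [X in _ = _ + X + _]eq_Rintegral do
  rewrite /dot sum_I2 d10 d11/= sub0r subr0 mulrN1 mulr1 addrC.
under [X in _ = _ + _ + X]eq_Rintegral do
  rewrite /dot sum_I2 d20 d21/= oppr0 mulr0 add0r mulrN1.
have we a b k := @continuous_on_edge R _ a b _ (wz k).
rewrite Rintegral01B; [|exact: we|exact: we].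
rewrite Rintegral01N; last exact: we.
ring.
Qed.

(** Green's theorem for the field turned by a quarter: its curl is the divergence of [z], and its
    tangential component is the normal component of [z]. *)
Lemma divergence_That (z : E -> E) : open U -> Cn_on 1 U z ->
  integral_That (div_hat z) = \sum_(a < 3) \int[mu]_(t in `[0, 1])
    cross2 (z (edge_param a (a + 1) t)) (edge_dir a (a + 1)).
Proof.
move=> oU cz; have /(C1_col _ oU) cz' := cz.
pose y x := quarter_turn (z x).
have cy : Cn_on 1 U y.
  apply/(C1_col _ oU) => i; case: (altP (i =P 0)) => i0.
    have -> : (fun x => y x i 0) = (fun x => - z x 1 0).
      by apply/funext => x; rewrite mxE i0.
    exact: (C1N oU (cz' 1)).
  have -> : (fun x => y x i 0) = (fun x => z x 0 0).
    by apply/funext => x; rewrite mxE (negbTE i0).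
  exact: cz'.
have y0 : (fun x => y x 0 0) = (fun x => - z x 1 0).
  by apply/funext => x; rewrite mxE.
have y1 : (fun x => y x 1 0) = (fun x => z x 0 0).
  by apply/funext => x; rewrite mxE.
have := green_That oU cy.
have -> : integral_That (curl_hat y) = integral_That (div_hat z).
  apply: eq_integral_That => x /TU Ux; rewrite /curl_hat /div_hat sum_I2 y0 y1.
  by rewrite (@deriveN _ _ _ (fun x => z x 1 0)) ?opprK//; exact/diff_derivable/(cz' 1).1.
move=> ->; apply: eq_bigr => a _; apply: eq_Rintegral => t _.
by rewrite /dot sum_I2 /cross2 /y /quarter_turn !mxE/=; ring.
Qed.

End green.

(** * Surface operators *)

Section vector_algebra.
Context {R : realType}.
Implicit Types (J : 'M[R]_(3, 2)) (a b : 'cV[R]_2) (s t w : 'cV[R]_3).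

Lemma dotE n (u v : 'cV[R]_n) : dot u v = (u^T *m v) 0 0.
Proof. by rewrite mxE; apply: eq_bigr => k _; rewrite mxE. Qed.

Lemma dotC n (u v : 'cV[R]_n) : dot u v = dot v u.
Proof. by apply: eq_bigr => k _; rewrite mulrC. Qed.

Lemma dot_mulmx m n (A : 'M[R]_(m, n)) u v : dot (A *m u) v = dot u (A^T *m v).
Proof. by rewrite !dotE trmx_mul mulmxA. Qed.

Lemma dotDr n (u v w : 'cV[R]_n) : dot u (v + w) = dot u v + dot u w.
Proof. by rewrite !dotE mulmxDr mxE. Qed.

Lemma dotNr n (u v : 'cV[R]_n) : dot u (- v) = - dot u v.
Proof. by rewrite !dotE mulmxN mxE. Qed.

Lemma dotBr n (u v w : 'cV[R]_n) : dot u (v - w) = dot u v - dot u w.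
Proof. by rewrite dotDr dotNr. Qed.

Lemma dotZr n c (u v : 'cV[R]_n) : dot u (c *: v) = c * dot u v.
Proof. by rewrite !dotE -scalemxAr mxE. Qed.

Lemma dotZl n c (u v : 'cV[R]_n) : dot (c *: u) v = c * dot u v.
Proof. by rewrite dotC dotZr dotC. Qed.

Lemma dotBl n (u v w : 'cV[R]_n) : dot (u - v) w = dot u w - dot v w.
Proof. by rewrite dotC dotBr !(dotC w). Qed.

Lemma dotrr_ge0 n (u : 'cV[R]_n) : 0 <= dot u u.
Proof. by apply: sumr_ge0 => k _; exact: sqr_ge0. Qed.

Lemma dotrr_eq0 n (u : 'cV[R]_n) : dot u u = 0 -> u = 0.
Proof.
move=> /psumr_eq0P u0; apply/matrixP => i j; rewrite (ord1 j) mxE.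
by apply/eqP; rewrite -sqrf_eq0 expr2; apply/eqP/u0 => // k _; exact: sqr_ge0.
Qed.

Lemma norm_coord n (u : 'cV[R]_n) k : `|u k 0| <= `|u|.
Proof. by rewrite [leRHS]/Num.Def.normr/= mx_normrE (le_bigmax _ _ (k, 0)). Qed.

(** The norm of a column is the maximum norm, whence the factor [n]. *)
Lemma dot_le_norm n (u v : 'cV[R]_n) : `|dot u v| <= n%:R * `|u| * `|v|.
Proof.
apply: (le_trans (ler_norm_sum _ _ _)).
have -> : n%:R * `|u| * `|v| = \sum_(k < n) (`|u| * `|v|).
  by rewrite sumr_const card_ord -mulrA mulr_natl.
by apply: ler_sum => k _; rewrite normrM ler_pM// norm_coord.
Qed.

Lemma norm_le_dot n (u : 'cV[R]_n) : `|u| ^+ 2 <= dot u u.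
Proof.
rewrite -ler_sqrt ?dotrr_ge0// sqrtr_sqr normr_id.
rewrite [leLHS]/Num.Def.normr/= mx_normrE bigmax_le ?sqrtr_ge0// => -[k j] _ /=.
rewrite (ord1 j) -sqrtr_sqr ler_wsqrtr// /dot (bigD1 k)//= expr2 lerDl.
by apply: sumr_ge0 => i _; exact: sqr_ge0.
Qed.

Lemma det_mx2 (M : 'M[R]_2) : \det M = M 0 0 * M 1 1 - M 0 1 * M 1 0.
Proof.
rewrite (expand_det_row _ 0) sum_I2 /cofactor !det_mx11 !mxE /=.
rewrite /= expr0 expr1 mul1r mulN1r mulrN.
by congr (_ * M _ _ - _ * M _ _); exact/val_inj.
Qed.

Lemma mulmx_col2 m (A : 'M[R]_(m, 2)) a k : (A *m a) k 0 = A k 0 * a 0 0 + A k 1 * a 1 0.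
Proof. by rewrite mxE sum_I2. Qed.

Lemma dot3E s t : dot s t = s 0 0 * t 0 0 + s 1 0 * t 1 0 + s (1 + 1) 0 * t (1 + 1) 0.
Proof. exact: sum_I3. Qed.

Lemma cross3E s t : [/\ cross s t 0 0 = s 1 0 * t (1 + 1) 0 - s (1 + 1) 0 * t 1 0,
  cross s t 1 0 = s (1 + 1) 0 * t 0 0 - s 0 0 * t (1 + 1) 0 &
  cross s t (1 + 1) 0 = s 0 0 * t 1 0 - s 1 0 * t 0 0].
Proof.
split; rewrite mxE; congr (s _ _ * t _ _ - s _ _ * t _ _); exact/val_inj.
Qed.

Lemma triple_product s t w : dot s (cross t w) = dot w (cross s t).
Proof.
by rewrite !dot3E; have [-> -> ->] := cross3E t w; have [-> -> ->] := cross3E s t; ring.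
Qed.

Lemma cross_mulmx J a b :
  cross (J *m a) (J *m b) = cross2 a b *: cross (col 0 J) (col 1 J).
Proof.
apply/matrixP => k j; rewrite (ord1 j).
by rewrite !mxE !sum_I2 /cross2; ring.
Qed.

Lemma gram_entry J k l : (J^T *m J) k l =
  J 0 k * J 0 l + J 1 k * J 1 l + J (1 + 1) k * J (1 + 1) l.
Proof. by rewrite mxE sum_I3 !mxE. Qed.

(** Lagrange's identity: the area density is the length of the unnormalized normal. *)
Lemma dot_cross_cols J :
  dot (cross (col 0 J) (col 1 J)) (cross (col 0 J) (col 1 J)) = \det (J^T *m J).
Proof.
rewrite det_mx2 !gram_entry dot3E.
by have [-> -> ->] := cross3E (col 0 J) (col 1 J); rewrite !mxE; ring.
Qed.

Lemma gram_sym J : (J^T *m J)^T = J^T *m J.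
Proof. by rewrite trmx_mul trmxK. Qed.

Lemma det_gram_gt0 J (m : R) : 0 < m ->
  (forall a, m * dot a a <= dot (J *m a) (J *m a)) -> 0 < \det (J^T *m J).
Proof.
move=> m0 mJ; set G := J^T *m J.
have Q a : dot (J *m a) (J *m a) = G 0 0 * a 0 0 ^+ 2 + 2 * G 0 1 * a 0 0 * a 1 0
    + G 1 1 * a 1 0 ^+ 2.
  by rewrite dot3E !mulmx_col2 !gram_entry; ring.
have G10 : G 1 0 = G 0 1 by rewrite /G -[in LHS](gram_sym J) mxE.
pose v (p q : R) : 'cV[R]_2 := \col_k (if k == 0 then p else q).
have vE p q : v p q 0 0 = p /\ v p q 1 0 = q by rewrite !mxE.
have mJv p q : m * (p ^+ 2 + q ^+ 2) <=
    G 0 0 * p ^+ 2 + 2 * G 0 1 * p * q + G 1 1 * q ^+ 2.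
  by have := mJ (v p q); rewrite Q /dot sum_I2; have [-> ->] := vE p q.
have G00 : 0 < G 0 0 by have := mJv 1 0; nra.
(* At this vector the quadratic form of G takes the value G_00 det G. *)
have := mJv (- G 0 1) (G 0 0); rewrite det_mx2 -/G G10 => H.
have : 0 < G 0 0 * (G 0 0 * G 1 1 - G 0 1 * G 0 1).
  apply: (@lt_le_trans _ _ (m * ((- G 0 1) ^+ 2 + G 0 0 ^+ 2))); last by nra.
  by rewrite mulr_gt0// ltr_wpDl ?sqr_ge0// exprn_gt0.
by rewrite pmulr_rgt0.
Qed.

Lemma gram_unit J : 0 < \det (J^T *m J) -> J^T *m J \in unitmx.
Proof. by move=> dJ; rewrite unitmxE unitfE gt_eqF. Qed.

(** The Gram factor cancels, so the 1-form of a covariant field pulls back to the reference field.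
    Gradient formula, circulation and weak pairings all rest on this. *)
Lemma dot_covariant J a b : 0 < \det (J^T *m J) ->
  dot (J *m invmx (J^T *m J) *m a) (J *m b) = dot a b.
Proof.
move=> /gram_unit GU.
rewrite -mulmxA dot_mulmx mulmxA dotC dot_mulmx gram_sym mulKVmx//.
exact: dotC.
Qed.

Lemma invmx_gram J : 0 < \det (J^T *m J) -> let G := J^T *m J in
  [/\ invmx G 0 0 = G 1 1 / \det G, invmx G 1 1 = G 0 0 / \det G,
      invmx G 0 1 = - G 0 1 / \det G & invmx G 1 0 = - G 0 1 / \det G].
Proof.
move=> dJ G.
have G10 : G 1 0 = G 0 1 by rewrite /G -[in LHS](gram_sym J) mxE.
have adj (i j k l : 'I_2) : lift j (0 : 'I_1) = k -> lift i (0 : 'I_1) = l ->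
    invmx G i j = (-1) ^+ (j + i) * G k l / \det G.
  by move=> jk il; rewrite /invmx gram_unit// !mxE /cofactor det_mx11 !mxE jk il mulrC.
split.
- rewrite (@adj _ _ 1 1); [|exact/val_inj|exact/val_inj].
  by rewrite -signr_odd /= expr0 mul1r.
- rewrite (@adj _ _ 0 0); [|exact/val_inj|exact/val_inj].
  by rewrite -signr_odd /= expr0 mul1r.
- rewrite (@adj _ _ 0 1); [|exact/val_inj|exact/val_inj].
  by rewrite -signr_odd /= expr1 mulN1r.
- rewrite (@adj _ _ 1 0); [|exact/val_inj|exact/val_inj].
  by rewrite -signr_odd /= expr1 mulN1r G10.
Qed.

End vector_algebra.

(** * Existence and uniqueness of the surface gradient *)

Section surface_gradient.
Context {R : realType}.
Local Notation E := 'cV[R]_2.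
Implicit Types (X : E -> 'cV[R]_3) (x : E).

Lemma jacE X x (a : E) : differentiable X x -> 'D_a X x = jac X x *m a.
Proof.
move=> dX; rewrite derive_dirE//; apply/matrixP => i j; rewrite (ord1 j).
rewrite mulmx_col2 /jac mxE [in RHS]mxE [X in _ = _ + X * _]mxE.
by congr (_ + _); rewrite mxE mulrC.
Qed.

Lemma grad_hatE (U : E -> R) x (a : E) : differentiable U x ->
  'D_a U x = dot (grad_hat U x) a.
Proof.
move=> dU; rewrite derive_dirE// /dot sum_I2 !mxE.
by rewrite mulrC [X in _ + X]mulrC.
Qed.

Variables (X : E -> 'cV[R]_3) (m : R).
Hypothesis m0 : 0 < m.
Hypothesis Xinj : {in That &, injective X}.
Hypothesis Xdiff : forall x, That x -> differentiable X x.
Hypothesis Xcoercive : forall x a, That x ->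
  m * dot a a <= dot (jac X x *m a) (jac X x *m a).

Lemma det_gram_gt0_That x : That x -> 0 < \det (gram X x).
Proof. by move=> Tx; apply: det_gram_gt0 m0 _ => a; exact: Xcoercive. Qed.

Lemma jac_lower_bound : exists2 c : R, 0 < c &
  forall x (a : E), That x -> c * `|a| <= `|jac X x *m a|.
Proof.
(* The 3 is the price of the maximum norm in space: the dot square is at most three times the square
   of the norm. *)
exists (Num.sqrt (m / 3)); first by rewrite sqrtr_gt0 divr_gt0.
move=> x a Tx; rewrite -ler_sqr ?nnegrE ?mulr_ge0 ?sqrtr_ge0//.
rewrite exprMn sqr_sqrtr ?divr_ge0 ?(ltW m0)// mulrAC ler_pdivrMr//.
apply: (@le_trans _ _ (m * dot a a)); first by rewrite ler_wpM2l ?(ltW m0) ?norm_le_dot.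
apply: (le_trans (Xcoercive a Tx)); apply: (le_trans (ler_norm _)).
by apply: (le_trans (dot_le_norm _ _)); rewrite -mulrA -expr2 mulrC.
Qed.

Lemma That_norm_le (y : E) : That y -> `|y| <= 1.
Proof.
move=> [y0 y1 yy]; rewrite [leLHS]/Num.Def.normr/= mx_normrE bigmax_le//.
move=> [k j] _ /=; rewrite (ord1 j).
have [->|->] : k = 0 \/ k = 1 by case: k => -[|[|]]//= i; [left|right]; exact/val_inj.
  by rewrite ger0_norm//; lra.
by rewrite ger0_norm//; lra.
Qed.

(* Near [x] by the lower bound on the Jacobian, away from [x] by compactness
   and injectivity. *)
Lemma inverse_lipschitz x : That x -> exists2 K : R, 0 < K &
  forall y, That y -> `|y - x| <= K * `|X y - X x|.
Proof.
move=> Tx; have [c c0 cJ] := jac_lower_bound.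
have c20 : 0 < c / 2 by rewrite divr_gt0.
have /nbhs_ballP[r /= r0 rP] := differentiable_approx (Xdiff Tx) c20.
(* The linearization error uses up half of the lower bound [c] and leaves c/2. *)
have near y : `|y - x| < r -> `|y - x| <= 2 / c * `|X y - X x|.
  move=> yr; have yB : ball x r y by rewrite -ball_normE /= distrC.
  have := rP _ yB; rewrite -(@deriveE _ _ _ X) ?jacE//; [|exact: Xdiff|exact: Xdiff].
  have := cJ x (y - x) Tx.
  set j := jac X x *m _; set d := X y - X x => h1 h2.
  have h3 : `|j| <= `|d - j| + `|d|.
    by rewrite -[in leLHS](subKr d j) distrC (le_trans (ler_normB _ _))// addrC distrC.
  rewrite mulrAC ler_pdivlMr// ; lra.
pose A : set E := That `&` ~` ball x r.
have cA : compact A.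
  apply: (subclosed_compact _ compact_That) => [|z []//].
  by apply: closedI; [exact: closed_That|exact/open_closedC/ball_open].
have [A0|/set0P A0] := eqVneq A set0.
  exists (2 / c); first by rewrite divr_gt0.
  move=> y Ty; apply: near; rewrite ltNge; apply/negP => yr.
  suff : A y by rewrite A0.
  by split=> //; rewrite -ball_normE /= distrC; apply/negP; rewrite -leNgt.
have cf : {within A, continuous (fun y => `|X y - X x|)}.
  apply/subspace_continuousP => y [Ty _]; apply: cvg_within_filter.
  apply: (@continuous_comp _ _ _ (fun y => X y - X x) (@Num.Def.normr R _)).
    by apply: continuousB; [exact/differentiable_continuous/Xdiff|exact: cst_continuous].
  exact: norm_continuous.
have [z /[!inE] -[Tz xz] zmin] := compact_EVT_min A0 cA cf.
have d0 : 0 < `|X z - X x|.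
  rewrite normr_gt0 subr_eq0; apply/eqP => /Xinj zx.
  by apply: xz; rewrite zx ?inE//; exact: ballxx.
(* Points of the triangle are at most 2 apart, and [z] realizes the least image distance outside the
   ball. *)
exists (2 / c + 2 / `|X z - X x|); first by rewrite addr_gt0 ?divr_gt0.
move=> y Ty; have [yr|yr] := ltP `|y - x| r.
  apply: (le_trans (near _ yr)); rewrite ler_wpM2r// lerDl.
  by rewrite ltW// divr_gt0.
have yA : y \in A.
  by rewrite inE; split=> //; rewrite -ball_normE /= distrC; apply/negP; rewrite -leNgt.
apply: (@le_trans _ _ 2).
  rewrite (le_trans (ler_normB _ _))//.
  by have := That_norm_le Ty; have := That_norm_le Tx; lra.
rewrite mulrDl; apply: ler_wpDl; first by rewrite mulr_ge0// ltW// divr_gt0.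
by rewrite mulrAC ler_pdivlMr// ler_wpM2l// zmin.
Qed.

(** The expansions of [U] and of [X] have remainders small relative to |y - x|; the inverse
    Lipschitz bound makes them small relative to the distance in space. *)
Lemma is_surface_grad_covariant (u : 'cV[R]_3 -> R) (U : E -> R) x : That x ->
  (forall y, That y -> u (X y) = U y) -> differentiable U x ->
  is_surface_grad X u (X x) (covariant X x (grad_hat U x)).
Proof.
move=> Tx uU dU; have [K K0 XK] := inverse_lipschitz Tx.
split; first by exists x.
  exists x, (invmx (gram X x) *m grad_hat U x); split=> //.
  by rewrite /covariant mulmxA.
move=> e e0; set g := covariant _ _ _.
(* The 1 accounts for the remainder of [U], the other term for that of [X] after pairing with
   [g]. *)
pose C := 1 + 3%:R * `|g|.
have C0 : 0 < C by rewrite ltr_pwDl// mulr_ge0.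
have e'0 : 0 < e / (C * K) by rewrite divr_gt0// mulr_gt0.
have /nbhs_ballP[r1 /= r10 r1P] := differentiable_approx (Xdiff Tx) e'0.
have /nbhs_ballP[r2 /= r20 r2P] := differentiable_approx dU e'0.
rewrite near_withinE; near=> q => -[y Ty yq]; rewrite -yq !uU//.
have yx : `|y - x| < Num.min r1 r2.
  apply: (le_lt_trans (XK y Ty)); rewrite yq mulrC -ltr_pdivlMr// distrC.
  have : ball (X x) (Num.min r1 r2 / K) q.
    near: q; apply: nbhsx_ballx; by rewrite divr_gt0// lt_min r10.
  by rewrite -ball_normE.
move: yx; rewrite lt_min => /andP[yx1 yx2].
have := r1P y; rewrite -ball_normE /= distrC => /(_ yx1).
have := r2P y; rewrite -ball_normE /= distrC => /(_ yx2).
rewrite -!deriveE//; last exact: Xdiff.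
rewrite jacE; last exact: Xdiff.
have cov : dot g (jac X x *m (y - x)) = dot (grad_hat U x) (y - x).
  exact: dot_covariant (det_gram_gt0_That Tx).
rewrite grad_hatE// -cov; set d := X y - X x; set j := jac X x *m _ => h1 h2.
have -> : U y - U x - dot g d = (U y - U x - dot g j) - dot g (d - j).
  by rewrite (dotBr g d j); ring.
apply: (le_trans (ler_normB _ _)).
apply: (@le_trans _ _ (e / (C * K) * C * `|y - x|)).
  rewrite [leRHS]mulrAC /C mulrDr mulr1 lerD//.
  apply: (le_trans (dot_le_norm _ _)).
  by rewrite mulrC ler_wpM2r// mulr_ge0.
have -> : e / (C * K) * C = e / K by field; rewrite !gt_eqF.
by rewrite -mulrA ler_wpM2l ?(ltW e0)// mulrC ler_pdivrMr// mulrC XK.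
Unshelve. all: by end_near. Qed.

(** The only available increments run along segments from [x] to points of the triangle. Dividing by
    the segment parameter shows that the difference of two gradients is orthogonal to their images
    under the Jacobian. *)
Lemma surface_grad_unique u x g1 g2 : That x ->
  is_surface_grad X u (X x) g1 -> is_surface_grad X u (X x) g2 -> g1 = g2.
Proof.
move=> Tx [_ [x1 [a1 [Tx1 Xx1 g1E]]] G1] [_ [x2 [a2 [Tx2 Xx2 g2E]]] G2].
have {}Xx1 : x1 = x by apply: Xinj; rewrite ?inE.
have {}Xx2 : x2 = x by apply: Xinj; rewrite ?inE.
subst x1 x2; set d := g1 - g2.
have dE : d = jac X x *m (a1 - a2) by rewrite mulmxBr -g1E -g2E.
have key y : That y -> dot d (jac X x *m (y - x)) = 0.
  move=> Ty; set v := y - x; set j := jac X x *m v.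
  (* [M] collects the coefficients of [e] in the final estimate; [e <= 1] lets the quadratic term be
     counted among them. *)
  pose M := 2 * `|j| + 2 * `|v| + 3%:R * `|d| * `|v| + 1.
  have M0 : 0 < M by rewrite ltr_wpDl// !addr_ge0// !mulr_ge0.
  apply/eqP; rewrite -normr_le0; apply/ler_addgt0Pl => e1 e10; rewrite addr0.
  pose e := Num.min 1 (e1 / M).
  have e0 : 0 < e by rewrite lt_min ltr01 divr_gt0.
  have e_1 : e <= 1 by rewrite ge_min lexx.
  have eM : e * M <= e1 by rewrite -ler_pdivlMr// ge_min lexx orbT.
  have line : (X (x + t *: v)) @[t --> 0^'+] --> X x.
    apply: cvg_at_right_filter.
    have := @continuous_comp _ _ _ (fun t : R => x + t *: v) X 0.
    rewrite /prop_for /continuous_at /= scale0r addr0; apply.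
      have := differentiable_continuous (differentiable_line x v 0).
      by rewrite /prop_for /continuous_at /= scale0r addr0.
    exact/differentiable_continuous/Xdiff.
  have linex : (x + t *: v) @[t --> 0^'+] --> x.
    apply: cvg_at_right_filter.
    have := differentiable_continuous (differentiable_line x v 0).
    by rewrite /prop_for /continuous_at /= scale0r addr0.
  near (0 : R)^'+ => t.
  have t0 : 0 < t by near: t; exact: nbhs_right_gt.
  have t1 : t <= 1 by near: t; exact: nbhs_right_le.
  have Tt : That (x + t *: v).
    have -> : x + t *: v = (1 - t) *: x + t *: y.
      by rewrite /v scalerBr scalerBl scale1r addrA addrAC.
    by apply: That_convex; rewrite ?(ltW t0).
  have Tc : curved_triangle X (X (x + t *: v)) by exists (x + t *: v).
  have H1 : curved_triangle X (X (x + t *: v)) ->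
      `|u (X (x + t *: v)) - u (X x) - dot g1 (X (x + t *: v) - X x)|
      <= e * `|X (x + t *: v) - X x|.
    by near: t; exact: (line _ (G1 e e0)).
  have H2 : curved_triangle X (X (x + t *: v)) ->
      `|u (X (x + t *: v)) - u (X x) - dot g2 (X (x + t *: v) - X x)|
      <= e * `|X (x + t *: v) - X x|.
    by near: t; exact: (line _ (G2 e e0)).
  have H3 : `|X (x + t *: v) - X x - 'd X x (x + t *: v - x)|
      <= e * `|x + t *: v - x|.
    by near: t; exact: (linex _ (differentiable_approx (Xdiff Tx) e0)).
  have {H1 H2} H12 := lerD (H1 Tc) (H2 Tc).
  have xt : x + t *: v - x = t *: v by rewrite addrC addKr.
  move: H3; rewrite -(@deriveE _ _ _ X) ?jacE ?xt; [|exact: Xdiff|exact: Xdiff].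
  rewrite -scalemxAr -/j normrZ gtr0_norm//; move: H12.
  set w := X (x + t *: v) - X x; set du := u _ - u _ => H12 H3.
  have wle : `|w| <= t * `|j| + e * (t * `|v|).
    rewrite -[w](subrK (t *: j)) (le_trans (ler_normD _ _))// addrC lerD//.
    by rewrite normrZ gtr0_norm.
  have dw : `|dot d w| <= 2 * e * `|w|.
    have -> : dot d w = (du - dot g2 w) - (du - dot g1 w).
      by rewrite /d dotBl; ring.
    apply: (le_trans (ler_normB _ _)); rewrite addrC; apply: (le_trans H12).
    by rewrite (_ : 2 * e * `|w| = e * `|w| + e * `|w|)//; ring.
  have dj : t * `|dot d j| <= `|dot d w| + 3%:R * `|d| * (e * (t * `|v|)).
    rewrite -(gtr0_norm t0) -normrM -dotZr (gtr0_norm t0).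
    have -> : dot d (t *: j) = dot d w - dot d (w - t *: j) by rewrite (dotBr d w (t *: j)); ring.
    rewrite (le_trans (ler_normB _ _))// lerD2l (le_trans (dot_le_norm _ _))//.
    by rewrite ler_wpM2l// mulr_ge0.
  apply: le_trans eM; rewrite -(ler_pM2l t0); apply: (le_trans dj).
  apply: (@le_trans _ _ (2 * e * (t * `|j| + e * (t * `|v|)) + 3%:R * `|d| * (e * (t * `|v|)))).
    rewrite lerD2r (le_trans dw)// ler_wpM2l// mulr_ge0// ltW//.
  have ev : 0 <= e * (t * `|v|) - e * (e * (t * `|v|)).
    by rewrite subr_ge0 ler_wpM2l ?(ltW e0)// ler_piMl// mulr_ge0// ltW.
  have te : 0 < t * e by rewrite mulr_gt0.
  rewrite /M.
  rewrite -subr_ge0.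
  have -> : t * (e * (2 * `|j| + 2 * `|v| + 3%:R * `|d| * `|v| + 1)) -
    (2 * e * (t * `|j| + e * (t * `|v|)) + 3%:R * `|d| * (e * (t * `|v|))) =
    2 * (e * (t * `|v|) - e * (e * (t * `|v|))) + t * e by ring.
  by apply: addr_ge0; [apply: mulr_ge0|exact: ltW].
(* Even at a corner of the reference triangle, the directions towards the
   vertices span the plane. *)
have dJ k : dot d (jac X x *m basis k) = 0.
  have kE : basis k = (vertex (lift ord0 k) - x) - (vertex ord0 - x) :> E.
    rewrite opprB addrA subrK; apply: col2P; rewrite !mxE; 
      by case: k => -[|[|]]//= i; ring.
  by rewrite kE mulmxBr dotBr !key ?subrr//; exact: vertex_That.
apply: subr0_eq; apply: dotrr_eq0; rewrite -/d.
rewrite [X in dot _ X]dE (vec2E (a1 - a2)) mulmxDr dotDr -!scalemxAr !dotZr !dJ.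
by rewrite !mulr0 addr0.
Unshelve. all: by end_near. Qed.

Lemma surface_gradE (u : 'cV[R]_3 -> R) (U : E -> R) x : That x ->
  (forall y, That y -> u (X y) = U y) -> differentiable U x ->
  surface_grad X u (X x) = covariant X x (grad_hat U x).
Proof.
move=> Tx uU dU; have g := is_surface_grad_covariant Tx uU dU.
have h : is_surface_grad X u (X x) (surface_grad X u (X x)).
  by apply: getPex; exists (covariant X x (grad_hat U x)).
exact: surface_grad_unique Tx h g.
Qed.

End surface_gradient.

Lemma near_eq_differentiable {R : realType} {V W : normedModType R} (f g : V -> W) x :
  (\near x, f x = g x) -> differentiable f x -> differentiable g x.
Proof.
move=> fg df.
have g0 : g \o shift x = cst (g x) + 'd f x +o_ 0 id.
  apply/eqaddoP => e e0; have /eqaddoP/(_ e e0) := diff_locally df.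
  have : \forall y \near (0 : V), f (y + x) = g (y + x).
    by move: fg; rewrite (near_shift 0 x); apply: filterS => y; rewrite /= subr0.
  apply: filterS2 => y fgy.
  by rewrite !fctE /= -(nbhs_singleton fg) -fgy.
have dgf : 'd g x = 'd f x :> (V -> W).
  by apply: diff_unique g0; exact: (diff_continuous df).
by apply/diff_locallyP; rewrite dgf; split=> //; exact: (diff_continuous df).
Qed.

(* [a], [b], [c] are the entries of the Gram matrix and [D] its determinant,
   [cblm] stands for J_l . d_b J_m, [dbm] for d_b of the m-th component of the
   reference field, and [Lb] for d_b log J_Gamma (Jacobi's formula). Equality of
   mixed partials is built in: [c100 = c001] and [c110 = c011]. *)
Fact div_identity (R : realType)
    (a b c s w0 w1 d00 d01 d10 d11
    c000 c001 c010 c011 c101 c111 D L0 L1 : R) :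
  D = a * c - b * b -> D != 0 ->
  L0 = (c000 * c + a * c011 - b * (c001 + c010)) / D ->
  L1 = (c001 * c + a * c111 - b * (c101 + c011)) / D ->
  c / D *
    (s * (c000 * w0 + a * d00 - L0 * a * w0 + (c001 * w1 + b * d01 - L0 * b * w1))) +
  - b / D *
    (s * (c001 * w0 + a * d10 - L1 * a * w0 + (c101 * w1 + b * d11 - L1 * b * w1))) +
  (- b / D *
    (s * (c010 * w0 + b * d00 - L0 * b * w0 + (c011 * w1 + c * d01 - L0 * c * w1))) +
  a / D *
    (s * (c011 * w0 + b * d10 - L1 * b * w0 + (c111 * w1 + c * d11 - L1 * c * w1)))) =
  s * (d00 + d11).
Proof.
move=> DE D0 L0E L1E.
have e0 : c000 * c + a * c011 - b * (c001 + c010) = L0 * D by rewrite L0E divfK.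
have e1 : c001 * c + a * c111 - b * (c101 + c011) = L1 * D by rewrite L1E divfK.
(* Over the common denominator [D], the claim is polynomial once the numerators of [L0] and [L1] are
   named. *)
have -> : s * (d00 + d11) = s * (D * (d00 + d11)) / D by field.
transitivity (s * (w0 * (L0 * D) + w1 * (L1 * D) + (a * c - b * b) * (d00 + d11) -
  (a * c - b * b) * (L0 * w0 + L1 * w1)) / D).
  by rewrite -e0 -e1; ring.
rewrite -DE; congr (_ / _); ring.
Qed.

(** * Derivatives of the metric and the divergence formula *)

Section second_partials.
Context {R : realType} {n : nat}.
Local Notation E := 'cV[R]_2.
Variables (U : set E) (X : E -> 'cV[R]_n).
Hypotheses (oU : open U) (X2 : Cn_on 2 U X).

Lemma partial_C1 k l : Cn_on 1 U (fun y => 'D_(basis l) X y k 0).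
Proof. by have /(C1_col _ oU) := X2.2 l. Qed.

Lemma partial_sym x k l b : U x ->
  'D_(basis b) (fun y => 'D_(basis l) X y k 0) x =
  'D_(basis l) (fun y => 'D_(basis b) X y k 0) x.
Proof.
move=> Ux.
have nU : \forall y \near x, U y by exact: open_nbhs_nbhs.
(* Entry and derivative commute where [X] is differentiable, which is known near [x] only. *)
have jE i : \forall y \near x, 'D_(basis i) X y k 0 = 'D_(basis i) (fun z => X z k 0) y.
  by apply: filterS nU => y Uy; rewrite derive_col//; exact: X2.1.
have dj i : differentiable ('D_(basis i) (fun z => X z k 0)) x.
  by apply: near_eq_differentiable (jE i) _; exact: (partial_C1 k i).1.
apply: etrans (near_eq_derive _ (jE l)) _.
apply: etrans _ (esym (near_eq_derive _ (jE b))).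
apply: derive_symmetric => //; apply: filterS nU => y Uy.
by have /differentiable_col := X2.1 y Uy; exact.
Qed.

End second_partials.

Section jacobian.
Context {R : realType}.
Local Notation E := 'cV[R]_2.
Variables (U : set E) (X : E -> 'cV[R]_3).
Hypotheses (oU : open U) (X2 : Cn_on 2 U X).

Lemma jac_entry k l : (fun y => jac X y k l) = (fun y => 'D_(basis l) X y k 0).
Proof. by apply/funext => y; rewrite mxE. Qed.

Lemma jac_C1 k l : Cn_on 1 U (fun y => jac X y k l).
Proof. by rewrite jac_entry; exact: partial_C1. Qed.

Lemma derive_jac_sym x (k : 'I_3) (l b : 'I_2) : U x ->
  'D_(basis b) (fun y => jac X y k l) x = 'D_(basis l) (fun y => jac X y k b) x.
Proof. by rewrite !jac_entry => Ux; exact: (partial_sym oU X2). Qed.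

(** Christoffel symbol of the first kind, [J_l . d_b J_m], symmetric in [b] and [m] for a C^2
    map. *)
Definition christoffel x (b l m : 'I_2) : R :=
  \sum_k jac X x k l * 'D_(basis b) (fun y => jac X y k m) x.

Lemma is_derive_jac x b k l : U x -> is_derive x (basis b)
  (fun y => jac X y k l) ('D_(basis b) (fun y => jac X y k l) x).
Proof. by move=> Ux; apply/derivableP/diff_derivable; exact: (jac_C1 k l).1. Qed.

Lemma gramE x l m : gram X x l m = jac X x 0 l * jac X x 0 m +
  jac X x 1 l * jac X x 1 m + jac X x (1 + 1) l * jac X x (1 + 1) m.
Proof. exact: gram_entry. Qed.

Lemma gram_symE x l m : gram X x l m = gram X x m l.
Proof. by rewrite !gramE; ring. Qed.

Lemma is_derive_gram x b l m : U x -> is_derive x (basis b)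
  (fun y => gram X y l m) (christoffel x b l m + christoffel x b m l).
Proof.
move=> Ux; have j k i := is_derive_jac b k i Ux.
have -> : (fun y => gram X y l m) = (fun y => jac X y 0 l * jac X y 0 m +
    jac X y 1 l * jac X y 1 m + jac X y (1 + 1) l * jac X y (1 + 1) m).
  by apply/funext => y; exact: gramE.
apply: (is_derive_eq (is_deriveD (is_deriveD (is_deriveM (j 0 l) (j 0 m))
  (is_deriveM (j 1 l) (j 1 m))) (is_deriveM (j (1 + 1) l) (j (1 + 1) m)))).
by rewrite /christoffel !sum_I3 /GRing.scale/=; ring.
Qed.

Lemma det_gramE x : \det (gram X x) =
  gram X x 0 0 * gram X x 1 1 - gram X x 0 1 * gram X x 0 1.
Proof. by rewrite det_mx2 (gram_symE x 1 0). Qed.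

Lemma is_derive_det_gram x b : U x -> is_derive x (basis b)
  (fun y => \det (gram X y))
  (2 * (christoffel x b 0 0 * gram X x 1 1 + gram X x 0 0 * christoffel x b 1 1 -
     gram X x 0 1 * (christoffel x b 0 1 + christoffel x b 1 0))).
Proof.
move=> Ux; have g l m := is_derive_gram b l m Ux.
have -> : (fun y => \det (gram X y)) =
    (fun y => gram X y 0 0 * gram X y 1 1 - gram X y 0 1 * gram X y 0 1).
  by apply/funext => y; exact: det_gramE.
apply: (is_derive_eq (is_deriveB (is_deriveM (g 0 0) (g 1 1)) (is_deriveM (g 0 1) (g 0 1)))).
by rewrite /GRing.scale/=; ring.
Qed.

Lemma gram_C1 l m : Cn_on 1 U (fun y => gram X y l m).
Proof.
have -> : (fun y => gram X y l m) = (fun y => jac X y 0 l * jac X y 0 m +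
    jac X y 1 l * jac X y 1 m + jac X y (1 + 1) l * jac X y (1 + 1) m).
  by apply/funext => y; exact: gramE.
have j k i i' := C1M oU (jac_C1 k i) (jac_C1 k i').
exact: (C1D oU (C1D oU (j _ _ _) (j _ _ _)) (j _ _ _)).
Qed.

Lemma det_gram_C1 : Cn_on 1 U (fun y => \det (gram X y)).
Proof.
have -> : (fun y => \det (gram X y)) =
    (fun y => gram X y 0 0 * gram X y 1 1 - gram X y 0 1 * gram X y 0 1).
  by apply/funext => y; exact: det_gramE.
exact: (C1B oU (C1M oU (gram_C1 _ _) (gram_C1 _ _)) (C1M oU (gram_C1 _ _) (gram_C1 _ _))).
Qed.

Lemma area_density_gt0 x : 0 < \det (gram X x) -> 0 < area_density X x.
Proof. by rewrite sqrtr_gt0. Qed.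

Lemma area_density_sqr x : 0 < \det (gram X x) -> area_density X x ^+ 2 = \det (gram X x).
Proof. by move=> ?; rewrite sqr_sqrtr// ltW. Qed.

(** Half the trace of G^-1 d_b G, which by Jacobi's formula is d_b log J_Gamma. *)
Definition density_dlog x b : R :=
  (christoffel x b 0 0 * gram X x 1 1 + gram X x 0 0 * christoffel x b 1 1 -
     gram X x 0 1 * (christoffel x b 0 1 + christoffel x b 1 0)) / \det (gram X x).

Lemma is_derive_inv_density x b : U x -> 0 < \det (gram X x) ->
  is_derive x (basis b) (fun y => (area_density X y)^-1)
    (- (area_density X x)^-1 * density_dlog x b).
Proof.
move=> Ux dX; have dd := is_derive_det_gram b Ux.
have ds0 := area_density_gt0 dX.
have ddiff : differentiable (fun y => \det (gram X y)) x by exact: det_gram_C1.1.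
have ds : is_derive x (basis b) (area_density X) (area_density X x * density_dlog x b).
  apply: DeriveDef.
    apply: diff_derivable.
    apply: (@differentiable_comp _ _ _ _ (fun y => \det (gram X y)) (@Num.sqrt R)) => //.
    exact: differentiable_sqrt.
  rewrite derive_sqrt_comp// derive_val -/(area_density X x) /density_dlog.
  rewrite -[in RHS]area_density_sqr//; field; rewrite gt_eqF//.
have s0 : area_density X x != 0 by rewrite gt_eqF.
apply: DeriveDef; first by apply: derivableV => //; exact: ex_derive.
rewrite (@deriveV _ _ (area_density X))//.
by rewrite (@derive_val _ _ _ _ _ _ _ ds) /GRing.scale/=; field.
Qed.

Lemma christoffel_sym x b l m : U x -> christoffel x b l m = christoffel x m l b.
Proof. by move=> Ux; apply: eq_bigr => k _; rewrite derive_jac_sym. Qed.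

Lemma is_derive_contravariant x b (wh : E -> E) k : U x -> 0 < \det (gram X x) ->
  differentiable wh x ->
  is_derive x (basis b) (fun y => contravariant X y (wh y) k 0)
    ((area_density X x)^-1 * (\sum_m
      ('D_(basis b) (fun y => jac X y k m) x * wh x m 0 +
       jac X x k m * 'D_(basis b) (fun y => wh y m 0) x -
       density_dlog x b * jac X x k m * wh x m 0))).
Proof.
move=> Ux dX /differentiable_col dw.
have w m : is_derive x (basis b) (fun y => wh y m 0) ('D_(basis b) (fun y => wh y m 0) x).
  exact/derivableP/diff_derivable.
have j m := is_derive_jac b k m Ux.
have -> : (fun y => contravariant X y (wh y) k 0) = (fun y => (area_density X y)^-1 *
    (jac X y k 0 * wh y 0 0 + jac X y k 1 * wh y 1 0)).
  by apply/funext => y; rewrite mxE mulmx_col2.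
apply: (is_derive_eq (is_deriveM (is_derive_inv_density b Ux dX)
  (is_deriveD (is_deriveM (j 0) (w 0)) (is_deriveM (j 1) (w 1))))).
by rewrite sum_I2 !fctE /GRing.scale/=; ring.
Qed.

(** Summing over the ambient index first contracts each gradient with the Jacobian, so that only
    Gram entries and Christoffel symbols remain when the gradients are those of a contravariant
    field. *)
Lemma trace_covariant x (g : 'I_3 -> E) : \sum_k covariant X x (g k) k 0 =
  \sum_l \sum_b invmx (gram X x) l b * \sum_k jac X x k l * g k b 0.
Proof.
by rewrite !sum_I3 !sum_I2 /covariant -!mulmxA !mulmx_col2 !sum_I3; ring.
Qed.

Lemma div_contravariant x (wh : E -> E) : U x -> 0 < \det (gram X x) ->
  differentiable wh x ->
  \sum_k covariant X x (grad_hat (fun y => contravariant X y (wh y) k 0) x) k 0 =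
  (area_density X x)^-1 * div_hat wh x.
Proof.
move=> Ux dX dw; rewrite trace_covariant.
have P b l : \sum_k jac X x k l * grad_hat (fun y => contravariant X y (wh y) k 0) x b 0 =
  (area_density X x)^-1 * \sum_m (christoffel x b l m * wh x m 0 +
    gram X x l m * 'D_(basis b) (fun y => wh y m 0) x -
    density_dlog x b * gram X x l m * wh x m 0).
  have D k : grad_hat (fun y => contravariant X y (wh y) k 0) x b 0 =
      'D_(basis b) (fun y => contravariant X y (wh y) k 0) x by rewrite mxE.
  have D' k := @derive_val _ _ _ _ _ _ _ (is_derive_contravariant b k Ux dX dw).
  by rewrite sum_I3 !D !D' !sum_I2 !gramE /christoffel !sum_I3; ring.
under eq_bigr => l _ do under eq_bigr => b _ do rewrite P sum_I2.
rewrite sum_I2 !(sum_I2 (fun b => invmx _ _ b * _)).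
have [g00 g11 g01 g10] := invmx_gram dX; rewrite -/(gram X x) in g00 g11 g01 g10.
rewrite g00 g11 g01 g10 (gram_symE x 1 0).
rewrite (christoffel_sym 1 0 0 Ux) (christoffel_sym 1 1 0 Ux) /div_hat sum_I2.
apply: (@div_identity R _ _ _ _ _ _ _ _ _ _ _ _ _ _ _ _ (\det (gram X x))
  (density_dlog x 0) (density_dlog x 1)).
- exact: det_gramE.
- by rewrite gt_eqF.
- by rewrite /density_dlog.
- by rewrite /density_dlog (christoffel_sym 1 0 0 Ux) (christoffel_sym 1 1 0 Ux).
Qed.

End jacobian.

(* [pik] is the k-th partial derivative of psi_i, [wkb] that of v_b at psi(x);
   [h0], [h1] are the mixed second partials of psi, which drop out. *)
Fact pullback_identity (R : realType)
    (p00 p01 p10 p11 v0 v1 w00 w01 w10 w11 h0 h1 : R) :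
  p01 * (p00 * w00 + p10 * w10) + v0 * h0 + (p11 * (p00 * w01 + p10 * w11) + v1 * h1) -
  (p00 * (p01 * w00 + p11 * w10) + v0 * h0 + (p10 * (p01 * w01 + p11 * w11) + v1 * h1)) =
  (w01 - w10) * (p00 * p11 - p01 * p10).
Proof. ring. Qed.

(** * Pull-back of planar 1-forms *)

Section pullback.
Context {R : realType}.
Local Notation E := 'cV[R]_2.
Variables (U U' : set E) (psi vh : E -> E).
Hypotheses (oU : open U) (psi2 : Cn_on 2 U psi) (oU' : open U') (vh1 : Cn_on 1 U' vh).

Definition jac2 x : 'M[R]_2 := \matrix_(i, k) ('D_(basis k) psi x) i 0.

(** [vh] is read as the coefficients of a 1-form. *)
Definition pullback (x : E) : E := (jac2 x)^T *m vh (psi x).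

Let V := U `&` psi @^-1` U'.

Let oV : open V.
Proof. by apply: open_setI_preimage => // x Ux; exact: Cn_on_continuous psi2 Ux. Qed.

Let psi2V : Cn_on 2 V psi. Proof. by apply: Cn_on_sub psi2 => x []. Qed.

Let vhV k : Cn_on 1 V (fun x => vh (psi x) k 0).
Proof.
have /(C1_col _ oU') vk := vh1.
exact: (@C1_comp _ _ V U' psi (fun y => vh y k 0) oV (Cn_onS psi2V) (vk k) (fun x Vx => Vx.2)).
Qed.

Lemma pullback_entry k : (fun x => pullback x k 0) = (fun x =>
  'D_(basis k) psi x 0 0 * vh (psi x) 0 0 + 'D_(basis k) psi x 1 0 * vh (psi x) 1 0).
Proof. by apply/funext => x; rewrite mulmx_col2 !mxE. Qed.

Lemma pullback_C1 : Cn_on 1 V pullback.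
Proof.
apply/(C1_col _ oV) => k; rewrite pullback_entry.
by apply: (C1D oV); apply: (C1M oV); [exact: partial_C1|exact: vhV|exact: partial_C1|exact: vhV].
Qed.

(** The exterior derivative commutes with pull-back. The second derivatives of [psi] cancel by
    symmetry, which is where its C^2 regularity enters. *)
Lemma curl_pullback x : V x -> curl_hat pullback x = curl_hat vh (psi x) * \det (jac2 x).
Proof.
move=> Vx; rewrite /curl_hat !pullback_entry.
have d0 k i l := derivableP (diff_derivable (v := basis k) ((partial_C1 oV psi2V i l).1 x Vx)).
have dv k b := derivableP (diff_derivable (v := basis k) ((vhV b).1 x Vx)).
have dvE k b : 'D_(basis k) (fun y => vh (psi y) b 0) x =
   'D_(basis k) psi x 0 0 * 'D_(basis 0) (fun y => vh y b 0) (psi x) +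
   'D_(basis k) psi x 1 0 * 'D_(basis 1) (fun y => vh y b 0) (psi x).
  apply: (@derive_compE _ _ _ psi (fun y => vh y b 0)); first exact: psi2V.1.
  by have /(C1_col _ oU') vk := vh1; exact: (vk b).1 _ Vx.2.
pose P i k := 'D_(basis k) psi x i 0.
pose H i k a := 'D_(basis k) (fun y => 'D_(basis a) psi y i 0) x.
pose W k b := 'D_(basis k) (fun y => vh y b 0) (psi x).
have D k a : 'D_(basis k) (fun y => 'D_(basis a) psi y 0 0 * vh (psi y) 0 0 +
      'D_(basis a) psi y 1 0 * vh (psi y) 1 0) x =
    P 0 a * (P 0 k * W 0 0 + P 1 k * W 1 0) + vh (psi x) 0 0 * H 0 k a +
    (P 1 a * (P 0 k * W 0 1 + P 1 k * W 1 1) + vh (psi x) 1 0 * H 1 k a).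
  apply: etrans (congr2 (fun s t => P 0 a * s + vh (psi x) 0 0 * H 0 k a +
    (P 1 a * t + vh (psi x) 1 0 * H 1 k a)) (dvE k 0) (dvE k 1)).
  exact: (@derive_val _ _ _ _ _ _ _ (is_deriveD (is_deriveM (d0 k 0 a) (dv k 0))
    (is_deriveM (d0 k 1 a) (dv k 1)))).
apply: etrans (congr2 (fun s t => s - t) (D 0 1) (D 1 0)) _.
have Hsym i : H i 1 0 = H i 0 1 by exact: (partial_sym oV psi2V i 0 1 Vx).
have J i k : jac2 x i k = P i k by rewrite mxE.
rewrite (Hsym 0) (Hsym 1) det_mx2 (J 0 0) (J 0 1) (J 1 0) (J 1 1).
exact: pullback_identity.
Qed.

End pullback.

(** * Existence and uniqueness of the surface curl *)

Section surface_curl.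
Context {R : realType}.
Local Notation E := 'cV[R]_2.
Variables (X : E -> 'cV[R]_3) (U : set E) (m : R).
Hypotheses (oU : open U) (TU : That `<=` U) (X2 : Cn_on 2 U X).
Hypotheses (Xinj : {in That &, injective X}) (m0 : 0 < m).
Hypothesis Xcoercive : forall x a, That x ->
  m * dot a a <= dot (jac X x *m a) (jac X x *m a).

Lemma C2_differentiable x : That x -> differentiable X x.
Proof. by move=> /TU; exact: X2.1. Qed.

Lemma area_density_gt0_That x : That x -> 0 < area_density X x.
Proof. by move=> Tx; apply: area_density_gt0; exact: (det_gram_gt0_That m0 Xcoercive). Qed.

(** By the inverse Lipschitz bound the inverse of [X] is continuous on the curved triangle. *)
Lemma continuous_on_triangle (W : topologicalType) (c : 'cV[R]_3 -> W) :
  {within That, continuous (c \o X)} -> {within curved_triangle X, continuous c}.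
Proof.
move=> /subspace_continuousP cX; apply/subspace_continuousP => _ [x Tx <-] P.
move=> cP; have /nbhs_ballP[r /= r0 rP] :
  \forall y \near x, That y -> P (c (X y)) by exact: (cX _ Tx P cP).
have [K K0 XK] := inverse_lipschitz m0 Xinj C2_differentiable Xcoercive Tx.
suff : \forall q \near X x, curved_triangle X q -> P (c q) by [].
apply/nbhs_ballP; exists (r / K) => /=; first by rewrite divr_gt0.
move=> q; rewrite -ball_normE /= => qr [y Ty yq]; rewrite -yq; apply: rP => //.
rewrite -ball_normE /= distrC; apply: (le_lt_trans (XK y Ty)).
by rewrite mulrC -ltr_pdivlMr// yq distrC.
Qed.

Lemma continuous_triangle_comp (W : topologicalType) (c : 'cV[R]_3 -> W) :
  {within curved_triangle X, continuous c} -> {within That, continuous (c \o X)}.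
Proof.
move=> cc; apply: within_continuous_comp cc; last by move=> x; exists x.
by apply: within_That_continuous TU _ => x Ux; exact/differentiable_continuous/X2.1.
Qed.

Lemma density_continuous : {within That, continuous (area_density X)}.
Proof.
apply: within_That_continuous TU _ => x Ux.
apply: (@continuous_comp _ _ _ (fun y => \det (gram X y)) (@Num.sqrt R)).
  exact/differentiable_continuous/(det_gram_C1 oU X2).1.
exact: sqrt_continuous.
Qed.

Lemma jac_comp psi x : differentiable psi x -> That (psi x) ->
  jac (X \o psi) x = jac X (psi x) *m jac2 psi x.
Proof.
move=> dp Tp; apply/matrixP => i k.
rewrite mxE (derive_comp (basis k) dp (C2_differentiable Tp)) jacE; last exact: C2_differentiable.
by rewrite mulmx_col2 [RHS]mxE sum_I2 [jac2 _ _ 0 k]mxE [jac2 _ _ 1 k]mxE.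
Qed.

(** The Gram determinant acquires the square of the determinant of [psi], whose root has the right
    sign because [psi] preserves orientation. *)
Lemma area_density_comp psi x : differentiable psi x -> That (psi x) ->
  0 < \det (jac2 psi x) ->
  area_density (X \o psi) x = area_density X (psi x) * \det (jac2 psi x).
Proof.
move=> dp Tp det0; rewrite /area_density /gram jac_comp// trmx_mul.
set A := jac2 psi x; set B := jac X (psi x).
have -> : A^T *m B^T *m (B *m A) = A^T *m ((B^T *m B) *m A) by rewrite !mulmxA.
rewrite det_mulmx det_tr det_mulmx mulrCA -expr2 sqrtrM; last
  exact/ltW/(det_gram_gt0_That m0 Xcoercive).
by rewrite sqrtr_sqr gtr0_norm.
Qed.

Lemma derive1_edge (f : E -> 'cV[R]_3) a b t : differentiable f (edge_param a b t) ->
  (fun s => f (edge_param a b s))^`()%classic t = jac f (edge_param a b t) *m edge_dir a b.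
Proof.
move=> df; rewrite derive1E -(jacE _ df).
have le : edge_param a b = (fun s => vertex a + s *: edge_dir a b) :> (R -> E).
  by apply/funext => s; exact: edge_param_line.
rewrite le in df *; have dl := differentiable_line (vertex a) (edge_dir a b) t.
by have := derive_comp (1 : R) dl df; rewrite derive_line.
Qed.

Lemma circulation_density (U' : set E) (v : 'cV[R]_3 -> 'cV[R]_3) (vh : E -> E)
    (c : 'cV[R]_3 -> R) psi :
  open U' -> That `<=` U' -> Cn_on 1 U' vh ->
  (forall x, That x -> v (X x) = covariant X x (vh x)) ->
  (forall x, That x -> c (X x) = (area_density X x)^-1 * curl_hat vh x) ->
  oriented_subregion psi ->
  surface_integral (X \o psi) (fun x => c (X (psi x))) = circulation (X \o psi) v.
Proof.
move=> oU' TU' vh1 vE cE [[U1 [oU1 TU1 psi2]] _ Tpsi det0].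
have TV : That `<=` U1 `&` psi @^-1` U'.
  by move=> x Tx; split; [exact: TU1|exact/TU'/Tpsi].
have dpsi x : That x -> differentiable psi x by move=> /TU1; exact: psi2.1.
(* The density of [X] cancels, and the remaining determinant of [psi] is the one in
   [curl_pullback]. *)
transitivity (integral_That (curl_hat (pullback psi vh))).
  apply: eq_integral_That => x Tx.
  rewrite (@curl_pullback _ U1 U')//; last exact: TV.
  rewrite cE; last exact: Tpsi.
  rewrite (area_density_comp (dpsi x Tx) (Tpsi x Tx) (det0 x Tx)).
  by field; rewrite gt_eqF// area_density_gt0_That//; exact: Tpsi.
have oV : open (U1 `&` psi @^-1` U').
  by apply: open_setI_preimage => // x Ux; exact: Cn_on_continuous psi2 Ux.
rewrite (green_That TV oV (pullback_C1 oU1 psi2 oU' vh1)).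
apply: eq_bigr => a _; apply: eq_Rintegral => t.
rewrite inE/= in_itv/= => t01; have Te := edge_param_That a (a + 1) t01.
rewrite (@derive1_edge (X \o psi)); last first.
  by apply: differentiable_comp; [exact: dpsi|exact/C2_differentiable/Tpsi].
rewrite jac_comp; [|exact: dpsi|exact: Tpsi].
rewrite /= vE; last exact: Tpsi.
rewrite -mulmxA dot_covariant; last exact/(det_gram_gt0_That m0 Xcoercive)/Tpsi.
by rewrite /pullback dot_mulmx trmxK.
Qed.

Lemma shrink_jac (x : E) (e : R) : let f := fun y => (1 - e) *: x + e *: y in
  [/\ forall y, differentiable f y,
      forall k, 'D_(basis k) f = (fun=> e *: basis k) &
      forall y, (\matrix_(i, k) ('D_(basis k) f y) i 0) = e%:M :> 'M[R]_2].
Proof.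
move=> f.
have D k y : 'D_(basis k) f y = e *: basis k.
  rewrite (@deriveD _ _ _ (fun=> (1 - e) *: x) (fun y => e *: y)).
  - by rewrite derive_cst add0r (@deriveZ _ _ _ id)// derive_id.
  - exact: derivable_cst.
  - by apply: (@derivableZ _ _ _ id).
split=> //; first by move=> k; apply/funext => y; exact: D.
by move=> y; apply/matrixP => i k; rewrite mxE D !mxE eqxx andbT mulr_natr.
Qed.

Lemma shrink_subregion x (e : R) : That x -> 0 < e <= 1 ->
  oriented_subregion (fun y => (1 - e) *: x + e *: y).
Proof.
move=> Tx /andP[e0 e1].
have [dif D J] := shrink_jac x e.
split.
- exists setT; split; [exact: openT|by []|]; split=> [y _|k]; first exact: dif.
  by rewrite D; exact: (C1_cst _ openT).
- move=> y z _ _ /addrI /(congr1 (fun w => e^-1 *: w)).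
  by rewrite !scalerA mulVf ?gt_eqF// !scale1r.
- by move=> y Ty; apply: That_convex => //; rewrite e1 ltW.
- move=> y _.
  by rewrite J det_scalar exprn_gt0.
Qed.

(* Both densities have the same integral over arbitrarily small triangles
   contracting to [x]. *)
Lemma surface_curl_unique (v : 'cV[R]_3 -> 'cV[R]_3) c1 c2 x : That x ->
  is_surface_curl X v c1 -> is_surface_curl X v c2 -> c1 (X x) = c2 (X x).
Proof.
suff le (d1 d2 : 'cV[R]_3 -> R) : That x ->
    is_surface_curl X v d1 -> is_surface_curl X v d2 -> d1 (X x) <= d2 (X x).
  by move=> Tx h1 h2; apply/le_anti/andP; split; exact: le.
move=> Tx [cd1 H1] [cd2 H2]; rewrite leNgt; apply/negP => lt12.
have c1X := continuous_triangle_comp cd1.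
have c2X := continuous_triangle_comp cd2.
pose q y := (d1 (X y) - d2 (X y)) * area_density X y.
have cq : {within That, continuous q}.
  apply/subspace_continuousP => y Ty; apply: cvgM.
    by apply: cvgB; [move/subspace_continuousP: c1X|move/subspace_continuousP: c2X]; exact.
  by move/subspace_continuousP: density_continuous; exact.
have q0 : 0 < q x by rewrite mulr_gt0 ?area_density_gt0_That// subr_gt0.
have /nbhs_ballP[r /= r0 rP] : \forall y \near x, That y -> q x / 2 < q y.
  have /subspace_continuousP/(_ x Tx) := cq.
  by move/(cvgr_gt (q x)); apply; rewrite ltr_pdivrMr// ltr_pMr// ltr1n.
(* Points of the triangle are at most 2 apart, so the contracted copy stays within r/2 of [x]. *)
pose e := Num.min 1 (r / 4).
have e01 : 0 < e <= 1 by rewrite lt_min ltr01 divr_gt0//= ge_min lexx.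
have /andP[e0 e1] := e01.
pose psi (y : E) : E := (1 - e) *: x + e *: y.
have Opsi : oriented_subregion psi by exact: shrink_subregion.
have [[U1 [oU1 TU1 psi2]] _ Tpsi det0] := Opsi.
have dpsi y : That y -> differentiable psi y by move=> /TU1; exact: psi2.1.
have cpsi : {within That, continuous psi}.
  by apply: within_That_continuous TU1 _ => y Uy; exact/differentiable_continuous/psi2.1.
have dete y : That y -> \det (jac2 psi y) = e ^+ 2.
  move=> Ty; have [_ _ D] := shrink_jac x e; by rewrite /jac2 D det_scalar.
pose p (d : 'cV[R]_3 -> R) y := d (X (psi y)) * area_density (X \o psi) y.
have pE d y : That y -> p d y = d (X (psi y)) * (area_density X (psi y) * e ^+ 2).
  by move=> Ty; rewrite /p (area_density_comp (dpsi y Ty) (Tpsi y Ty) (det0 y Ty)) dete.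
have cp d : {within curved_triangle X, continuous d} -> {within That, continuous (p d)}.
  move=> cd; have cX := continuous_triangle_comp cd.
  have cdp : {within That, continuous (fun y => d (X (psi y)) * (area_density X (psi y) * e ^+ 2))}.
    apply/subspace_continuousP => y Ty; apply: cvgM.
      by move/subspace_continuousP: (within_continuous_comp cpsi Tpsi cX); exact.
    apply: cvgM; last exact: cvg_cst.
    by move/subspace_continuousP: (within_continuous_comp cpsi Tpsi density_continuous); exact.
  by apply: subspace_eq_continuous cdp => y /[!inE] Ty; exact/esym/pE.
have I0 : integral_That (fun y => p d1 y - p d2 y) = 0.
  rewrite (integral_ThatB (cp _ cd1) (cp _ cd2)).
  have := H1 psi Opsi; rewrite -(H2 psi Opsi) /surface_integral => I12.
  by apply/eqP; rewrite subr_eq0; apply/eqP; exact: I12.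
have : 0 < integral_That (fun y => p d1 y - p d2 y).
  apply: (@integral_That_gt0 _ _ (q x / 2 * e ^+ 2)).
  - by rewrite mulr_gt0 ?divr_gt0// exprn_gt0.
  - apply/subspace_continuousP => y Ty; apply: cvgB.
      by move/subspace_continuousP: (cp _ cd1); exact.
    by move/subspace_continuousP: (cp _ cd2); exact.
  move=> y Ty; rewrite !pE//.
  have -> : d1 (X (psi y)) * (area_density X (psi y) * e ^+ 2) -
      d2 (X (psi y)) * (area_density X (psi y) * e ^+ 2) = q (psi y) * e ^+ 2.
    by rewrite /q; ring.
  apply: ler_wpM2r; first by rewrite exprn_ge0// ltW.
  apply: ltW; apply: rP; last exact: Tpsi.
  rewrite -ball_normE /= distrC.
  have -> : psi y - x = e *: (y - x).
    by apply: col2P; rewrite !mxE; ring.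
  rewrite normrZ gtr0_norm//.
  have : `|y - x| <= 2.
    rewrite (le_trans (ler_normB _ _))//.
    by have := That_norm_le Ty; have := That_norm_le Tx; lra.
  move=> yx2; apply: (@le_lt_trans _ _ (r / 4 * 2)); last by lra.
  apply: ler_pM => //; first exact: ltW.
  by rewrite /e ge_min lexx orbT.
by rewrite I0 ltxx.
Qed.

(** A curl density is a function of points in space, so the candidate needs the reference point; off
    the triangle the value is arbitrary. *)
Definition inverse_point (p : 'cV[R]_3) : E := get [set x | That x /\ X x = p].

Lemma inverse_pointK x : That x -> inverse_point (X x) = x.
Proof.
move=> Tx; have [Ty Xy] : [set y | That y /\ X y = X x] (inverse_point (X x)).
  by apply: getPex; exists x.
by apply: Xinj; rewrite ?inE.
Qed.

Lemma surface_curlE (U' : set E) (v : 'cV[R]_3 -> 'cV[R]_3) (vh : E -> E) :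
  open U' -> That `<=` U' -> Cn_on 1 U' vh ->
  (forall x, That x -> v (X x) = covariant X x (vh x)) ->
  has_surface_curl X v /\
  forall x, That x -> surface_curl X v (X x) = (area_density X x)^-1 * curl_hat vh x.
Proof.
move=> oU' TU' vh1 vE.
pose c p := (area_density X (inverse_point p))^-1 * curl_hat vh (inverse_point p).
have cE x : That x -> c (X x) = (area_density X x)^-1 * curl_hat vh x.
  by move=> Tx; rewrite /c inverse_pointK.
have /(C1_col _ oU') vk := vh1.
have cc : is_surface_curl X v c.
  split; last by move=> psi; exact: (circulation_density oU' TU' vh1 vE cE).
  apply: continuous_on_triangle.
  have cf : {within That, continuous (fun x => (area_density X x)^-1 * curl_hat vh x)}.
    apply/subspace_continuousP => x Tx; apply: cvgM.
      apply: cvgV; first by rewrite gt_eqF// area_density_gt0_That.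
      by move/subspace_continuousP: density_continuous; exact.
    apply: cvg_within_filter; apply: cvgB.
      by apply: (vk 1).2; exact: TU'.
    by apply: (vk 0).2; exact: TU'.
  by apply: subspace_eq_continuous cf => x /[!inE] Tx; exact/esym/cE.
have hc : has_surface_curl X v by exists c.
split=> // x Tx; rewrite -cE//.
by apply: surface_curl_unique Tx _ cc; exact: getPex hc.
Qed.

End surface_curl.

(** * Polynomials and Bernstein coefficients *)

Section polynomials.
Context {R : realType}.
Local Notation E := 'cV[R]_2.
Implicit Types (f g : E -> R) (n : nat).

Lemma is_poly_mono n (c : R) i j : (i + j <= n)%N ->
  is_poly n (fun x : E => c * x 0 0 ^+ i * x 1 0 ^+ j).
Proof.
move=> ijn; exists (fun k l => if (k == i) && (l == j) then c else 0) => x.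
have iN : (i < n.+1)%N by rewrite ltnS (leq_trans _ ijn)// leq_addr.
have jN : (j < n.+1)%N by rewrite ltnS (leq_trans _ ijn)// leq_addl.
rewrite (bigD1 (Ordinal iN))//= [X in _ + X]big1 ?addr0; last first.
  move=> k /negbTE ki; rewrite big1// => l _.
  by rewrite (_ : (k == i :> nat) = false) ?mul0r.
rewrite (bigD1 (Ordinal jN))//= !eqxx/= big1 ?addr0// => l /andP[_ /negbTE lj].
by rewrite (_ : (l == j :> nat) = false) ?andbF ?mul0r.
Qed.

Lemma is_poly0 n : is_poly n (fun _ : E => 0).
Proof.
exists (fun _ _ => 0) => x; rewrite big1// => i _; rewrite big1// => j _.
by rewrite !mul0r.
Qed.

Lemma is_polyD n f g : is_poly n f -> is_poly n g -> is_poly n (fun x => f x + g x).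
Proof.
move=> [c fE] [e gE]; exists (fun i j => c i j + e i j) => x.
rewrite fE gE -big_split/=; apply: eq_bigr => i _.
by rewrite -big_split/=; apply: eq_bigr => j _; rewrite !mulrDl.
Qed.

(** Reduces properties of polynomials to zero, sums and monomials. *)
Lemma is_poly_ind n f (P : (E -> R) -> Prop) : is_poly n f ->
  P (fun=> 0) -> (forall g h, P g -> P h -> P (fun x => g x + h x)) ->
  (forall c i j, (i + j <= n)%N -> P (fun x => c * x 0 0 ^+ i * x 1 0 ^+ j)) -> P f.
Proof.
move=> [c fE] P0 PD Pm.
have Psum (I : finType) (p : pred I) (g : I -> E -> R) :
    (forall i, p i -> P (g i)) -> P (fun x => \sum_(i | p i) g i x).
  move=> Pg; elim: (index_enum I) => [|i s IH].
    by rewrite (_ : (fun x : E => _) = fun=> 0)//; apply/funext => x; rewrite big_nil.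
  have [pi|pi] := boolP (p i).
    rewrite (_ : (fun x : E => _) = fun x => g i x + \sum_(j <- s | p j) g j x).
      by apply: PD => //; exact: Pg.
    by apply/funext => x; rewrite big_cons pi.
  rewrite (_ : (fun x : E => _) = fun x => \sum_(j <- s | p j) g j x)//.
  by apply/funext => x; rewrite big_cons (negbTE pi).
rewrite (_ : f = fun x => \sum_(i < n.+1) \sum_(j < n.+1 | (i + j <= n)%N)
    c i j * x 0 0 ^+ i * x 1 0 ^+ j); last exact/funext.
apply: (Psum _ _ (fun (i : 'I_n.+1) x => \sum_(j < n.+1 | (i + j <= n)%N)
    c i j * x 0 0 ^+ i * x 1 0 ^+ j)) => i _.
by apply: (Psum _ _ (fun (j : 'I_n.+1) x => c i j * x 0 0 ^+ i * x 1 0 ^+ j)) => j; exact: Pm.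
Qed.

Lemma is_polyW n m f : (n <= m)%N -> is_poly n f -> is_poly m f.
Proof.
move=> nm nf; apply: (is_poly_ind nf); first exact: is_poly0.
  by move=> g h; exact: is_polyD.
by move=> c i j ijn; apply: is_poly_mono; exact: leq_trans nm.
Qed.

Lemma is_polyN n f : is_poly n f -> is_poly n (fun x => - f x).
Proof.
move=> nf; apply: (is_poly_ind (P := fun f => is_poly n (fun x => - f x)) nf).
- by under eq_fun do rewrite oppr0; exact: is_poly0.
- move=> g h ng nh; rewrite (_ : (fun x : E => _) = (fun x => - g x + - h x)).
    exact: is_polyD.
  by apply/funext => x; rewrite opprD.
- move=> c i j ijn; rewrite (_ : (fun x : E => _) = (fun x => - c * x 0 0 ^+ i * x 1 0 ^+ j)).
    exact: is_poly_mono.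
  by apply/funext => x; rewrite !mulNr.
Qed.

Lemma is_polyB n f g : is_poly n f -> is_poly n g -> is_poly n (fun x => f x - g x).
Proof. by move=> nf ng; apply: is_polyD => //; exact: is_polyN. Qed.

Lemma differentiable_entry k (x : E) : differentiable (fun y : E => y k 0 : R) x.
Proof. exact: differentiable_coord. Qed.

Lemma derive_entry k (x v : E) : 'D_v (fun y : E => y k 0 : R) x = v k 0.
Proof. by rewrite (@derive_col R E 2 id x v k)// derive_id. Qed.

Lemma is_derive_entry_exp k p (x v : E) : is_derive x v (fun y : E => y k 0 ^+ p : R)
  (p%:R * x k 0 ^+ p.-1 * v k 0).
Proof.
have de : is_derive x v (fun y : E => y k 0 : R) (v k 0).
  apply: DeriveDef; last exact: derive_entry.
  exact/diff_derivable/differentiable_entry.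
elim: p => [|p IH].
  under eq_fun do rewrite expr0.
  by apply: (is_derive_eq (is_derive_cst (1 : R) x v)); rewrite !mul0r.
rewrite (_ : (fun y : E => _) = (fun y : E => y k 0 * y k 0 ^+ p)); last first.
  by apply/funext => y; rewrite exprS.
apply: (is_derive_eq (is_deriveM de IH)); rewrite /GRing.scale/=.
(* The predecessor is truncated, so the exponent 0 is separated. *)
by case: p {IH} => [|p]; rewrite ?expr0 -?natr1 ?exprS/=; ring.
Qed.

Lemma differentiable_mono (c : R) i j (x : E) :
  differentiable (fun y : E => c * y 0 0 ^+ i * y 1 0 ^+ j) x.
Proof.
have dX k l : differentiable (fun y : E => y k 0 ^+ l : R) x.
  elim: l => [|l IH]; first by under eq_fun do rewrite expr0; exact: differentiable_cst.
  rewrite (_ : (fun y : E => _) = (fun y : E => y k 0 * y k 0 ^+ l)); last first.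
    by apply/funext => y; rewrite exprS.
  exact: (differentiableM (differentiable_entry k x) IH).
exact: (differentiableM (differentiableM (differentiable_cst c x) (dX 0 i)) (dX 1 j)).
Qed.

Lemma is_poly_differentiable n f x : is_poly n f -> differentiable f x.
Proof.
move=> nf; apply: (is_poly_ind (P := fun f => differentiable f x) nf) => //.
- by move=> g h dg dh; exact: differentiableD.
- by move=> c i j _; exact: differentiable_mono.
Qed.

Lemma derive_mono (c : R) i j k (x : E) :
  'D_(basis k) (fun y : E => c * y 0 0 ^+ i * y 1 0 ^+ j) x =
  if k == 0 then c * i%:R * x 0 0 ^+ i.-1 * x 1 0 ^+ j
  else c * j%:R * x 0 0 ^+ i * x 1 0 ^+ j.-1.
Proof.
have dX l p := is_derive_entry_exp l p x (basis k).
have D := @derive_val _ _ _ _ _ _ _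
  (is_deriveM (is_deriveM (is_derive_cst c x (basis k)) (dX 0 i)) (dX 1 j)).
apply: (etrans D); rewrite /GRing.scale/= !fctE !mxE !eqxx !andbT.
have [->|->] : k = 0 \/ k = 1 by case: k {dX D} => -[|[|]]//= l; [left|right]; exact/val_inj.
  by rewrite /=; ring.
by rewrite /=; ring.
Qed.

Lemma eq_is_poly n f g : (forall x, f x = g x) -> is_poly n g -> is_poly n f.
Proof. by move=> /funext ->. Qed.

Lemma is_poly_derive n f k : is_poly n.+1 f -> is_poly n (fun x => 'D_(basis k) f x).
Proof.
(* Differentiability travels through the induction because the sum rule asks for it. *)
move=> nf; suff [] : (forall x, differentiable f x) /\ is_poly n (fun x => 'D_(basis k) f x) by [].
apply: (is_poly_ind (P := fun f => (forall x, differentiable f x) /\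
  is_poly n (fun x => 'D_(basis k) f x)) nf).
- split=> [x|]; first exact: differentiable_cst.
  apply: (eq_is_poly (g := fun=> 0)) => [x|]; [exact: derive_cst|exact: is_poly0].
- move=> g h [dg ng] [dh nh]; split=> [x|]; first exact: differentiableD.
  apply: (eq_is_poly _ (is_polyD ng nh)) => x.
  by apply: deriveD; exact: diff_derivable.
- move=> c i j ijn; split=> [x|]; first exact: differentiable_mono.
  apply: (eq_is_poly (fun x => derive_mono c i j k x)).
  case: (k == 0).
    (* For exponent 0 the truncated predecessor lowers no degree, but the coefficient vanishes. *)
    case: i ijn => [|i] ijn; last exact: is_poly_mono.
    by apply: (eq_is_poly _ (is_poly0 n)) => x; rewrite mulr0 !mul0r.
  case: j ijn => [|j] ijn; last by apply: is_poly_mono; rewrite addnS in ijn.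
  by apply: (eq_is_poly _ (is_poly0 n)) => x; rewrite mulr0 !mul0r.
Qed.

Lemma is_poly_C1 n f : is_poly n f -> Cn_on 1 setT f.
Proof.
move=> nf; split=> [x _|k x _]; first exact: is_poly_differentiable nf.
apply: differentiable_continuous; apply: (@is_poly_differentiable n).
by apply: is_poly_derive; exact: is_polyW nf.
Qed.

Lemma is_vpoly_C1 n (v : E -> E) : is_vpoly n v -> Cn_on 1 setT v.
Proof. by move=> nv; apply/(C1_col _ openT) => k; exact: is_poly_C1 (nv k). Qed.

(** Substitutes the affine coordinates of the edge. As formal polynomials, traces that agree on
    [0,1] also have equal derivatives. *)
Lemma is_poly_edge n f a b : is_poly n f -> exists2 P : {poly R},
  (size P <= n.+1)%N & forall t, f (edge_param a b t) = P.[t].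
Proof.
move=> nf; apply: (is_poly_ind (P := fun f => exists2 P : {poly R},
  (size P <= n.+1)%N & forall t, f (edge_param a b t) = P.[t]) nf).
- by exists 0 => [|t]; rewrite ?size_poly0 ?horner0.
- move=> g h [P sP gP] [Q sQ hQ]; exists (P + Q) => [|t].
    by rewrite (leq_trans (size_polyD _ _))// geq_max sP.
  by rewrite hornerD gP hQ.
- move=> c i j ijn.
  pose L k : {poly R} := (vertex a k 0)%:P + edge_dir a b k 0 *: 'X.
  have sL k p : (size (L k ^+ p) <= p.+1)%N.
    rewrite (leq_trans (size_poly_exp_leq _ _))// ltnS -[leqRHS]mul1n leq_mul2r.
    apply/orP; right; rewrite -subn1 leq_subLR addn1.
    rewrite (leq_trans (size_polyD _ _))// geq_max (leq_trans (size_polyC_leq1 _))//=.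
    by rewrite (leq_trans (size_scale_leq _ _))// size_polyX.
  exists (c *: (L 0 ^+ i * L 1 ^+ j)) => [|t].
    rewrite (leq_trans (size_scale_leq _ _))// (leq_trans (size_polyMleq _ _))//.
    rewrite -subn1 leq_subLR (leq_trans (leq_add (sL 0 i) (sL 1 j)))//.
    by rewrite addSn addnS add1n !ltnS.
  have LE k : edge_param a b t k 0 = (L k).[t].
    rewrite edge_param_line mxE [X in _ + X]mxE /L.
    by rewrite hornerD hornerC hornerZ hornerX mulrC.
  by rewrite hornerZ hornerM !horner_exp !LE mulrA.
Qed.

End polynomials.

(** * Univariate Bernstein expansions *)

Section bernstein.
Context {R : realType}.
Implicit Types (P Q : {poly R}) (f g : R -> R).

Definition bernstein_span n f : Prop := exists c : 'I_n.+1 -> R, forall t,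
  f t = \sum_(k < n.+1) c k * ('C(n, k)%:R * t ^+ k * (1 - t) ^+ (n - k)).

Lemma bernstein_spanD n f g : bernstein_span n f -> bernstein_span n g ->
  bernstein_span n (fun t => f t + g t).
Proof.
move=> [c fE] [e gE]; exists (fun k => c k + e k) => t.
by rewrite fE gE -big_split/=; apply: eq_bigr => k _; rewrite mulrDl.
Qed.

Lemma bernstein_spanZ n a f : bernstein_span n f -> bernstein_span n (fun t => a * f t).
Proof.
move=> [c fE]; exists (fun k => a * c k) => t.
by rewrite fE mulr_sumr; apply: eq_bigr => k _; rewrite mulrA.
Qed.

Lemma bernstein_span_sum n m (f : 'I_m -> R -> R) :
  (forall i, bernstein_span n (f i)) -> bernstein_span n (fun t => \sum_i f i t).
Proof.
elim: m f => [|m IH] f bf.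
  exists (fun=> 0) => t; rewrite big_ord0 big1// => k _; exact: mul0r.
rewrite (_ : (fun t => _) = (fun t => f ord0 t + \sum_(i < m) f (lift ord0 i) t)).
  by apply: bernstein_spanD => //; exact: IH.
by apply/funext => t; rewrite big_ord_recl.
Qed.

Lemma bernstein_span_basis n k : (k <= n)%N ->
  bernstein_span n (fun t => t ^+ k * (1 - t) ^+ (n - k)).
Proof.
move=> kn; have kN : (k < n.+1)%N by [].
exists (fun i => if i == Ordinal kN then 'C(n, k)%:R^-1 else 0) => t.
rewrite (bigD1 (Ordinal kN))//= eqxx big1 ?addr0; last first.
  by move=> i /negbTE ->; rewrite mul0r.
by rewrite -mulrA mulKf// pnatr_eq0 -lt0n bin_gt0.
Qed.

(* [t^m = t^m ((1 - t) + t)^(n - m)]. *)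
Lemma bernstein_span_exp n m : (m <= n)%N -> bernstein_span n (fun t => t ^+ m).
Proof.
move=> mn.
rewrite (_ : (fun t => _) = (fun t => \sum_(l < (n - m).+1)
    'C(n - m, l)%:R * (t ^+ (m + l) * (1 - t) ^+ (n - (m + l))))).
  apply: bernstein_span_sum => l; apply: bernstein_spanZ.
  by apply: bernstein_span_basis; rewrite -leq_subRL// -ltnS.
apply/funext => t; have := exprDn (1 - t) t (n - m).
rewrite subrK expr1n => /(congr1 ( *%R (t ^+ m))); rewrite mulr1 => ->.
rewrite mulr_sumr; apply: eq_bigr => l _.
by rewrite subnDA exprD -mulr_natl; ring.
Qed.

Lemma bernstein_span_horner n P : (size P <= n.+1)%N -> bernstein_span n (horner P).
Proof.
move=> sP; rewrite (_ : horner P = fun t => \sum_(i < size P) P`_i * t ^+ i).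
  apply: bernstein_span_sum => i; apply: bernstein_spanZ; apply: bernstein_span_exp.
  by rewrite -ltnS (leq_trans _ sP).
by apply/funext => t; rewrite horner_coef.
Qed.

Lemma poly_eq_on01 P Q : (forall t, 0 <= t <= 1 -> P.[t] = Q.[t]) -> P = Q.
Proof.
move=> PQ; apply/eqP; rewrite -subr_eq0; apply/negPn/negP => PQ0.
(* The points 1/(k+1) lie in [0,1], are distinct, and are one more than the degree of a nonzero
   difference allows. *)
pose rs : seq R := [seq k.+1%:R^-1 | k <- iota 0 (size (P - Q))].
have := max_poly_roots PQ0 (rs := rs); rewrite size_map size_iota ltnn => H.
suff : false by []; apply: H.
  apply/allP => _ /mapP[k _ ->]; rewrite /root !hornerE PQ ?subrr//.
  by rewrite invr_ge0 ler0n/= invf_le1 ?ltr0n// ler1n.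
rewrite map_inj_uniq ?iota_uniq// => k l /invr_inj/eqP.
by rewrite eqr_nat eqSS => /eqP.
Qed.

Lemma same_bernstein_horner n P f g : (size P <= n.+1)%N ->
  (forall t, 0 <= t <= 1 -> f t = P.[t]) -> (forall t, 0 <= t <= 1 -> g t = P.[t]) ->
  same_bernstein_coefs n f g.
Proof.
move=> /bernstein_span_horner[c PE] fP gP.
by exists c => t t01; rewrite ?fP ?gP.
Qed.

Lemma same_bernstein_eq n f g t : same_bernstein_coefs n f g -> 0 <= t <= 1 ->
  f t = g t.
Proof. by move=> [c fc gc] t01; rewrite fc// gc. Qed.

(** By the chain rule, the tangential component of a gradient on an edge is determined by the trace
    alone. *)
Lemma derive_edge_horner (f : 'cV[R]_2 -> R) a b P t :
  (forall x, differentiable f x) -> (forall t, f (edge_param a b t) = P.[t]) ->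
  dot (grad_hat f (edge_param a b t)) (edge_dir a b) = P^`().[t].
Proof.
move=> df fP; rewrite derivE derive1E -grad_hatE//.
have -> : horner P = (fun s => f (vertex a + s *: edge_dir a b)).
  by apply/funext => s; rewrite -fP edge_param_line.
have dl := is_derive_line (df (vertex a + t *: edge_dir a b)).
by rewrite edge_param_line (@derive_val _ _ _ _ _ _ _ dl).
Qed.

End bernstein.

(** * The de Rham subcomplex *)

Lemma C1_congr {R : realType} {W : normedModType R} (U : set 'cV[R]_2) (f g : 'cV[R]_2 -> W) :
  open U -> (forall x, U x -> f x = g x) -> Cn_on 1 U f -> Cn_on 1 U g.
Proof.
move=> oU fg [df cf].
have nfg x : U x -> \forall y \near x, f y = g y.
  by move=> Ux; apply: filterS fg _; exact: open_nbhs_nbhs.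
apply: (@C1_intro _ _ _ _ (fun k => 'D_(basis k) f)) => //.
- by move=> x Ux; apply: near_eq_differentiable (nfg x Ux) _; exact: df.
- by move=> k x Ux; apply/esym/near_eq_derive; exact: nfg.
Qed.

(** * Regularity and metric-free pairings of mapped fields *)

Section element_fields.
Context {R : realType}.
Local Notation E := 'cV[R]_2.
Variables (X : E -> 'cV[R]_3) (U : set E).
Hypotheses (oU : open U) (X2 : Cn_on 2 U X).
Hypothesis Udet : forall x, U x -> 0 < \det (gram X x).

Lemma density_C1 : Cn_on 1 U (area_density X).
Proof. exact: (C1_sqrt oU Udet (det_gram_C1 oU X2)). Qed.

Lemma inv_density_C1 : Cn_on 1 U (fun x => (area_density X x)^-1).
Proof.
apply: (C1V oU _ density_C1) => x Ux; rewrite gt_eqF//.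
by apply: area_density_gt0; exact: Udet.
Qed.

Lemma jac_mulmx_C1 (v : E -> E) : Cn_on 1 U v ->
  Cn_on 1 U (fun x => jac X x *m v x).
Proof.
move=> /(C1_col _ oU) cv; apply/(C1_col _ oU) => k.
have -> : (fun x => (jac X x *m v x) k 0) =
    (fun x => jac X x k 0 * v x 0 0 + jac X x k 1 * v x 1 0).
  by apply/funext => x; rewrite mulmx_col2.
exact: (C1D oU (C1M oU (jac_C1 oU X2 _ _) (cv _)) (C1M oU (jac_C1 oU X2 _ _) (cv _))).
Qed.

Lemma contravariant_C1 (v : E -> E) : Cn_on 1 U v ->
  Cn_on 1 U (fun x => contravariant X x (v x)).
Proof.
move=> /jac_mulmx_C1/(C1_col _ oU) cv; apply/(C1_col _ oU) => k.
have -> : (fun x => contravariant X x (v x) k 0) =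
    (fun x => (area_density X x)^-1 * (jac X x *m v x) k 0).
  by apply/funext => x; rewrite mxE.
exact: (C1M oU inv_density_C1 (cv _)).
Qed.

Lemma inv_gram_C1 k l : Cn_on 1 U (fun x => invmx (gram X x) k l).
Proof.
have cd : Cn_on 1 U (fun x => (\det (gram X x))^-1).
  by apply: (C1V oU _ (det_gram_C1 oU X2)) => x Ux; rewrite gt_eqF// Udet.
have cg := gram_C1 oU X2.
have E2 (i : 'I_2) : i = 0 \/ i = 1.
  by case: i => -[|[|]]//= p; [left|right]; exact/val_inj.
case: (E2 k) => ->; case: (E2 l) => ->.
- by apply: (C1_congr oU _ (C1M oU (cg 1 1) cd)) => x /Udet/invmx_gram[].
- by apply: (C1_congr oU _ (C1M oU (C1N oU (cg 0 1)) cd)) => x /Udet/invmx_gram[].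
- by apply: (C1_congr oU _ (C1M oU (C1N oU (cg 0 1)) cd)) => x /Udet/invmx_gram[].
- by apply: (C1_congr oU _ (C1M oU (cg 0 0) cd)) => x /Udet/invmx_gram[].
Qed.

Lemma inv_gram_mulmx_C1 (v : E -> E) : Cn_on 1 U v ->
  Cn_on 1 U (fun x => invmx (gram X x) *m v x).
Proof.
move=> /(C1_col _ oU) cv; apply/(C1_col _ oU) => k.
have -> : (fun x => (invmx (gram X x) *m v x) k 0) =
    (fun x => invmx (gram X x) k 0 * v x 0 0 + invmx (gram X x) k 1 * v x 1 0).
  by apply/funext => x; rewrite mulmx_col2.
exact: (C1D oU (C1M oU (inv_gram_C1 _ _) (cv _)) (C1M oU (inv_gram_C1 _ _) (cv _))).
Qed.

Lemma covariant_C1 (v : E -> E) : Cn_on 1 U v ->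
  Cn_on 1 U (fun x => covariant X x (v x)).
Proof.
move=> cv; rewrite (_ : (fun x => _) = (fun x => jac X x *m (invmx (gram X x) *m v x))).
  exact/jac_mulmx_C1/inv_gram_mulmx_C1.
by apply/funext => x; rewrite /covariant mulmxA.
Qed.

(** Inverts the contravariant map on tangent vectors, since G^-1 J^T is a left inverse of J. *)
Definition flux_pullback (h : E -> 'cV[R]_3) (x : E) : E :=
  area_density X x *: (invmx (gram X x) *m ((jac X x)^T *m h x)).

Lemma flux_pullback_C1 (h : E -> 'cV[R]_3) : Cn_on 1 U h -> Cn_on 1 U (flux_pullback h).
Proof.
move=> /(C1_col _ oU) ch.
have cJ : Cn_on 1 U (fun x => (jac X x)^T *m h x).
  apply/(C1_col _ oU) => k.
  have -> : (fun x => ((jac X x)^T *m h x) k 0) = (fun x => jac X x 0 k * h x 0 0 +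
      jac X x 1 k * h x 1 0 + jac X x (1 + 1) k * h x (1 + 1) 0).
    apply/funext => x; have T l : (jac X x)^T k l = jac X x l k by rewrite mxE.
    by rewrite mxE sum_I3 !T.
  have m l := C1M oU (jac_C1 oU X2 l k) (ch l).
  exact: (C1D oU (C1D oU (m _) (m _)) (m _)).
have /(C1_col _ oU) cG := inv_gram_mulmx_C1 cJ.
apply/(C1_col _ oU) => k.
have -> : (fun x => flux_pullback h x k 0) = (fun x =>
    area_density X x * (invmx (gram X x) *m ((jac X x)^T *m h x)) k 0).
  by apply/funext => x; rewrite mxE.
exact: (C1M oU density_C1 (cG k)).
Qed.

Lemma flux_pullbackK (h : E -> 'cV[R]_3) x (a : E) : U x -> h x = jac X x *m a ->
  contravariant X x (flux_pullback h x) = h x.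
Proof.
move=> Ux hx; have dx := Udet Ux.
rewrite /contravariant /flux_pullback -scalemxAr scalerA mulVf ?scale1r; last first.
  by rewrite gt_eqF// area_density_gt0.
by rewrite hx [(jac X x)^T *m _]mulmxA mulKmx//; exact: gram_unit.
Qed.

(** The inverse density of the flux field cancels the weight of the surface integral. *)
Lemma dot_contra_co x (w g : E) : U x ->
  dot (contravariant X x w) (covariant X x g) * area_density X x = dot w g.
Proof.
move=> Ux; have dx := Udet Ux.
rewrite /contravariant dotZl dotC (dot_covariant _ _ dx) dotC mulrC.
by rewrite mulVKf// gt_eqF// area_density_gt0.
Qed.

Lemma cross2_mulmx (A : 'M[R]_2) (a b : E) : cross2 (A *m a) (A *m b) = \det A * cross2 a b.
Proof. by rewrite /cross2 !mulmx_col2 det_mx2; ring. Qed.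

(** The two factors G^-1 contribute 1/det G, the normals det G, and the density cancels. *)
Lemma dot_cross_normal x (v g : E) : U x ->
  dot (covariant X x v) (cross (covariant X x g) (unit_normal X x)) * area_density X x =
  cross2 v g.
Proof.
move=> Ux; have dx := Udet Ux; have s0 := area_density_gt0 dx.
rewrite triple_product /covariant -!mulmxA cross_mulmx /unit_normal dotZr dotZl.
rewrite dot_cross_cols -/(gram X x) cross2_mulmx det_inv -(area_density_sqr dx).
by field; rewrite gt_eqF.
Qed.

(** Turns the flux conditions on test fields into conditions on reference fields, free of the
    metric. *)
Lemma contravariant_flux x (w e : E) : U x ->
  dot (contravariant X x w) (cross (jac X x *m e) (unit_normal X x)) = cross2 w e.
Proof.
move=> Ux; have dx := Udet Ux; have s0 := area_density_gt0 dx.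
rewrite /contravariant dotZl triple_product cross_mulmx /unit_normal dotZr dotZl.
rewrite dot_cross_cols -/(gram X x) -(area_density_sqr dx).
by field; rewrite gt_eqF.
Qed.

End element_fields.

(** * Integration by parts on the reference triangle *)

Section integration_by_parts.
Context {R : realType}.
Local Notation E := 'cV[R]_2.
Local Notation mu := (@lebesgue_measure R).
Variables (U : set E) (oU : open U) (TU : That `<=` U).

Lemma C1_continuous_on_That (f : E -> R) : Cn_on 1 U f -> {within That, continuous f}.
Proof.
by case=> df _; apply: within_That_continuous TU _ => x /df; exact: differentiable_continuous.
Qed.

Lemma partial_continuous_on_That (f : E -> R) k : Cn_on 1 U f ->
  {within That, continuous (fun x => 'D_(basis k) f x)}.
Proof. by case=> _ cf; apply: within_That_continuous TU _ => x; exact: cf. Qed.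

Lemma scale_C1 (h : E -> R) (w : E -> E) : Cn_on 1 U h -> Cn_on 1 U w ->
  Cn_on 1 U (fun x => h x *: w x).
Proof.
move=> ch /(C1_col _ oU) cw; apply/(C1_col _ oU) => k.
have -> : (fun x => (h x *: w x) k 0) = (fun x => h x * w x k 0).
  by apply/funext => x; rewrite mxE.
exact: (C1M oU ch (cw k)).
Qed.

Lemma within_sumM (f1 g1 f2 g2 : E -> R) :
  {within That, continuous f1} -> {within That, continuous g1} ->
  {within That, continuous f2} -> {within That, continuous g2} ->
  {within That, continuous (fun x => f1 x * g1 x + f2 x * g2 x)}.
Proof.
move=> /subspace_continuousP c1 /subspace_continuousP d1.
move=> /subspace_continuousP c2 /subspace_continuousP d2.
apply/subspace_continuousP => x Tx; apply: cvgD.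
  by apply: cvgM; [exact: c1|exact: d1].
by apply: cvgM; [exact: c2|exact: d2].
Qed.

Lemma derive_scale_entry (h : E -> R) (w : E -> E) k l x :
  Cn_on 1 U h -> Cn_on 1 U w -> U x ->
  'D_(basis k) (fun y => (h y *: w y) l 0) x =
  h x * 'D_(basis k) (fun y => w y l 0) x + w x l 0 * 'D_(basis k) h x.
Proof.
move=> ch /(C1_col _ oU) cw Ux.
rewrite (_ : (fun y => _) = (fun y => h y * w y l 0)); last first.
  by apply/funext => y; rewrite mxE.
by apply: deriveM; apply: diff_derivable; [exact: ch.1|exact: (cw l).1].
Qed.

Lemma div_by_parts (h : E -> R) (w : E -> E) : Cn_on 1 U h -> Cn_on 1 U w ->
  integral_That (fun x => h x * div_hat w x) +
  integral_That (fun x => dot (w x) (grad_hat h x)) =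
  \sum_(a < 3) \int[mu]_(t in `[0, 1]) (h (edge_param a (a + 1) t) *
    cross2 (w (edge_param a (a + 1) t)) (edge_dir a (a + 1))).
Proof.
move=> ch cw; have /(C1_col _ oU) cwk := cw.
have chh := C1_continuous_on_That ch.
have cwT k := C1_continuous_on_That (cwk k).
have cdh (k : 'I_2) := partial_continuous_on_That (k := k) ch.
have cdw l (k : 'I_2) := partial_continuous_on_That (k := k) (cwk l).
have dE : (fun x => dot (w x) (grad_hat h x)) = (fun x =>
    w x 0 0 * 'D_(basis 0) h x + w x 1 0 * 'D_(basis 1) h x).
  by apply/funext => x; rewrite /dot sum_I2 ![grad_hat _ _ _ _]mxE.
have vE : (fun x => h x * div_hat w x) = (fun x =>
    h x * 'D_(basis 0) (fun y => w y 0 0) x + h x * 'D_(basis 1) (fun y => w y 1 0) x).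
  by apply/funext => x; rewrite /div_hat sum_I2 mulrDr.
rewrite dE vE -integral_ThatD; [|exact: within_sumM|exact: within_sumM].
transitivity (integral_That (div_hat (fun x => h x *: w x))).
  apply: eq_integral_That => x /TU Ux.
  rewrite /div_hat sum_I2 (derive_scale_entry _ _ ch cw Ux) (derive_scale_entry _ _ ch cw Ux).
  by ring.
rewrite (divergence_That TU oU (scale_C1 ch cw)); apply: eq_bigr => a _.
by apply: eq_Rintegral => t _; rewrite /cross2 !(mxE _ _ _ 0); ring.
Qed.

Lemma curl_by_parts (h : E -> R) (v : E -> E) : Cn_on 1 U h -> Cn_on 1 U v ->
  integral_That (fun x => h x * curl_hat v x) -
  integral_That (fun x => cross2 (v x) (grad_hat h x)) =
  \sum_(a < 3) \int[mu]_(t in `[0, 1]) (h (edge_param a (a + 1) t) *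
    dot (v (edge_param a (a + 1) t)) (edge_dir a (a + 1))).
Proof.
move=> ch cv; have /(C1_col _ oU) cvk := cv.
have chh := C1_continuous_on_That ch.
have cvT k := C1_continuous_on_That (cvk k).
have cdh (k : 'I_2) := partial_continuous_on_That (k := k) ch.
have cdv l (k : 'I_2) := partial_continuous_on_That (k := k) (cvk l).
have cN (f : E -> R) : {within That, continuous f} -> {within That, continuous (fun x => - f x)}.
  by move=> /subspace_continuousP cf; apply/subspace_continuousP => x Tx; apply: cvgN; exact: cf.
have dE : (fun x => cross2 (v x) (grad_hat h x)) = (fun x =>
    v x 0 0 * 'D_(basis 1) h x + - v x 1 0 * 'D_(basis 0) h x).
  by apply/funext => x; rewrite /cross2 ![grad_hat _ _ _ _]mxE mulNr.
have vE : (fun x => h x * curl_hat v x) = (fun x =>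
    h x * 'D_(basis 0) (fun y => v y 1 0) x + - h x * 'D_(basis 1) (fun y => v y 0 0) x).
  by apply/funext => x; rewrite /curl_hat mulrBr mulNr.
rewrite dE vE -integral_ThatB; last 2 first.
- by apply: within_sumM => //; exact: cN.
- by apply: within_sumM => //; exact: cN.
transitivity (integral_That (curl_hat (fun x => h x *: v x))).
  apply: eq_integral_That => x /TU Ux.
  rewrite /curl_hat (derive_scale_entry _ _ ch cv Ux) (derive_scale_entry _ _ ch cv Ux).
  by ring.
rewrite (green_That TU oU (scale_C1 ch cv)); apply: eq_bigr => a _.
by apply: eq_Rintegral => t _; rewrite dotZl.
Qed.

End integration_by_parts.

(** * Cancellation across shared edges *)

Section shared_edges.
Context {R : realType} {I : finType}.
Variable F : I -> 'cV[R]_2 -> 'cV[R]_3.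
Hypothesis hF : oriented_triangulation F.
Local Notation mu := (@lebesgue_measure R).

Lemma shared_edge_sym i a b j c d : shared_edge F i a b j c d -> shared_edge F j c d i a b.
Proof.
move=> [ij ab cd FE]; split=> //; first by rewrite eq_sym.
by move=> t t01; rewrite FE.
Qed.

Lemma onem01 (t : R) : 0 <= t <= 1 -> 0 <= 1 - t <= 1.
Proof. by move=> /andP[t0 t1]; rewrite subr_ge0 t1 gerBl. Qed.

Lemma shared_edge_rev i a b j c d : shared_edge F i a b j c d -> shared_edge F i b a j d c.
Proof.
move=> [ij ab cd FE]; split=> //; do ?by rewrite eq_sym.
by move=> t t01; rewrite -!(edge_param_rev _ _ t) FE// onem01.
Qed.

Lemma edge_param0 a b : edge_param a b 0 = vertex a :> 'cV[R]_2.
Proof. by rewrite /edge_param subr0 scale1r scale0r addr0. Qed.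

Lemma edge_param1 a b : edge_param a b 1 = vertex b :> 'cV[R]_2.
Proof. by rewrite /edge_param subrr scale1r scale0r add0r. Qed.

Lemma vertex_inj : injective (vertex : 'I_3 -> 'cV[R]_2).
Proof.
move=> a b ab; have e (k : 'I_2) : (a == k.+1 :> nat)%:R = (b == k.+1 :> nat)%:R :> R.
  by have := congr1 (fun x : 'cV[R]_2 => x k 0) ab; rewrite !mxE.
have en (b1 b2 : bool) : b1%:R = b2%:R :> R -> b1 = b2.
  by case: b1; case: b2 => // /eqP; rewrite ?oner_eq0// eq_sym oner_eq0.
have a1 := en _ _ (e 0); have a2 := en _ _ (e 1); clear e ab.
by case: a b a1 a2 => [[|[|[|]]]//= p] [[|[|[|]]]//= q] _ _; exact/val_inj.
Qed.

(** The neighbour is unique by hypothesis; injectivity of its map then identifies the two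
    parameterizations and hence their endpoints. *)
Lemma shared_edge_functional i a b j c d k e f :
  shared_edge F i a b j c d -> shared_edge F i a b k e f -> [/\ j = k, c = e & d = f].
Proof.
move=> s1 s2; have jk := triangulation_edge hF s1 s2; subst k.
have [_ _ _ F1] := s1; have [_ _ _ F2] := s2.
have [_ Finj _] := triangulation_regular hF j.
have E t : 0 <= t <= 1 -> edge_param c d t = edge_param e f t :> 'cV[R]_2.
  move=> t01; apply: Finj; rewrite ?inE; do ?exact: edge_param_That.
  by rewrite -F1// F2.
split=> //; apply: vertex_inj.
  by have := E 0; rewrite !edge_param0 lexx ler01; exact.
by have := E 1; rewrite !edge_param1 lexx ler01; exact.
Qed.

(** Of two distinct vertices of a triangle one is the successor of the other, and the orientation
    condition decides which. *)
Lemma shared_edge_orientation i a j c d : shared_edge F i a (a + 1) j c d -> c = d + 1.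
Proof.
move=> s; have := triangulation_oriented hF s; rewrite /counterclockwise eqxx.
have [_ _ + _] := s; clear s.
by case: c d => [[|[|[|]]]//= p] [[|[|[|]]]//= q] _ _; exact/val_inj.
Qed.

(** An edge is indexed by its triangle and its first vertex in counterclockwise order; its partner
    runs along the same curve backwards. *)
Let partner (e e' : I * 'I_3) : Prop :=
  shared_edge F e.1 e.2 (e.2 + 1) e'.1 (e'.2 + 1) e'.2.

Let partner_sym e e' : partner e e' -> partner e' e.
Proof. by move=> /shared_edge_sym/shared_edge_rev. Qed.

(** The default value [e] makes every unshared edge a fixed point. *)
Let swap (e : I * 'I_3) := xget e (partner e).

Let swapP e e' : partner e e' -> swap e = e'.
Proof.
move=> ee'; have : partner e (swap e) by apply: xgetPex; exists e'.
move=> ee''; have [] := shared_edge_functional ee' ee''.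
by case: (swap e) e' {ee' ee''} => j c [j' c'] /= -> _ ->.
Qed.

Let swapK : involutive swap.
Proof.
move=> e; have [[e' ee']|ne] := pselect (exists e', partner e e').
  by rewrite (swapP ee'); apply: swapP; exact: partner_sym.
have se : swap e = e by apply: xgetPN => e' ee'; apply: ne; exists e'.
by rewrite !se.
Qed.

(* Contributions of shared edges cancel in pairs under the involution that
   exchanges the two sides of each shared edge. *)
Lemma sum_edges0 (Phi : I -> 'I_3 -> R) :
  (forall i a j c, shared_edge F i a (a + 1) j (c + 1) c -> Phi j c = - Phi i a) ->
  (forall i a, boundary_edge F i a (a + 1) -> Phi i a = 0) ->
  \sum_i \sum_a Phi i a = 0.
Proof.
move=> shared bd; rewrite pair_big /=; set S := \sum_e _.
(* Reindexing by [swap] negates every term; the fixed ones vanish by the boundary condition. *)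
have SN : S = - S.
  rewrite {1}/S (reindex_inj (inv_inj swapK)) /= -sumrN; apply: eq_bigr => e _.
  have [[e' ee']|ne] := pselect (exists e', partner e e').
    by rewrite (swapP ee') (shared _ _ _ _ ee').
  have se : swap e = e by apply: xgetPN => e' ee'; apply: ne; exists e'.
  rewrite se bd ?oppr0//; split; first by case: e.2 => [[|[|[|]]]].
  move=> [j [c [d s]]]; apply: ne; exists (j, d).
  by move: s (shared_edge_orientation s) => + cd; rewrite cd.
by apply/eqP; rewrite -[_ == 0](mulrn_eq0 _ 2) mulr2n {1}SN addNr.
Qed.

(** The integrand is given for all ordered pairs of vertices, so that the partner's term is an
    instance of it, brought back by the substitution of 1 - t for t. *)
Lemma sum_edge_integrals0 (p : I -> 'I_3 -> 'I_3 -> R -> R) :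
  (forall i a b, {within `[0, 1], continuous (p i a b)}) ->
  (forall i a b t, p i b a (1 - t) = - p i a b t) ->
  (forall i a b j c d t, shared_edge F i a b j c d -> 0 <= t <= 1 ->
    p i a b t = p j c d t) ->
  (forall i a b t, boundary_edge F i a b -> 0 <= t <= 1 -> p i a b t = 0) ->
  \sum_i \sum_(a < 3) \int[mu]_(t in `[0, 1]) p i a (a + 1) t = 0.
Proof.
move=> cp rev shared bd; apply: sum_edges0 => [i a j c s|i a b]; last first.
  rewrite (@eq_Rintegral _ _ _ _ _ (fun=> 0)) => [|t]; first by rewrite Rintegral_cst// mul0r.
  by rewrite inE/= in_itv/= => t01; exact: bd.
rewrite -[LHS]Rintegral01_onem// -Rintegral01N//; apply: eq_Rintegral => t.
rewrite inE/= in_itv/= => t01; rewrite rev; congr (- _).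
by apply/esym; exact: shared s t01.
Qed.

End shared_edges.

Section elements.
Context {R : realType} {I : finType}.
Variable F : I -> 'cV[R]_2 -> 'cV[R]_3.
Hypothesis hF : oriented_triangulation F.
Local Notation E := 'cV[R]_2.
Local Notation mR := (measurableTypeR R).
Local Notation D := (pt @^-1` (@That R)).

(** Positivity of det G is given on the closed triangle, but differentiating J_Gamma^-1 and G^-1 at
    its boundary needs it on a neighbourhood. *)
Lemma element_domain i : exists U, [/\ open U, That `<=` U, Cn_on 2 U (F i) &
  forall x, U x -> 0 < \det (gram (F i) x)].
Proof.
have [m [M [m0 mM]]] := triangulation_uniform hF.
have [[U [oU TU F2]] _ _] := triangulation_regular hF i.
exists (U `&` [set x | 0 < \det (gram (F i) x)]); split.
- apply: open_gt0 => // x Ux; exact: (Cn_on_continuous (det_gram_C1 oU F2) Ux).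
- move=> x Tx; split; first exact: TU.
  by apply: (det_gram_gt0_That m0 _ Tx) => y a Ty; have /andP[] := mM i y a Ty.
- by apply: Cn_on_sub F2 => x [].
- by move=> x [].
Qed.

Lemma element_injective i : {in That &, injective (F i)}.
Proof. by have [] := triangulation_regular hF i. Qed.

Lemma element_coercive : exists2 m : R, 0 < m & forall i x a, That x ->
  m * dot a a <= dot (jac (F i) x *m a) (jac (F i) x *m a).
Proof.
have [m [M [m0 mM]]] := triangulation_uniform hF.
by exists m => // i x a Tx; have /andP[] := mM i x a Tx.
Qed.

Lemma element_differentiable i x : That x -> differentiable (F i) x.
Proof. by have [U [_ TU F2 _]] := element_domain i; move=> /TU; exact: F2.1. Qed.

Lemma element_gradE i (u : 'cV[R]_3 -> R) (uh : E -> R) x : That x ->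
  (forall y, That y -> u (F i y) = uh y) -> differentiable uh x ->
  surface_differentiable (F i) u (F i x) /\
  surface_grad (F i) u (F i x) = covariant (F i) x (grad_hat uh x).
Proof.
move=> Tx uE du; have [m m0 mc] := element_coercive.
have di := @element_differentiable i; have inj := @element_injective i.
split; last exact: (surface_gradE m0 inj di (mc i) Tx uE du).
exists (covariant (F i) x (grad_hat uh x)).
exact: (is_surface_grad_covariant m0 inj di (mc i) Tx uE du).
Qed.

Lemma element_divE i (w : 'cV[R]_3 -> 'cV[R]_3) (wh : E -> E) x : That x ->
  (forall y, That y -> w (F i y) = contravariant (F i) y (wh y)) ->
  differentiable wh x ->
  surface_vdifferentiable (F i) w (F i x) /\
  surface_div (F i) w (F i x) = (area_density (F i) x)^-1 * div_hat wh x.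
Proof.
move=> Tx wE dw; have [U [oU TU F2 Fdet]] := element_domain i.
have wkE k y : That y -> w (F i y) k 0 = contravariant (F i) y (wh y) k 0.
  by move=> Ty; rewrite wE.
have dk k : differentiable (fun y => contravariant (F i) y (wh y) k 0) x.
  have dj l : differentiable (fun y => jac (F i) y k l) x.
    exact: (jac_C1 oU F2 k l).1 _ (TU _ Tx).
  have dwl l : differentiable (fun y => wh y l 0) x by have /differentiable_col := dw; exact.
  have ds := (inv_density_C1 oU F2 Fdet).1 _ (TU _ Tx).
  rewrite (_ : (fun y => _) = (fun y => (area_density (F i) y)^-1 *
      (jac (F i) y k 0 * wh y 0 0 + jac (F i) y k 1 * wh y 1 0))); last first.
    by apply/funext => y; rewrite mxE mulmx_col2.
  exact: (differentiableM ds (differentiableD (differentiableM (dj 0) (dwl 0))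
    (differentiableM (dj 1) (dwl 1)))).
have G k := @element_gradE i (fun q => w q k 0)
  (fun y => contravariant (F i) y (wh y) k 0) x Tx (wkE k) (dk k).
split=> [k|]; first exact: (G k).1.
rewrite -(div_contravariant oU F2 (TU _ Tx) (Fdet _ (TU _ Tx)) dw).
by apply: eq_bigr => k _; rewrite (G k).2.
Qed.

Lemma element_curlE i (U' : set E) (v : 'cV[R]_3 -> 'cV[R]_3) (vh : E -> E) :
  open U' -> That `<=` U' -> Cn_on 1 U' vh ->
  (forall x, That x -> v (F i x) = covariant (F i) x (vh x)) ->
  has_surface_curl (F i) v /\ forall x, That x ->
    surface_curl (F i) v (F i x) = (area_density (F i) x)^-1 * curl_hat vh x.
Proof.
move=> oU' TU' cv vE; have [m m0 mc] := element_coercive.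
have [U [oU TU F2 _]] := element_domain i.
exact: (surface_curlE oU TU F2 (@element_injective i) m0 (mc i) oU' TU' cv vE).
Qed.

Lemma L2_continuous (f : I -> 'cV[R]_3 -> R) (fh : I -> E -> R) :
  (forall i, {within That, continuous (fh i)}) ->
  (forall i x, That x -> f i (F i x) = fh i x) -> L2 F f.
Proof.
move=> cf fE i; have [U [oU TU F2 Fdet]] := element_domain i.
have cfF : {within That, continuous (fun x => f i (F i x))}.
  by apply: subspace_eq_continuous (cf i) => x /[!inE] Tx; exact/esym/fE.
split.
  apply: (@within_continuous_measurable2 R D (fun z => f i (F i (pt z)))).
    exact: measurable_That.
  apply: (@within_continuous_comp _ _ _ D That pt) cfF => //.
  by apply: continuous_subspaceT; exact: pt_continuous.
apply: (That_integrable (f := fun x => f i (F i x) ^+ 2 * area_density (F i) x)).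
rewrite (_ : (fun x => _) = fun x => f i (F i x) * f i (F i x) * area_density (F i) x)//.
move/subspace_continuousP: cfF => cfF.
have /subspace_continuousP ca := density_continuous oU TU F2.
apply/subspace_continuousP => x Tx.
exact: (cvgM (cvgM (cfF x Tx) (cfF x Tx)) (ca x Tx)).
Qed.

Lemma L2_tangential_C1 (v : I -> 'cV[R]_3 -> 'cV[R]_3) (a : I -> E -> E)
    (vh : I -> E -> 'cV[R]_3) :
  (forall i, Cn_That 1 (vh i)) -> (forall i x, That x -> v i (F i x) = vh i x) ->
  (forall i x, That x -> vh i x = jac (F i) x *m a i x) -> L2_tangential F v.
Proof.
move=> cv vE va; split=> [i x Tx|k].
  by exists x, (a i x); split=> //; rewrite vE// va.
apply: (L2_continuous (fh := fun i x => vh i x k 0)) => [i|i x Tx]; last by rewrite vE.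
have [U [oU TU /(C1_col _ oU) ck]] := cv i.
by have := C1_continuous_on_That TU (ck k).
Qed.

End elements.

(** * Weak derivatives and the inclusions of the subcomplex *)

Section de_rham.
Context {R : realType} {I : finType}.
Variable F : I -> 'cV[R]_2 -> 'cV[R]_3.
Hypothesis hF : oriented_triangulation F.
Local Notation E := 'cV[R]_2.
Local Notation mu := (@lebesgue_measure R).

Lemma shared_edge_That i a b j c d t : shared_edge F i a b j c d -> 0 <= t <= 1 ->
  F i (edge_param a b t) = F j (edge_param c d t).
Proof. by case=> _ _ _; exact. Qed.

Lemma dot_quarter_turn (w e : E) : dot w (quarter_turn e) = - cross2 w e.
Proof. by rewrite /dot sum_I2 /cross2 !mxE/=; ring. Qed.

Lemma Cn_That_inter (W1 W2 : normedModType R) n1 n2 (f : E -> W1) (g : E -> W2) U :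
  open U -> That `<=` U -> Cn_on n1 U f -> Cn_That n2 g ->
  exists V, [/\ open V, That `<=` V, V `<=` U, Cn_on n1 V f & Cn_on n2 V g].
Proof.
move=> oU TU cf [U' [oU' TU' cg]]; exists (U `&` U'); split.
- exact: openI.
- by move=> x Tx; split; [exact: TU|exact: TU'].
- by move=> x [].
- by apply: Cn_on_sub cf => x [].
- by apply: Cn_on_sub cg => x [].
Qed.

(* [c] is the normal component [cross2] or the tangential component [dot]. *)
Lemma edge_terms0 (h : I -> E -> R) (v : I -> E -> E) (c : E -> E -> R) :
  (forall i, {within That, continuous (h i)}) ->
  (forall i k, {within That, continuous (fun x => v i x k 0)}) ->
  (exists c0 c1 : E -> R, forall u e, c u e = u 0 0 * c0 e + u 1 0 * c1 e) ->
  (forall u e, c u (- e) = - c u e) ->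
  (forall i a b j a' b' t, shared_edge F i a b j a' b' -> 0 <= t <= 1 ->
    h i (edge_param a b t) * c (v i (edge_param a b t)) (edge_dir a b) =
    h j (edge_param a' b' t) * c (v j (edge_param a' b' t)) (edge_dir a' b')) ->
  (forall i a b t, boundary_edge F i a b -> 0 <= t <= 1 ->
    h i (edge_param a b t) * c (v i (edge_param a b t)) (edge_dir a b) = 0) ->
  \sum_i \sum_(a < 3) \int[mu]_(t in `[0, 1]) (h i (edge_param a (a + 1) t) *
    c (v i (edge_param a (a + 1) t)) (edge_dir a (a + 1))) = 0.
Proof.
move=> ch cv [c0 [c1 cE]] cN shared bd.
apply: (sum_edge_integrals0 hF (p := fun i a b t =>
  h i (edge_param a b t) * c (v i (edge_param a b t)) (edge_dir a b))) => //.
- move=> i a b.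
  apply: (@continuous_on_edge R _ a b (fun x => h i x * c (v i x) (edge_dir a b))).
  move/subspace_continuousP: (ch i) => chi.
  have /subspace_continuousP cv0 := cv i 0; have /subspace_continuousP cv1 := cv i 1.
  apply/subspace_continuousP => x Tx; apply: cvgM; first exact: chi.
  rewrite cE (_ : (fun y => c _ _) = (fun y => v i y 0 0 * c0 (edge_dir a b) +
    v i y 1 0 * c1 (edge_dir a b))); last by apply/funext => y; rewrite cE.
  apply: cvgD; apply: cvgM; do ?exact: cvg_cst; [exact: cv0|exact: cv1].
- by move=> i a b t; rewrite edge_param_rev edge_dirN cN mulrN.
Qed.

Lemma edge_terms0_cross2 (h : I -> E -> R) (v : I -> E -> E) :
  (forall i, {within That, continuous (h i)}) ->
  (forall i k, {within That, continuous (fun x => v i x k 0)}) ->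
  (forall i a b j a' b' t, shared_edge F i a b j a' b' -> 0 <= t <= 1 ->
    h i (edge_param a b t) * cross2 (v i (edge_param a b t)) (edge_dir a b) =
    h j (edge_param a' b' t) * cross2 (v j (edge_param a' b' t)) (edge_dir a' b')) ->
  (forall i a b t, boundary_edge F i a b -> 0 <= t <= 1 ->
    h i (edge_param a b t) * cross2 (v i (edge_param a b t)) (edge_dir a b) = 0) ->
  \sum_i \sum_(a < 3) \int[mu]_(t in `[0, 1]) (h i (edge_param a (a + 1) t) *
    cross2 (v i (edge_param a (a + 1) t)) (edge_dir a (a + 1))) = 0.
Proof.
move=> ch cv; apply: edge_terms0 => //.
- exists (fun e => e 1 0), (fun e => - e 0 0) => u e; rewrite /cross2; ring.
- by move=> u e; rewrite /cross2 !mxE; ring.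
Qed.

Lemma edge_terms0_dot (h : I -> E -> R) (v : I -> E -> E) :
  (forall i, {within That, continuous (h i)}) ->
  (forall i k, {within That, continuous (fun x => v i x k 0)}) ->
  (forall i a b j a' b' t, shared_edge F i a b j a' b' -> 0 <= t <= 1 ->
    h i (edge_param a b t) * dot (v i (edge_param a b t)) (edge_dir a b) =
    h j (edge_param a' b' t) * dot (v j (edge_param a' b' t)) (edge_dir a' b')) ->
  (forall i a b t, boundary_edge F i a b -> 0 <= t <= 1 ->
    h i (edge_param a b t) * dot (v i (edge_param a b t)) (edge_dir a b) = 0) ->
  \sum_i \sum_(a < 3) \int[mu]_(t in `[0, 1]) (h i (edge_param a (a + 1) t) *
    dot (v i (edge_param a (a + 1) t)) (edge_dir a (a + 1))) = 0.
Proof.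
move=> ch cv; apply: edge_terms0 => //.
- exists (fun e => e 0 0), (fun e => e 1 0) => u e; exact: sum_I2.
- by move=> u e; rewrite dotNr.
Qed.

(** A test function is single-valued on the surface, so its reference traces match on shared
    edges. *)
Lemma test_function_pullback phi : test_function F phi ->
  exists h : I -> E -> R, [/\ forall i, Cn_That 1 (h i),
    forall i x, That x -> phi (F i x) = h i x,
    forall i a b j c d t, shared_edge F i a b j c d -> 0 <= t <= 1 ->
      h i (edge_param a b t) = h j (edge_param c d t) &
    forall i a b t, boundary_edge F i a b -> 0 <= t <= 1 -> h i (edge_param a b t) = 0].
Proof.
move=> [_ ph bd].
have /choice[h hP] : forall i, exists h, Cn_That 1 h /\ forall x, That x -> phi (F i x) = h x.
  by move=> i; have [h ch hE] := ph i; exists h.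
exists h; split=> [i|i|i a b j c d t s t01|i a b t b0 t01]; [exact: (hP i).1|exact: (hP i).2| |].
- rewrite -(hP i).2 -?(hP j).2; do ?exact: edge_param_That.
  by rewrite (shared_edge_That s).
- by rewrite -(hP i).2; [exact: bd|exact: edge_param_That].
Qed.

Lemma vpoly_continuous n (v : E -> E) k : is_vpoly n v ->
  {within That, continuous (fun x => v x k 0)}.
Proof.
move=> nv; apply: (C1_continuous_on_That (U := setT)) => //.
exact: is_poly_C1 (nv k).
Qed.

Lemma poly_continuous n (u : E -> R) : is_poly n u -> {within That, continuous u}.
Proof.
move=> nu; apply: (C1_continuous_on_That (U := setT)) => //.
exact: is_poly_C1 nu.
Qed.

(** On a shared edge the test function matches by single-valuedness and the normal component by its
    Bernstein coefficients. *)
Lemma V1div_weak_div d w wh :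
  (forall i, is_vpoly d (wh i)) ->
  (forall i x, That x -> w i (F i x) = contravariant (F i) x (wh i x)) ->
  (forall i a b j a' b', shared_edge F i a b j a' b' ->
        same_bernstein_coefs d
          (fun t => dot (wh i (edge_param a b t)) (quarter_turn (edge_dir a b)))
          (fun t => dot (wh j (edge_param a' b' t)) (quarter_turn (edge_dir a' b')))) ->
  weak_div F w (fun i => surface_div (F i) (w i)).
Proof.
move=> wp wE wb phi /test_function_pullback[h [ch hE hs hb]].
apply/eqP; rewrite -subr_eq0 opprK /total_integral -big_split/=; apply/eqP.
pose S i := \sum_(a < 3) \int[mu]_(t in `[0, 1]) (h i (edge_param a (a + 1) t) *
    cross2 (wh i (edge_param a (a + 1) t)) (edge_dir a (a + 1))).
transitivity (\sum_i S i).
  apply: eq_bigr => i _; have [U [oU TU F2 Fdet]] := element_domain hF i.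
  have [V [oV TV VU _ hV]] := Cn_That_inter oU TU F2 (ch i).
  have wV : Cn_on 1 V (wh i) by apply: Cn_on_sub (is_vpoly_C1 (wp i)).
  rewrite /S -(div_by_parts oV TV hV wV) addrC /surface_integral.
  congr (_ + _); apply: eq_integral_That => x Tx.
    rewrite (element_divE hF Tx (wE i) (wV.1 _ (TV _ Tx))).2 hE//.
    have s0 : area_density (F i) x != 0 by rewrite gt_eqF// area_density_gt0// Fdet//; exact: TU.
    by field.
  rewrite (element_gradE hF Tx (hE i) (hV.1 _ (TV _ Tx))).2 wE//.
  by rewrite (dot_contra_co Fdet)//; exact: TU.
apply: edge_terms0_cross2.
- by move=> i; have [U [oU TU hU]] := ch i; exact: (C1_continuous_on_That TU hU).
- by move=> i k; exact: (vpoly_continuous (wp i)).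
- move=> i a b j a' b' t s t01; rewrite (hs _ _ _ _ _ _ _ s t01); congr (_ * _).
  have := same_bernstein_eq (wb _ _ _ _ _ _ s) t01; rewrite !dot_quarter_turn.
  exact: oppr_inj.
- by move=> i a b t b0 t01; rewrite (hb _ _ _ _ b0 t01) mul0r.
Qed.

Lemma V1curl_weak_curl d v vh :
  (forall i, is_vpoly d (vh i)) ->
  (forall i x, That x -> v i (F i x) = covariant (F i) x (vh i x)) ->
  (forall i a b j a' b', shared_edge F i a b j a' b' ->
        same_bernstein_coefs d
          (fun t => dot (vh i (edge_param a b t)) (edge_dir a b))
          (fun t => dot (vh j (edge_param a' b' t)) (edge_dir a' b'))) ->
  weak_curl F v (fun i => surface_curl (F i) (v i)).
Proof.
move=> vp vE vb phi /test_function_pullback[h [ch hE hs hb]].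
apply/eqP; rewrite eq_sym -subr_eq0 /total_integral -sumrB; apply/eqP.
pose S i := \sum_(a < 3) \int[mu]_(t in `[0, 1]) (h i (edge_param a (a + 1) t) *
    dot (vh i (edge_param a (a + 1) t)) (edge_dir a (a + 1))).
transitivity (\sum_i S i).
  apply: eq_bigr => i _; have [U [oU TU F2 Fdet]] := element_domain hF i.
  have [V [oV TV VU _ hV]] := Cn_That_inter oU TU F2 (ch i).
  have vV : Cn_on 1 V (vh i) by apply: Cn_on_sub (is_vpoly_C1 (vp i)).
  rewrite /S -(curl_by_parts oV TV hV vV) /surface_integral.
  congr (_ - _); apply: eq_integral_That => x Tx.
    rewrite (element_curlE hF oV TV vV (vE i)).2// hE//.
    have s0 : area_density (F i) x != 0 by rewrite gt_eqF// area_density_gt0// Fdet//; exact: TU.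
    by field.
  rewrite (element_gradE hF Tx (hE i) (hV.1 _ (TV _ Tx))).2 vE//.
  by rewrite (dot_cross_normal Fdet)//; exact: TU.
apply: edge_terms0_dot.
- by move=> i; have [U [oU TU hU]] := ch i; exact: (C1_continuous_on_That TU hU).
- by move=> i k; exact: (vpoly_continuous (vp i)).
- move=> i a b j a' b' t s t01; rewrite (hs _ _ _ _ _ _ _ s t01); congr (_ * _).
  exact: same_bernstein_eq (vb _ _ _ _ _ _ s) t01.
- by move=> i a b t b0 t01; rewrite (hb _ _ _ _ b0 t01) mul0r.
Qed.

(** Makes the weak gradient an instance of the planar [div_by_parts], with the test field in the
    role of the flux. *)
Lemma test_field_pullback i (w : 'cV[R]_3 -> 'cV[R]_3) (h : E -> 'cV[R]_3) :
  (forall x, That x -> tangent_at (F i) (F i x) (w (F i x))) ->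
  Cn_That 1 h -> (forall x, That x -> w (F i x) = h x) ->
  exists wh, Cn_That 1 wh /\
    forall x, That x -> w (F i x) = contravariant (F i) x (wh x).
Proof.
move=> wt ch wE; have [U [oU TU F2 Fdet]] := element_domain hF i.
have [V [oV TV VU FV hV]] := Cn_That_inter oU TU F2 ch.
have Vdet x : V x -> 0 < \det (gram (F i) x) by move=> /VU; exact: Fdet.
exists (flux_pullback (F i) h); split.
  by exists V; split=> //; exact: flux_pullback_C1.
move=> x Tx; have [y [a [Ty yx wa]]] := wt x Tx.
(* Tangency is stated at some preimage of the point; injectivity makes it [x]. *)
have {}yx : y = x by apply: (element_injective hF) yx; rewrite inE.
rewrite yx in wa; have hx := etrans (esym (wE x Tx)) wa.
exact: etrans (wE x Tx) (esym (flux_pullbackK Fdet (TU x Tx) hx)).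
Qed.

(** The roles are exchanged: the Bernstein condition matches the scalar, while the flux is matched,
    or vanishes, by the conditions on the test field. *)
Lemma V0_weak_grad d u uh :
  (forall i, is_poly d (uh i)) ->
  (forall i x, That x -> u i (F i x) = uh i x) ->
  (forall i a b j a' b', shared_edge F i a b j a' b' ->
        same_bernstein_coefs d (uh i \o edge_param a b) (uh j \o edge_param a' b')) ->
  weak_grad F u (fun i => surface_grad (F i) (u i)).
Proof.
move=> up uE ub w [wt wpull ws wb].
have /choice[wh whP] : forall i, exists wh : E -> E, Cn_That 1 wh /\
    forall x, That x -> w i (F i x) = contravariant (F i) x (wh x).
  by move=> i; have [h ch hE] := wpull i; exact: test_field_pullback (wt i) ch hE.
have cw i := (whP i).1; have wE i := (whP i).2.
have fluxE i a b t : 0 <= t <= 1 ->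
    edge_flux F w i a b t = cross2 (wh i (edge_param a b t)) (edge_dir a b).
  move=> t01; have Te := edge_param_That a b t01.
  have [U [oU TU F2 Fdet]] := element_domain hF i.
  by rewrite /edge_flux wE// (contravariant_flux Fdet)//; exact: TU.
apply/eqP; rewrite -subr_eq0 opprK /total_integral -big_split/=; apply/eqP.
pose S i := \sum_(a < 3) \int[mu]_(t in `[0, 1]) (uh i (edge_param a (a + 1) t) *
    cross2 (wh i (edge_param a (a + 1) t)) (edge_dir a (a + 1))).
transitivity (\sum_i S i).
  apply: eq_bigr => i _; have [U [oU TU F2 Fdet]] := element_domain hF i.
  have [V [oV TV VU _ wV]] := Cn_That_inter oU TU F2 (cw i).
  have uV : Cn_on 1 V (uh i) by apply: Cn_on_sub (is_poly_C1 (up i)).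
  rewrite /S -(div_by_parts oV TV uV wV) /surface_integral.
  congr (_ + _); apply: eq_integral_That => x Tx.
    rewrite (element_divE hF Tx (wE i) (wV.1 _ (TV _ Tx))).2 uE//.
    have s0 : area_density (F i) x != 0 by rewrite gt_eqF// area_density_gt0// Fdet//; exact: TU.
    by field.
  rewrite (element_gradE hF Tx (uE i) (uV.1 _ (TV _ Tx))).2 wE// dotC.
  by rewrite (dot_contra_co Fdet)//; exact: TU.
apply: edge_terms0_cross2.
- by move=> i; exact: (poly_continuous (up i)).
- move=> i k; have [V [oV TV /(C1_col _ oV) wV]] := cw i.
  exact: (C1_continuous_on_That TV (wV k)).
- move=> i a b j a' b' t s t01.
  rewrite -(fluxE i a b t t01) -(fluxE j a' b' t t01) (ws _ _ _ _ _ _ _ s t01).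
  by congr (_ * _); exact: same_bernstein_eq (ub _ _ _ _ _ _ s) t01.
- by move=> i a b t b0 t01; rewrite -(fluxE i a b t t01) (wb _ _ _ _ b0 t01) mulr0.
Qed.

Lemma covariant_L2 (v : I -> 'cV[R]_3 -> 'cV[R]_3) n vh :
  (forall i, is_vpoly n (vh i)) ->
  (forall i x, That x -> v i (F i x) = covariant (F i) x (vh i x)) -> L2_tangential F v.
Proof.
move=> vp vE.
apply: (L2_tangential_C1 hF (a := fun i x => invmx (gram (F i) x) *m vh i x) _ vE).
  move=> i; have [U [oU TU F2 Fdet]] := element_domain hF i.
  exists U; split=> //; apply: (covariant_C1 oU F2 Fdet).
  by apply: Cn_on_sub (is_vpoly_C1 (vp i)).
by move=> i x Tx; rewrite /covariant mulmxA.
Qed.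

Lemma contravariant_L2 (w : I -> 'cV[R]_3 -> 'cV[R]_3) n wh :
  (forall i, is_vpoly n (wh i)) ->
  (forall i x, That x -> w i (F i x) = contravariant (F i) x (wh i x)) -> L2_tangential F w.
Proof.
move=> wp wE.
apply: (L2_tangential_C1 hF (a := fun i x => (area_density (F i) x)^-1 *: wh i x) _ wE).
  move=> i; have [U [oU TU F2 Fdet]] := element_domain hF i.
  exists U; split=> //; apply: (contravariant_C1 oU F2 Fdet).
  by apply: Cn_on_sub (is_vpoly_C1 (wp i)).
by move=> i x Tx; rewrite /contravariant scalemxAr.
Qed.

Lemma V2_square_integrable d q : V2 F d q -> L2 F q.
Proof.
move=> [qh [qp qE]]; apply: (L2_continuous hF _ qE) => i.
have [U [oU TU F2 Fdet]] := element_domain hF i.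
apply: (C1_continuous_on_That TU); apply: (C1M oU (inv_density_C1 oU F2 Fdet)).
by apply: Cn_on_sub (is_poly_C1 (qp i)).
Qed.

Lemma curl_grad_hat n (f : E -> R) x : is_poly n f -> curl_hat (grad_hat f) x = 0.
Proof.
move=> nf; have nf2 : is_poly n.+1 f by apply: is_polyW nf; exact: leqnSn.
have gE k : (fun y => grad_hat f y k 0) = (fun y => 'D_(basis k) f y).
  by apply/funext => y; rewrite mxE.
have df k : differentiable ('D_(basis k) f) x.
  exact: is_poly_differentiable (is_poly_derive k nf2).
rewrite /curl_hat !gE (derive_symmetric _ (df 1) (df 0)) ?subrr//.
by near=> y; exact: is_poly_differentiable nf.
Unshelve. all: by end_near. Qed.

Lemma grad_hat_poly n (f : E -> R) : is_poly n.+1 f -> is_vpoly n (grad_hat f).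
Proof.
by move=> nf k; apply: (eq_is_poly _ (is_poly_derive k nf)) => x; rewrite mxE.
Qed.

Lemma curl_hat_poly n (v : E -> E) : is_vpoly n.+1 v -> is_poly n (curl_hat v).
Proof. by move=> nv; apply: is_polyB; exact: is_poly_derive. Qed.

Lemma div_hat_poly n (w : E -> E) : is_vpoly n.+1 w -> is_poly n (div_hat w).
Proof.
move=> nw; apply: (eq_is_poly (g := fun x => 'D_(basis 0) (fun y => w y 0 0) x +
  'D_(basis 1) (fun y => w y 1 0) x)) => [x|]; first exact: sum_I2.
by apply: is_polyD; exact: is_poly_derive.
Qed.

Section degree.
Variable d : nat.

(** The degree of the complex is [d.+1] from here on, so that the predecessor in [V2] is [d] and
    potentials have degree [d.+2]. *)
Lemma surface_grad_V0 u uh : (forall i, is_poly d.+2 (uh i)) ->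
  (forall i x, That x -> u i (F i x) = uh i x) ->
  forall i x, That x ->
    surface_grad (F i) (u i) (F i x) = covariant (F i) x (grad_hat (uh i) x).
Proof.
move=> up uE i x Tx; apply: (element_gradE hF Tx (uE i) _).2.
exact: is_poly_differentiable (up i).
Qed.

Lemma V0_in_H1 u : V0 F d.+1 u -> H1 F u.
Proof.
move=> [uh [up uE ub]]; split.
  by apply: (L2_continuous hF _ uE) => i; exact: (poly_continuous (up i)).
exists (fun i => surface_grad (F i) (u i)); last exact: V0_weak_grad up uE ub.
exact: covariant_L2 (fun i => grad_hat_poly (up i)) (surface_grad_V0 up uE).
Qed.

(** Equal coefficients give equal traces on [0,1], hence one polynomial for both sides. Its
    derivative is the tangential component on either side and has degree at most [d.+1], so it has a
    Bernstein expansion of that degree. *)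
Lemma grad_V0_in_V1curl u : V0 F d.+1 u ->
  V1curl F d.+1 (fun i => surface_grad (F i) (u i)).
Proof.
move=> [uh [up uE ub]]; exists (fun i => grad_hat (uh i)); split.
- by move=> i; exact: grad_hat_poly.
- exact: surface_grad_V0 up uE.
- move=> i a b j a' b' s.
  have [P sP PE] := is_poly_edge a b (up i).
  have [Q _ QE] := is_poly_edge a' b' (up j).
  have PQ : P = Q.
    apply: poly_eq_on01 => t t01; rewrite -PE -QE.
    exact: same_bernstein_eq (ub _ _ _ _ _ _ s) t01.
  have du k x : differentiable (uh k) x := is_poly_differentiable x (up k).
  apply: (@same_bernstein_horner _ _ P^`()) => [|t _|t _].
  + by apply: (leq_trans (size_poly _ _)); case: (size P) sP.
  + by apply: derive_edge_horner => //; exact: du.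
  + by rewrite PQ; apply: derive_edge_horner => //; exact: du.
Qed.

(** Both claims are proved together because membership of the curl in [V2] supplies the square
    integrability of the weak curl. *)
Lemma V1curl_in_Hcurl v : V1curl F d.+1 v ->
  V2 F d.+1 (fun i => surface_curl (F i) (v i)) /\ Hcurl F v.
Proof.
move=> [vh [vp vE vb]].
have c2 : V2 F d.+1 (fun i => surface_curl (F i) (v i)).
  exists (fun i => curl_hat (vh i)); split=> [i|i x Tx]; first exact: curl_hat_poly.
  exact: (element_curlE hF openT _ (is_vpoly_C1 (vp i)) (vE i)).2.
split=> //; split; first exact: covariant_L2 vp vE.
exists (fun i => surface_curl (F i) (v i)); first exact: V2_square_integrable c2.
exact: V1curl_weak_curl vp vE vb.
Qed.

Lemma V1div_in_Hdiv w : V1div F d.+1 w ->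
  V2 F d.+1 (fun i => surface_div (F i) (w i)) /\ Hdiv F w.
Proof.
move=> [wh [wp wE wb]].
have d2 : V2 F d.+1 (fun i => surface_div (F i) (w i)).
  exists (fun i => div_hat (wh i)); split=> [i|i x Tx]; first exact: div_hat_poly.
  exact: (element_divE hF Tx (wE i) ((is_vpoly_C1 (wp i)).1 x Logic.I)).2.
split=> //; split; first exact: contravariant_L2 wp wE.
exists (fun i => surface_div (F i) (w i)); first exact: V2_square_integrable d2.
exact: V1div_weak_div wp wE wb.
Qed.

Lemma surface_curl_grad0 u : V0 F d.+1 u -> forall i p, curved_triangle (F i) p ->
  surface_curl (F i) (surface_grad (F i) (u i)) p = 0.
Proof.
move=> [uh [up uE ub]] i _ [x Tx <-].
have gp := grad_hat_poly (up i).
rewrite (element_curlE hF openT _ (is_vpoly_C1 gp) (surface_grad_V0 up uE i)).2//.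
by rewrite (curl_grad_hat x (up i)) mulr0.
Qed.

End degree.

End de_rham.

Lemma smooth_C1 {R : realType} {W : normedModType R} (f : 'cV[R]_2 -> W) :
  smooth_That f -> Cn_That 1 f.
Proof. by move=> [U [oU TU cf]]; exists U; split=> //; exact: cf. Qed.

Theorem theorem7p3 (R : realType) (I : finType)
    (F : I -> 'cV[R]_2 -> 'cV[R]_3) (hF : oriented_triangulation F) :
  [/\ forall i (u : 'cV[R]_3 -> R) (uh : 'cV[R]_2 -> R),
        smooth_That uh ->
        (forall x, That x -> u (F i x) = uh x) ->
        forall x, That x ->
          surface_differentiable (F i) u (F i x) /\
          surface_grad (F i) u (F i x) =
            jac (F i) x *m invmx (gram (F i) x) *m grad_hat uh x,
      forall i (v : 'cV[R]_3 -> 'cV[R]_3) (vh : 'cV[R]_2 -> 'cV[R]_2),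
        smooth_That vh ->
        (forall x, That x ->
           v (F i x) = jac (F i) x *m invmx (gram (F i) x) *m vh x) ->
        has_surface_curl (F i) v /\
        forall x, That x ->
          surface_curl (F i) v (F i x) =
            (area_density (F i) x)^-1 * curl_hat vh x,
      forall i (w : 'cV[R]_3 -> 'cV[R]_3) (wh : 'cV[R]_2 -> 'cV[R]_2),
        smooth_That wh ->
        (forall x, That x ->
           w (F i x) = (area_density (F i) x)^-1 *: (jac (F i) x *m wh x)) ->
        forall x, That x ->
          surface_vdifferentiable (F i) w (F i x) /\
          surface_div (F i) w (F i x) =
            (area_density (F i) x)^-1 * div_hat wh x &
      forall d : nat, (1 <= d)%N -> de_rham_subcomplex F d].
Proof.
split.
- move=> i u uh /smooth_C1[U [_ TU cu]] uE x Tx.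
  exact: (element_gradE hF Tx uE (cu.1 _ (TU _ Tx))).
- by move=> i v vh /smooth_C1[U [oU TU cv]] vE; exact: (element_curlE hF oU TU cv vE).
- move=> i w wh /smooth_C1[U [_ TU cw]] wE x Tx.
  exact: (element_divE hF Tx wE (cw.1 _ (TU _ Tx))).
- case=> // d _; split.
  + by move=> u; exact: V0_in_H1.
  + by move=> v /(V1curl_in_Hcurl hF)[].
  + by move=> w /(V1div_in_Hdiv hF)[].
  + by move=> q; exact: V2_square_integrable.
  + by move=> u; exact: grad_V0_in_V1curl.
  + by move=> v /(V1curl_in_Hcurl hF)[].
  + by move=> w /(V1div_in_Hdiv hF)[].
  + by move=> u; exact: surface_curl_grad0.
Qed.
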